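(* Let $(X,\{w_j\}_{j=1}^m,\{p_j\}_{j=1}^m)$ be a nonexpansive system in which at least one $w_j$ is weakly contractive, let $K$ be its invariant set, let $T:C(K)\to C(K)$ be its Ruelle operator, and let $\varrho$ be the spectral radius of $T$. Suppose $$\sup_{x\in K}\ \sum_{j=1}^m p_j(x)\,\sup_{y\in K,\ y\neq x}\frac{|w_j(x)-w_j(y)|}{|x-y|}<\varrho .$$ Then the Ruelle operator theorem holds for this system.
   Context: Let $X\subseteq\mathbb{R}^d$ be a nonempty compact set. A map $w:X\to X$ is nonexpansive if $|w(x)-w(y)|\le|x-y|$ for all $x,y\in X$, and weakly contractive if $\sup_{x,y\in X,\,|x-y|\le t}|w(x)-w(y)|<t$ for all $t>0$. A function $p$ on $X$ is Dini continuous if $\int_0^1\frac{\alpha_p(t)}{t}\,dt<\infty$, where $\alpha_p(t)=\sup_{x,y\in X,\,|x-y|\le t}|p(x)-p(y)|$. A nonexpansive system $(X,\{w_j\}_{j=1}^m,\{p_j\}_{j=1}^m)$ consists of nonexpansive maps $w_j:X\to X$ and positive Dini continuous functions $p_j:X\to(0,\infty)$, $1\le j\le m$. If at least one $w_j$ is weakly contractive, there is a unique smallest nonempty compact set $K\subseteq X$ with $K=\bigcup_{j=1}^m w_j(K)$; this is the invariant set of the system. The Ruelle operator is $T:C(K)\to C(K)$, $Tf(x)=\sum_{j=1}^m p_j(x)f(w_j(x))$, where $C(K)$ is the space of continuous functions on $K$ with the supremum norm. $T^*$ denotes the dual operator on the space $M(K)$ of finite Borel measures on $K$, and $\langle\mu,f\rangle=\int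 f\,d\mu$. The Ruelle operator theorem holds for the system if there exist a unique positive function $h\in C(K)$ and a unique probability measure $\mu\in M(K)$ such that $Th=\varrho h$, $T^*\mu=\varrho\mu$, $\langle\mu,h\rangle=1$, and for every $f\in C(K)$, $\varrho^{-n}T^nf$ converges to $\langle\mu,f\rangle h$ in the supremum norm. Convention: a supremum over the empty set is $0$ (relevant only if $K$ is a single point). *)

(* Defs.v *)
From HB Require Import structures.
From mathcomp Require Import all_boot all_order all_algebra.
From mathcomp Require Import all_classical all_reals all_analysis.
From mathcomp Require Import complex.

Set Implicit Arguments.
Unset Strict Implicit.
Unset Printing Implicit Defensive.
Import Order.TTheory GRing.Theory Num.Theory.
Import numFieldNormedType.Exports.

Local Open Scope classical_set_scope.
Local Open Scope ring_scope.

(* Maps on a subset of R^d are total functions on 'rV[R]_d; every notion below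
   only looks at their values on the subset in question. *)

(* The norm `|x| of 'rV[R]_d is the maximum norm, so the Euclidean norm is
   defined here. It induces the same topology, so the library's compact, open
   and continuous can be used as they are. *)
Definition enorm (R : realType) (d : nat) (x : 'rV[R]_d) : R :=
  Num.sqrt (\sum_(i < d) x ord0 i ^+ 2).

(* Extended-real valued, since the supremum is infinite if f is unbounded. *)
Definition modulus (R : realType) (d e : nat) (X : set 'rV[R]_d)
    (f : 'rV[R]_d -> 'rV[R]_e) (t : R) : \bar R :=
  ereal_sup [set z | exists x y, [/\ X x, X y, enorm (x - y) <= t
                                   & z = (enorm (f x - f y))%:E]].

Definition modulus_scalar (R : realType) (d : nat) (X : set 'rV[R]_d)
    (p : 'rV[R]_d -> R) (t : R) : \bar R :=
  ereal_sup [set z | exists x y, [/\ X x, X y, enorm (x - y) <= t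
                                   & z = (`|p x - p y|)%:E]].

Definition nonexpansive (R : realType) (d : nat) (X : set 'rV[R]_d)
    (w : 'rV[R]_d -> 'rV[R]_d) : Prop :=
  forall x y, X x -> X y -> enorm (w x - w y) <= enorm (x - y).

Definition weakly_contractive (R : realType) (d : nat) (X : set 'rV[R]_d)
    (w : 'rV[R]_d -> 'rV[R]_d) : Prop :=
  forall t : R, 0 < t -> (modulus X w t < t%:E)%E.

Definition dini_continuous (R : realType) (d : nat) (X : set 'rV[R]_d)
    (p : 'rV[R]_d -> R) : Prop :=
  (\int[lebesgue_measure]_(t in `]0%R, 1%R])
      (modulus_scalar X p t * (t^-1)%:E) < +oo)%E.

Record nonexpansive_system (R : realType) (d m : nat) (X : set 'rV[R]_d)
    (w : 'I_m -> 'rV[R]_d -> 'rV[R]_d) (p : 'I_m -> 'rV[R]_d -> R) : Prop := {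
  system_nonempty : X !=set0 ;
  system_compact : compact X ;
  system_maps : forall j x, X x -> X (w j x) ;
  system_nonexpansive : forall j, nonexpansive X (w j) ;
  system_pos : forall j x, X x -> 0 < p j x ;
  system_dini : forall j, dini_continuous X (p j) }.

Definition self_similar (R : realType) (d m : nat) (X : set 'rV[R]_d)
    (w : 'I_m -> 'rV[R]_d -> 'rV[R]_d) (K : set 'rV[R]_d) : Prop :=
  [/\ K !=set0, compact K, K `<=` X & K = \bigcup_j (w j @` K)].

Definition invariant_set (R : realType) (d m : nat) (X : set 'rV[R]_d)
    (w : 'I_m -> 'rV[R]_d -> 'rV[R]_d) (K : set 'rV[R]_d) : Prop :=
  self_similar X w K /\ forall L, self_similar X w L -> K `<=` L.

(* f represents an element of C(K); two functions that agree on K represent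
   the same element. *)
Definition CK (R : realType) (d : nat) (K : set 'rV[R]_d)
    (f : 'rV[R]_d -> R) : Prop := {within K, continuous f}.

Definition supnorm (R : realType) (d : nat) (K : set 'rV[R]_d)
    (f : 'rV[R]_d -> R) : R := sup [set `|f x| | x in K].

Definition ruelle (R : realType) (d m : nat)
    (w : 'I_m -> 'rV[R]_d -> 'rV[R]_d) (p : 'I_m -> 'rV[R]_d -> R)
    (f : 'rV[R]_d -> R) : 'rV[R]_d -> R :=
  fun x => \sum_(j < m) p j x * f (w j x).

(* The spectrum of an operator on the real space C(K) is, as usual, that of its
   complexification on C(K) + i C(K), the complex continuous functions. *)
Definition CKC (R : realType) (d : nat) (K : set 'rV[R]_d)
    (f : 'rV[R]_d -> R[i]) : Prop :=
  CK K (fun x => complex.Re (f x)) /\ CK K (fun x => complex.Im (f x)).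

Definition supnormC (R : realType) (d : nat) (K : set 'rV[R]_d)
    (f : 'rV[R]_d -> R[i]) : R := sup [set ComplexField.Normc.normc (f x) | x in K].

Definition complexify (R : realType) (d : nat)
    (T : ('rV[R]_d -> R) -> 'rV[R]_d -> R) (f : 'rV[R]_d -> R[i]) :
    'rV[R]_d -> R[i] :=
  fun x => Complex (T (fun y => complex.Re (f y)) x)
                   (T (fun y => complex.Im (f y)) x).

(* l - T is a bijection of the complex C(K) with bounded inverse. *)
Definition resolvent_set (R : realType) (d : nat) (K : set 'rV[R]_d)
    (T : ('rV[R]_d -> R) -> 'rV[R]_d -> R) (l : R[i]) : Prop :=
  let S f x := l * f x - complexify T f x in
  [/\ (forall f1 f2, CKC K f1 -> CKC K f2 -> {in K, S f1 =1 S f2} ->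
         {in K, f1 =1 f2}),
      (forall g, CKC K g -> exists2 f, CKC K f & {in K, S f =1 g})
    & exists M : R, forall f, CKC K f -> supnormC K f <= M * supnormC K (S f)].

Definition spectral_radius (R : realType) (d : nat) (K : set 'rV[R]_d)
    (T : ('rV[R]_d -> R) -> 'rV[R]_d -> R) : R :=
  sup [set ComplexField.Normc.normc l | l in ~` resolvent_set K T].

(* Real suprema, for which the supremum of the empty set is 0; both sets are
   bounded above when the w j are nonexpansive and the p j are bounded on K. *)
Definition lipschitz_at (R : realType) (d : nat) (K : set 'rV[R]_d)
    (w : 'rV[R]_d -> 'rV[R]_d) (x : 'rV[R]_d) : R :=
  sup [set enorm (w x - w y) / enorm (x - y) | y in K `\ x].

Definition average_lipschitz (R : realType) (d m : nat) (K : set 'rV[R]_d)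
    (w : 'I_m -> 'rV[R]_d -> 'rV[R]_d) (p : 'I_m -> 'rV[R]_d -> R) : R :=
  sup [set \sum_(j < m) p j x * lipschitz_at K (w j) x | x in K].

Definition borel (R : realType) (d : nat) : measurableType _ :=
  g_sigma_algebraType (@open 'rV[R]_d).

(* A probability measure on K is a Borel probability measure mu on R^d with
   mu K = 1. *)
Definition pairing (R : realType) (d : nat) (K : set 'rV[R]_d)
    (mu : probability (borel R d) R) (f : 'rV[R]_d -> R) : R :=
  \int[mu]_(x in K) f x.

Definition ruelle_data (R : realType) (d : nat) (K : set 'rV[R]_d)
    (T : ('rV[R]_d -> R) -> 'rV[R]_d -> R) (rho : R)
    (h : 'rV[R]_d -> R) (mu : probability (borel R d) R) : Prop :=
  [/\ CK K h /\ (forall x, K x -> 0 < h x),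
      mu K = 1%E,
      {in K, T h =1 (fun x => rho * h x)},
      (* the dual operator is given by <T* mu, f> = <mu, T f> *)
      (forall f, CK K f -> pairing K mu (T f) = rho * pairing K mu f)
    & pairing K mu h = 1 /\
      forall f, CK K f ->
        (fun n => supnorm K
           (fun x => rho ^- n * iter n T f x - pairing K mu f * h x))
          @ \oo --> (0 : R)].

Definition ruelle_operator_theorem (R : realType) (d : nat)
    (K : set 'rV[R]_d) (T : ('rV[R]_d -> R) -> 'rV[R]_d -> R) (rho : R) : Prop :=
  exists (h : 'rV[R]_d -> R) (mu : probability (borel R d) R),
    ruelle_data K T rho h mu /\
    forall h' mu', ruelle_data K T rho h' mu' ->
      {in K, h' =1 h} /\ (forall A, measurable A -> mu' A = mu A).

(* Main.v *)
From HB Require Import structures.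
Require Import Defs.
From mathcomp Require Import all_boot all_order all_algebra.
From mathcomp Require Import all_classical all_reals all_analysis.
From mathcomp Require Import measurable_realfun complex ring lra.

Set Implicit Arguments.
Unset Strict Implicit.
Unset Printing Implicit Defensive.
Import Order.TTheory GRing.Theory Num.Theory.
Import numFieldNormedType.Exports.

Local Open Scope classical_set_scope.
Local Open Scope ring_scope.

(** Write rho for the spectral radius, q_j = p_j / rho, L for the operator with
    weights q_j and 1 for the constant function. The hypothesis says that
    sum_j q_j(x) |w_j x - w_j y| <= lam |x - y| with lam < 1: the w_j contract on
    average, although each of them may be an isometry.

    Fix lam < th < 1. Running two orbits along the same word, either their
    distance stays below th^k at time k, in which case Dini continuity makes the
    ratio of the weights close to 1 in a summable way, or it exceeds th^k for the
    first time at some k, and the total weight of these words is at most a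
    geometric error (lam / th)^k times the sup of a later iterate. At a time n when
    the sup of L^n 1 is a record the later iterates are controlled, so L^n 1 has
    bounded distortion; since the spectral radius of L is 1, sup L^n 1 >= 1 and
    inf L^n 1 <= 1 for all n, whence L^n 1 stays between two positive constants. The
    same estimate makes (L^n f)_n equicontinuous for every continuous f.

    A limit of Cesaro means of L^n 1 is a positive eigenfunction h, and conjugating
    by h turns L into a Markov operator. Weak contractivity of one w_j makes the
    words of a fixed length carry every point of K close to every point of K, so
    the oscillation of the Markov iterates tends to 0. The limits define a positive
    functional on C(K), represented by a measure through Daniell's construction. *)

(** Both inequalities lam < th < 1 matter: th < 1 makes the distortion of the weights summable over
    the scales th^k, and lam < th makes the weight of the exceptional words geometric, by Markov's
    inequality. That weight still multiplies a later iterate of 1, which is not yet known to be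
    bounded. Hence the record time, and hence a shift of all thresholds by a factor th^-l: it makes
    the whole error at most half of the quantity to be bounded, at the cost of a fixed factor exp((l
    |B0| + S) / c0), because the first l steps are compared only crudely.

    The spectral radius is defined through the complex resolvent, whereas the argument uses just two
    real inequalities: sup T^n 1 >= rho^n and inf T^n 1 <= rho^n. Both follow once rho is known to
    be the infimum of the exponential growth rates of T^n 1. A Neumann series shows that rho is at
    most this infimum; conversely, positivity of the weights places the infimum itself in the
    spectrum. *)

(** * Comparison of the Euclidean norm with the maximum norm *)

Section EuclideanNorm.
Context (R : realType) (d : nat).
Implicit Types x y : 'rV[R]_d.

Lemma enorm_ge0 x : 0 <= enorm x.
Proof. exact: sqrtr_ge0. Qed.

Lemma norm_le_enorm x : `|x| <= enorm x.
Proof.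
rewrite [`|x|]mx_normrE; apply: bigmax_le => [|[i j] _ /=]; first exact: enorm_ge0.
rewrite (ord1 i) -sqrtr_sqr ler_wsqrtr // (bigD1 j) //= lerDl.
by apply: sumr_ge0 => k _; exact: sqr_ge0.
Qed.

Lemma enorm_le_norm x : enorm x <= d%:R * `|x|.
Proof.
rewrite -[leRHS]ger0_norm ?mulr_ge0 // -sqrtr_sqr ler_wsqrtr // exprMn.
apply: (@le_trans _ _ (\sum_(i < d) `|x| ^+ 2)).
  apply: ler_sum => i _; rewrite -[leLHS]ger0_norm ?sqr_ge0 // normrX.
  rewrite lerXn2r ?nnegrE // [leRHS]mx_normrE.
  exact: (le_bigmax _ (fun ij : 'I_1 * 'I_d => `|x ij.1 ij.2|) (ord0, i)).
rewrite sumr_const card_ord -[_ *+ d]mulr_natl.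
apply: ler_wpM2r; rewrite ?sqr_ge0 //.
by rewrite -natrX ler_nat; case: (d) => // n; rewrite leq_pmull.
Qed.

Lemma enorm_eq0 x : (enorm x == 0) = (x == 0).
Proof.
apply/eqP/eqP => [x0|->]; last by rewrite /enorm big1 ?sqrtr0 // => i _; rewrite mxE expr0n.
by apply/eqP; rewrite -normr_le0 -x0 norm_le_enorm.
Qed.

Lemma enorm_small (e : R) : 0 < e ->
  exists2 r : R, 0 < r & forall x, `|x| <= r -> enorm x <= e.
Proof.
(* [d%:R + 1] instead of [d%:R] keeps the divisor positive in dimension 0. *)
move=> e0; have d0 : 0 < d%:R + 1 :> R by rewrite ltr_wpDl.
exists (e / (d%:R + 1)) => [|x xr]; first by rewrite divr_gt0.
apply: (le_trans (enorm_le_norm x)).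
apply: (@le_trans _ _ ((d%:R + 1) * `|x|)); first by rewrite ler_wpM2r // lerDl.
by rewrite mulrC -ler_pdivlMr.
Qed.

End EuclideanNorm.

Lemma nbhs_dist_lt (R : realType) (d : nat) (x : 'rV[R]_d) (r : R) :
  0 < r -> nbhs x [set y | `|x - y| < r].
Proof. by move=> r0; apply/nbhs_ballP; exists r => //= y; rewrite mx_norm_ball. Qed.

(** * Continuous functions on a compact set *)

Section UniformContinuity.
Context (R : realType) (d : nat) (K : set 'rV[R]_d).
Hypothesis cK : compact K.
Implicit Types f g : 'rV[R]_d -> R.

(** On a compact set this is equivalent to [CK]. Most closure properties of [CK] are proved in this
    form, in the norm for which the maps are nonexpansive. *)
Definition ucont f := forall e : R, 0 < e -> exists2 r : R, 0 < r &
  forall x y, K x -> K y -> enorm (x - y) <= r -> `|f x - f y| <= e.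

Lemma ucont_CK f : ucont f -> CK K f.
Proof.
move=> uf; apply/subspace_continuousP => x Kx.
apply/cvgrPdist_le => e /uf[r r0 fr].
have [s s0 sr] := enorm_small d r0.
near=> y; apply: fr => //; first by near: y; exact: withinT.
apply: sr; near: y; apply: cvg_within.
by apply: filterS (nbhs_dist_lt x s0) => y /ltW.
Unshelve. all: by end_near. Qed.

(** Heine-Cantor, from the near-covering form of compactness with the radius as a parameter tending
    to 0 from the right. *)
Lemma CK_ucont f : CK K f -> ucont f.
Proof.
move=> /subspace_continuousP cf e e0.
have /near_covering_withinP cov := (compact_near_coveringP K).1 cK.
have e2 : 0 < e / 2 by rewrite divr_gt0.
have A : \forall r \near (0:R)^'+, K `<=`
    (fun x => forall y, K y -> enorm (x - y) <= r -> `|f x - f y| <= e).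
  apply: (cov R (0:R)^'+ (fun r x => forall y, K y -> enorm (x - y) <= r -> `|f x - f y| <= e)).
  move=> x Kx; have /cvgrPdist_le/(_ _ e2) := cf x Kx.
  rewrite /prop_near1 /within /= => /nbhs_normP[r /= r0 fr].
  (* Half of [r] for the point and half for the radius: then both [z] and [y] lie within [r] of
     [x]. *)
  exists ([set z | `|x - z| < r / 2], [set s | s < r / 2]) => /=.
    split; first by apply: nbhs_dist_lt; rewrite divr_gt0.
    by apply: nbhs_right_lt; rewrite divr_gt0.
  move=> [z s] /= [xz sr] Kz y Ky zy.
  have := fr z; have := fr y; rewrite /= => /(_ _ Ky) + /(_ _ Kz).
  have zy' : `|z - y| < r / 2 by apply: le_lt_trans sr; apply: le_trans zy; exact: norm_le_enorm.
  have xy : `|x - y| < r.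
    have -> : x - y = (x - z) + (z - y) by rewrite addrA subrK.
    by apply: (le_lt_trans (ler_normD _ _)); lra.
  have xzr : `|x - z| < r by lra.
  move=> /(_ xy) A /(_ xzr) B.
  have -> : f z - f y = (f x - f y) - (f x - f z) by ring.
  by apply: (le_trans (ler_normB _ _)); lra.
have : \forall r \near 0^'+, 0 < r /\ K `<=`
    (fun x => forall y, K y -> enorm (x - y) <= r -> `|f x - f y| <= e).
  near=> r; split; near: r; [exact: nbhs_right_gt | by []].
by move=> /filter_ex[r [r0 fr]]; exists r => // x y Kx Ky; exact: fr.
Unshelve. all: by end_near. Qed.

Lemma CK_max f : K !=set0 -> CK K f -> exists2 c, K c & forall x, K x -> f x <= f c.
Proof.
move=> K0 cf; have [c cK' fc] := EVT_max_rV K0 cK cf.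
by rewrite inE in cK'; exists c => // x Kx; apply: fc; rewrite inE.
Qed.

Lemma CK_min f : K !=set0 -> CK K f -> exists2 c, K c & forall x, K x -> f c <= f x.
Proof.
move=> K0 cf; have [c cK' fc] := EVT_min_rV K0 cK cf.
by rewrite inE in cK'; exists c => // x Kx; apply: fc; rewrite inE.
Qed.

Lemma CK_bounded f : CK K f -> exists2 M, 0 < M & forall x, K x -> `|f x| <= M.
Proof.
move=> cf; have [K0|] := pselect (K !=set0); last first.
  by move=> K0; exists 1 => // x Kx; exfalso; apply: K0; exists x.
have [a Ka fa] := CK_max K0 cf; have [b Kb fb] := CK_min K0 cf.
exists (1 + `|f a| + `|f b|) => [|x Kx]; first by rewrite ltr_wpDr // ltr_wpDr.
have := fa _ Kx; have := fb _ Kx.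
have := ler_norm (f a); have := ler_norm (- f b); rewrite normrN.
have := normr_ge0 (f a); have := normr_ge0 (f b).
by rewrite ler_norml => *; apply/andP; split; lra.
Qed.

Lemma CK_eq f g : (forall x, K x -> f x = g x) -> CK K f -> CK K g.
Proof.
move=> fg /CK_ucont uf; apply: ucont_CK => e /uf[r r0 fr]; exists r => // x y Kx Ky.
by rewrite -!fg //; exact: fr.
Qed.

Lemma CK_cst (c : R) : CK K (fun=> c).
Proof. by apply: ucont_CK => e e0; exists 1 => // *; rewrite subrr normr0 ltW. Qed.

Lemma CK_add f g : CK K f -> CK K g -> CK K (fun x => f x + g x).
Proof.
move=> /CK_ucont uf /CK_ucont ug; apply: ucont_CK => e e0.
have e2 : 0 < e / 2 by rewrite divr_gt0.
have [r r0 fr] := uf _ e2; have [s s0 gs] := ug _ e2.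
exists (Num.min r s) => [|x y Kx Ky]; first by rewrite lt_min r0.
rewrite le_min => /andP[xr xs].
have := fr _ _ Kx Ky xr; have := gs _ _ Kx Ky xs.
have -> : f x + g x - (f y + g y) = (f x - f y) + (g x - g y) by ring.
by move=> A B; apply: (le_trans (ler_normD _ _)); lra.
Qed.

Lemma CK_mul f g : CK K f -> CK K g -> CK K (fun x => f x * g x).
Proof.
move=> cf cg; have [M M0 fM] := CK_bounded cf; have [N N0 gN] := CK_bounded cg.
move: cf cg => /CK_ucont uf /CK_ucont ug; apply: ucont_CK => e e0.
have eN : 0 < e / 2 / N by rewrite !divr_gt0.
have eM : 0 < e / 2 / M by rewrite !divr_gt0.
have [r r0 fr] := uf _ eN; have [s s0 gs] := ug _ eM.
exists (Num.min r s) => [|x y Kx Ky]; first by rewrite lt_min r0.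
rewrite le_min => /andP[xr xs].
have := fr _ _ Kx Ky xr; have := gs _ _ Kx Ky xs.
have -> : f x * g x - f y * g y = (f x - f y) * g x + f y * (g x - g y) by ring.
move=> A B; apply: (le_trans (ler_normD _ _)); rewrite !normrM.
have -> : e = e / 2 / N * N + M * (e / 2 / M) by field; rewrite !gt_eqF.
by apply: lerD; apply: ler_pM => //; [exact: gN | exact: fM].
Qed.

Lemma CK_scale (c : R) f : CK K f -> CK K (fun x => c * f x).
Proof. by move=> cf; apply: CK_mul => //; exact: CK_cst. Qed.


Lemma CK_opp f : CK K f -> CK K (fun x => - f x).
Proof.
by move=> cf; apply: CK_eq; last exact: (CK_scale (c := -1) cf); move=> x _ /=; rewrite mulN1r.
Qed.

Lemma CK_sub f g : CK K f -> CK K g -> CK K (fun x => f x - g x).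
Proof. by move=> cf cg; apply: CK_add => //; exact: CK_opp. Qed.

Lemma CK_exp f n : CK K f -> CK K (fun x => f x ^+ n).
Proof.
move=> cf; elim: n => [|n IH]; first exact: CK_cst.
by apply: CK_eq (CK_mul cf IH) => x _; rewrite exprS.
Qed.

Lemma CK_sum (I : Type) (r : seq I) (F : I -> 'rV[R]_d -> R) :
  (forall i, CK K (F i)) -> CK K (fun x => \sum_(i <- r) F i x).
Proof.
move=> cF; elim: r => [|i r IH].
  by apply: CK_eq; last exact: (CK_cst (c := 0)); move=> x _; rewrite big_nil.
by apply: CK_eq (CK_add (cF i) IH) => x _; rewrite big_cons.
Qed.

Lemma CK_inv f : CK K f -> (forall x, K x -> 0 < f x) -> CK K (fun x => (f x)^-1).
Proof.
move=> cf f0; have [K0|K0] := pselect (K !=set0); last first.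
  by apply: ucont_CK => e e0; exists 1 => // x y Kx; exfalso; apply: K0; exists x.
have [a Ka fa] := CK_min K0 cf; have m0 := f0 _ Ka.
move: cf => /CK_ucont uf; apply: ucont_CK => e e0.
have e' : 0 < e * (f a * f a) by rewrite !mulr_gt0.
have [r r0 fr] := uf _ e'; exists r => // x y Kx Ky /(fr _ _ Kx Ky) H.
have fx := f0 _ Kx; have fy := f0 _ Ky.
have -> : (f x)^-1 - (f y)^-1 = (f y - f x) / (f x * f y).
  by field; rewrite !gt_eqF.
rewrite normrM distrC normfV (ger0_norm (mulr_ge0 (ltW fx) (ltW fy))).
rewrite ler_pdivrMr ?mulr_gt0 //; apply: (le_trans H).
by rewrite ler_wpM2l ?(ltW e0) // ler_pM ?(ltW m0) // fa.
Qed.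

Lemma CK_abs f : CK K f -> CK K (fun x => `|f x|).
Proof.
move=> /CK_ucont uf; apply: ucont_CK => e /uf[r r0 fr]; exists r => // x y Kx Ky H.
by apply: le_trans (fr _ _ Kx Ky H); exact: ler_dist_dist.
Qed.

Lemma CK_comp (w : 'rV[R]_d -> 'rV[R]_d) f :
  (forall x, K x -> K (w x)) -> nonexpansive K w -> CK K f -> CK K (fun x => f (w x)).
Proof.
move=> wK nw /CK_ucont uf; apply: ucont_CK => e /uf[r r0 fr]; exists r => // x y Kx Ky H.
by apply: fr; [exact: wK|exact: wK|exact: le_trans (nw _ _ Kx Ky) H].
Qed.

Lemma supnorm_ge f x : CK K f -> K x -> `|f x| <= supnorm K f.
Proof.
move=> /CK_bounded[M _ fM] Kx; apply: ub_le_sup; last by exists x.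
by exists M => _ [y Ky <-]; exact: fM.
Qed.

Lemma supnorm_le f (M : R) : K !=set0 -> (forall x, K x -> `|f x| <= M) -> supnorm K f <= M.
Proof.
move=> [x Kx] fM; apply: ge_sup; first by exists `|f x|; exists x.
by move=> _ [y Ky <-]; exact: fM.
Qed.

Lemma enorm_bounded : exists2 D : R, 0 < D & forall x y, K x -> K y -> enorm (x - y) <= D.
Proof.
have [M [_ KM]] := compact_bounded cK.
have {}KM x : K x -> `|x| <= `|M| + 1.
  by apply: KM; rewrite (le_lt_trans (ler_norm _)) // ltrDl.
exists (d%:R * (`|M| + 1 + (`|M| + 1)) + 1) => [|x y Kx Ky].
  by rewrite ltr_wpDl // mulr_ge0 // !addr_ge0.
apply: (le_trans (enorm_le_norm _)); rewrite ler_wpDr // ler_wpM2l //.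
by apply: (le_trans (ler_normB _ _)); apply: lerD; exact: KM.
Qed.

End UniformContinuity.

(** * Dini continuity *)

(** The integral of a nonnegative function is the supremum of the integrals of the simple functions
    below it, and this supremum is monotone for arbitrary functions. It lets the Dini integrand be
    estimated without a measurability proof. *)
Lemma le_integral_measurable_free dd (R : realType) (T : measurableType dd)
    (mu : {measure set T -> \bar R}) (D : set T) (f g : T -> \bar R) :
  (forall x, D x -> 0 <= f x)%E -> (forall x, D x -> f x <= g x)%E ->
  (\int[mu]_(x in D) f x <= \int[mu]_(x in D) g x)%E.
Proof.
move=> f0 fg; rewrite !ge0_integralE //; last first.
  by move=> x Dx; apply: le_trans (fg _ Dx); exact: f0.
apply: ereal_sup_le => _ [h /= hf <-]; exists h => // x; apply: (le_trans (hf x)).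
exact: lee_restrict.
Qed.

Section DiniSummation.
Context (R : realType) (d : nat) (X : set 'rV[R]_d) (p : 'rV[R]_d -> R) (th : R).
Hypotheses (th0 : 0 < th) (th1 : th < 1) (dp : dini_continuous X p).

(** Such a shell has length [th ^+ k * (1 - th)], so the height [c k / th ^+ k] on it contributes
    [c k * (1 - th)]: the integral of dt / t becomes a sum over geometric scales. *)
Let A (k : nat) : set R := `]th ^+ k.+1, th ^+ k].

Let thX k : 0 < th ^+ k. Proof. exact: exprn_gt0. Qed.

Let A_uniq t k l : A k t -> A l t -> k = l.
Proof.
have aux i j : A i t -> A j t -> ~ (i < j)%N.
  rewrite /A /= !in_itv /= => /andP[it _] /andP[_ jt] ij.
  have : th ^+ j <= th ^+ i.+1 by apply: ler_wiXn2l; rewrite ?ltW.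
  by rewrite leNgt (lt_le_trans it jt).
move=> Ak Al; case: (ltngtP k l) => // [kl|lk].
- by case: (aux _ _ Ak Al).
- by case: (aux _ _ Al Ak).
Qed.

Let D : set R := `]0%R, 1%R].

Let integral_step n (c : nat -> R) : (forall k, 0 <= c k) ->
  (\int[lebesgue_measure]_(t in D)
     (\sum_(k < n) (c k / th ^+ k)%:E * (\1_(A k) t)%:E)
   = (\sum_(k < n) c k * (1 - th))%:E)%E.
Proof.
move=> c0; rewrite ge0_integral_sum //=; last 2 first.
- move=> k; apply: emeasurable_funM; first exact: measurable_cst.
  apply/measurable_EFinP; apply: measurable_indic; exact: measurable_itv.
- by move=> k t _; rewrite mule_ge0 // lee_fin // divr_ge0 // ltW.
rewrite -sumEFin; apply: eq_bigr => k _.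
rewrite ge0_integralZl_EFin //=; last 3 first.
- exact: measurable_itv.
- apply/measurable_EFinP; apply: measurable_indic; exact: measurable_itv.
- by rewrite divr_ge0 // ltW.
rewrite integral_indic //=; last exact: measurable_itv.
rewrite setIidl; last first.
  move=> t; rewrite /A /D /= !in_itv /= => /andP[a b]; apply/andP; split.
    exact: lt_trans a.
  by apply: (le_trans b); apply: exprn_ile1; rewrite ltW.
rewrite lebesgue_measure_itv /= lte_fin exprS.
have -> : th * th ^+ k < th ^+ k by rewrite gtr_pMl.
rewrite -EFinB -EFinM; congr (_%:E); field; by rewrite gt_eqF.
all: exact: measurable_itv.
Qed.

Let modulus_mono s t : s <= t -> (modulus_scalar X p s <= modulus_scalar X p t)%E.
Proof.
move=> st; apply: ereal_sup_le => _ [x [y [Xx Xy xy ->]]].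
by exists x, y; split => //; exact: le_trans st.
Qed.

Let I := fine (\int[lebesgue_measure]_(t in D)
      (modulus_scalar X p t * (t^-1)%:E))%E.

(** On [A k] the modulus is at least its value at [th ^+ k.+1], and 1 / t is at least [th ^- k]; so
    a step function lies below the Dini integrand. The real numbers [c k] stand in for values of the
    modulus, because the finiteness of those values is itself derived from this bound. *)
Let dini_sum n (c : nat -> R) : X !=set0 -> (forall k, 0 <= c k) ->
  (forall k, (k < n)%N -> ((c k)%:E <= modulus_scalar X p (th ^+ k.+1))%E) ->
  \sum_(k < n) c k * (1 - th) <= I.
Proof.
move=> [x Xx] c0 cm.
have m0 t : 0 <= t -> (0 <= modulus_scalar X p t)%E.
  move=> t0; apply: ereal_sup_ubound; exists x, x; split => //.
    by rewrite subrr (_ : enorm 0 = 0) //; apply/eqP; rewrite enorm_eq0.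
  by rewrite subrr normr0.
have f0 t : D t -> (0 <= modulus_scalar X p t * (t^-1)%:E)%E.
  rewrite /D /= in_itv /= => /andP[t0 _]; rewrite mule_ge0 ?m0 ?lee_fin ?invr_ge0 ?ltW //.
rewrite -lee_fin /I fineK; last first.
  by rewrite ge0_fin_numE ?integral_ge0.
rewrite -integral_step //; apply: le_integral_measurable_free => t Dt.
  by apply: sume_ge0 => k _; rewrite mule_ge0 // lee_fin // divr_ge0 // ltW.
have [[k kA]|nA] := pselect (exists k : 'I_n, A k t); last first.
  rewrite big1 ?f0 // => k _; rewrite indicE memNset ?mule0 // => Akt.
  by apply: nA; exists k.
rewrite (bigD1 k) //= big1 ?adde0; last first.
  move=> l lk; rewrite indicE memNset ?mule0 // => Alt.
  by move/eqP: lk; apply; apply: val_inj; exact: A_uniq Alt kA.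
rewrite indicE mem_set // mule1; move: kA Dt.
rewrite /A /D /= !in_itv /= => /andP[kt tk] /andP[t0 t1].
rewrite EFinM; apply: lee_pmul; rewrite ?lee_fin //.
- by rewrite invr_ge0 ltW.
- by apply: (le_trans (cm _ (ltn_ord k))); apply: modulus_mono; exact: ltW.
- by rewrite lef_pV2 ?posrE.
Qed.

(** The only form in which Dini continuity is used later: summable bounds for the oscillation of [p]
    at geometric scales. *)
Lemma dini_summable : X !=set0 -> exists b : nat -> R,
  [/\ forall k, 0 <= b k,
      exists S : R, forall n, \sum_(k < n) b k <= S &
      forall k x y, X x -> X y -> enorm (x - y) <= th ^+ k.+1 -> `|p x - p y| <= b k].
Proof.
move=> X0; have [x Xx] := X0.
have th1' : 0 < 1 - th by rewrite subr_gt0.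
have m0 t : 0 <= t -> (0 <= modulus_scalar X p t)%E.
  move=> t0; apply: ereal_sup_ubound; exists x, x; split => //.
    by rewrite subrr (_ : enorm 0 = 0) //; apply/eqP; rewrite enorm_eq0.
  by rewrite subrr normr0.
have fin k : modulus_scalar X p (th ^+ k.+1) \is a fin_num.
  rewrite ge0_fin_numE ?m0 ?ltW // ltey; apply/eqP => moo.
  (* If the modulus were infinite here, the single height (|I| + 1) / (1 - th) at [k] would be
     admissible and give |I| + 1 <= I. *)
  have := @dini_sum k.+1 (fun j => if j == k then (`|I| + 1) / (1 - th) else 0) X0.
  rewrite big_ord_recr /= eqxx mulfVK ?gt_eqF //.
  have H1 : forall j, 0 <= (if j == k then (`|I| + 1) / (1 - th) else 0).
    by move=> j; case: ifP => // _; rewrite divr_ge0 ?ltW // ltr_wpDl.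
  have H2 j : (j < k.+1)%N -> ((if j == k then (`|I| + 1) / (1 - th) else 0)%:E
      <= modulus_scalar X p (th ^+ j.+1))%E.
    by case: eqP => [->|_] _; rewrite ?moo ?leey // m0 // ltW.
  move=> /(_ H1 H2); rewrite big1 ?add0r; last first.
    by move=> j _; rewrite ltn_eqF ?mul0r.
  by have := ler_norm I; lra.
exists (fun k => fine (modulus_scalar X p (th ^+ k.+1))); split.
- by move=> k; apply: fine_ge0; rewrite m0 // ltW.
- exists (I / (1 - th)) => n; rewrite ler_pdivlMr // mulr_suml.
  apply: (dini_sum (c := fun k => fine (modulus_scalar X p (th ^+ k.+1)))) => // k.
    by apply: fine_ge0; rewrite m0 // ltW.
  by rewrite fineK.
- move=> k y z Xy Xz yz; rewrite -lee_fin fineK //.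
  by apply: ereal_sup_ubound; exists y, z.
Qed.

End DiniSummation.

(** * Positivity of the Ruelle operator *)

Section RuelleBasics.
Context (R : realType) (d m : nat) (K : set 'rV[R]_d).
Context (w : 'I_m -> 'rV[R]_d -> 'rV[R]_d) (p : 'I_m -> 'rV[R]_d -> R).
Hypotheses (cK : compact K) (wK : forall j x, K x -> K (w j x)).
Hypotheses (nw : forall j, nonexpansive K (w j)) (cp : forall j, CK K (p j)).
Hypothesis p0 : forall j x, K x -> 0 < p j x.
Local Notation T := (ruelle w p).
Local Notation one := (fun _ : 'rV[R]_d => 1 : R).
Implicit Types f g : 'rV[R]_d -> R.

Lemma ruelle_CK f : CK K f -> CK K (T f).
Proof.
move=> cf; apply: (CK_sum cK) => j; apply: (CK_mul cK) => //.
exact: (CK_comp cK (@wK j) (@nw j)).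
Qed.

Lemma iter_ruelle_CK n f : CK K f -> CK K (iter n T f).
Proof. by move=> cf; elim: n => //= n IH; exact: ruelle_CK. Qed.

Lemma ruelle_eq f g : (forall x, K x -> f x = g x) -> forall x, K x -> T f x = T g x.
Proof. by move=> fg x Kx; apply: eq_bigr => j _; rewrite fg //; exact: wK. Qed.

Lemma ruelle_le f g : (forall x, K x -> f x <= g x) -> forall x, K x -> T f x <= T g x.
Proof.
move=> fg x Kx; apply: ler_sum => j _; apply: ler_wpM2l; first by rewrite ltW ?p0.
by apply: fg; exact: wK.
Qed.

Lemma iter_ruelle_le n f g : (forall x, K x -> f x <= g x) ->
  forall x, K x -> iter n T f x <= iter n T g x.
Proof. by move=> fg; elim: n => //= n IH; exact: ruelle_le. Qed.

Lemma ruelleD f g : T (fun x => f x + g x) = fun x => T f x + T g x.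
Proof.
apply/funext => x; rewrite /ruelle -big_split /=.
by apply: eq_bigr => j _; rewrite mulrDr.
Qed.

Lemma ruelleZ (c : R) f : T (fun x => c * f x) = fun x => c * T f x.
Proof.
apply/funext => x; rewrite /ruelle mulr_sumr.
by apply: eq_bigr => j _; rewrite mulrCA.
Qed.

Lemma iter_ruelleD n f g :
  iter n T (fun x => f x + g x) = fun x => iter n T f x + iter n T g x.
Proof. by elim: n => //= n ->; rewrite ruelleD. Qed.

Lemma iter_ruelleZ n (c : R) f : iter n T (fun x => c * f x) = fun x => c * iter n T f x.
Proof. by elim: n => //= n ->; rewrite ruelleZ. Qed.

Lemma iter_ruelle_cst n (c : R) x : iter n T (fun=> c) x = c * iter n T one x.
Proof.
by have := iter_ruelleZ n c one; under eq_fun do rewrite mulr1; move=> ->.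
Qed.

Lemma iter_ruelle_affine n (a c : R) f x :
  iter n T (fun y => a + c * f y) x = a * iter n T one x + c * iter n T f x.
Proof.
by rewrite (iter_ruelleD n (fun=> a) (fun y => c * f y)) iter_ruelle_cst iter_ruelleZ.
Qed.

Lemma iter_ruelle_ge0 n f : (forall x, K x -> 0 <= f x) ->
  forall x, K x -> 0 <= iter n T f x.
Proof.
move=> f0 x Kx; have := @iter_ruelle_le n (fun=> 0) f f0 x Kx.
by rewrite iter_ruelle_cst mul0r.
Qed.

Lemma iter_ruelle_ub n f (c : R) : (forall x, K x -> f x <= c) ->
  forall x, K x -> iter n T f x <= c * iter n T one x.
Proof. by move=> fc x Kx; rewrite -iter_ruelle_cst; exact: iter_ruelle_le. Qed.

Lemma iter_ruelle_lb n f (c : R) : (forall x, K x -> c <= f x) ->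
  forall x, K x -> c * iter n T one x <= iter n T f x.
Proof. by move=> fc x Kx; rewrite -iter_ruelle_cst; exact: iter_ruelle_le. Qed.

Lemma iter_ruelle_abs n f (c : R) : (forall x, K x -> `|f x| <= c) ->
  forall x, K x -> `|iter n T f x| <= c * iter n T one x.
Proof.
move=> fc x Kx; rewrite ler_norml -mulNr; apply/andP; split.
  by apply: iter_ruelle_lb => // y Ky; have := fc _ Ky; rewrite ler_norml => /andP[].
by apply: iter_ruelle_ub => // y Ky; have := fc _ Ky; rewrite ler_norml => /andP[].
Qed.

Lemma ruelle_sum (I : Type) (r : seq I) (F : I -> 'rV[R]_d -> R) :
  T (fun x => \sum_(i <- r) F i x) = fun x => \sum_(i <- r) T (F i) x.
Proof.
apply/funext => x; rewrite exchange_big; apply: eq_bigr => j _.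
by rewrite mulr_sumr.
Qed.

Lemma iter_ruelle_one_ge0 n x : K x -> 0 <= iter n T one x.
Proof. exact: iter_ruelle_ge0. Qed.

End RuelleBasics.

(** Taken with [c] = 1 / rho, this passes to the weights of spectral radius 1. *)
Lemma ruelle_scale_weights (R : realType) (d m : nat) (w : 'I_m -> 'rV[R]_d -> 'rV[R]_d)
    (p : 'I_m -> 'rV[R]_d -> R) (c : R) n f :
  iter n (ruelle w (fun j x => c * p j x)) f = fun x => c ^+ n * iter n (ruelle w p) f x.
Proof.
elim: n => [|n IH] /=; first by apply/funext => x; rewrite mul1r.
rewrite IH; apply/funext => x; rewrite /ruelle mulr_sumr; apply: eq_bigr => j _.
by rewrite exprS; ring.
Qed.

(** * Powers of real numbers and geometric sums *)

Section RealSequences.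
Context (R : realType).

Lemma geometric_partial_sum_le (k : R) n : 0 <= k -> k < 1 ->
  \sum_(i < n) k ^+ i <= (1 - k)^-1.
Proof.
move=> k0 k1; have k1' : 0 < 1 - k by rewrite subr_gt0.
rewrite -[leRHS]mul1r ler_pdivlMr //.
have -> : (\sum_(i < n) k ^+ i) * (1 - k) = 1 - k ^+ n.
  elim: n => [|n IH]; first by rewrite big_ord0 mul0r expr0 subrr.
  by rewrite big_ord_recr /= mulrDl IH exprS; ring.
by rewrite gerBl exprn_ge0.
Qed.

Lemma exprn_small (k e : R) : 0 <= k -> k < 1 -> 0 < e ->
  exists N, forall n, (N <= n)%N -> k ^+ n <= e.
Proof.
move=> k0 k1 e0; have := @cvg_geometric R 1 k; rewrite ger0_norm // => /(_ k1).
move=> /cvgrPdist_le/(_ e e0)[N _ H]; exists N => n Nn; have := H n Nn.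
by rewrite /= mul1r sub0r normrN ger0_norm // exprn_ge0.
Qed.

Lemma exprn_large (k C : R) : 1 < k -> exists n, C < k ^+ n.
Proof.
move=> k1; have k0 : 0 < k by rewrite (lt_trans _ k1).
have [|||N H] := @exprn_small k^-1 (`|C| + 1)^-1.
- by rewrite invr_ge0 ltW.
- by rewrite invf_lt1.
- by rewrite invr_gt0 ltr_wpDl.
exists N; have := H N (leqnn N); rewrite exprVn lef_pV2 ?posrE ?exprn_gt0 ?ltr_wpDl //.
by apply: lt_le_trans; rewrite (le_lt_trans (ler_norm C)) // ltrDl.
Qed.

(** Continuity of the power map; it allows the growth rate to be lowered slightly without losing a
    strict inequality between n-th powers. *)
Lemma exprn_between (r C : R) n : 0 < r -> C < r ^+ n ->
  exists s, [/\ 0 < s, s < r & C <= s ^+ n].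
Proof.
move=> r0 Cr; have := @exprn_continuous R n r.
move=> /cvgrPdist_lt/(_ (r ^+ n - C)); rewrite subr_gt0 => /(_ Cr).
move=> /nbhs_normP[e /= e0 H].
(* [r - e / 2] may be negative; the maximum with [r / 2] is positive and still at distance less than
   [e] from [r]. *)
exists (Num.max (r / 2) (r - e / 2)); split.
- by rewrite lt_max divr_gt0.
- by rewrite gt_max; apply/andP; split; lra.
- have := H (Num.max (r / 2) (r - e / 2)); rewrite /= ger0_norm; last first.
    by rewrite subr_ge0 ge_max; apply/andP; split; lra.
  have : r - Num.max (r / 2) (r - e / 2) < e.
    have : r - e / 2 <= Num.max (r / 2) (r - e / 2) by rewrite le_max lexx orbT.
    lra.
  move=> A /(_ A) B; have := ler_norm (r ^+ n - (Num.max (r / 2) (r - e / 2)) ^+ n).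
  lra.
Qed.

Lemma exprn_between_gt (r C : R) n : 0 < r -> r ^+ n < C ->
  exists s, r < s /\ s ^+ n <= C.
Proof.
move=> r0 Cr; have := @exprn_continuous R n r.
move=> /cvgrPdist_lt/(_ (C - r ^+ n)); rewrite subr_gt0 => /(_ Cr).
move=> /nbhs_normP[e /= e0 H]; exists (r + e / 2); split; first lra.
have := H (r + e / 2); rewrite /= distrC addrAC subrr add0r ger0_norm; last by rewrite divr_ge0 // ltW.
have e2 : e / 2 < e by lra.
move=> /(_ e2); rewrite distrC => B; have := ler_norm ((r + e / 2) ^+ n - r ^+ n).
lra.
Qed.

End RealSequences.

(** * Limits along filters and geometrically convergent sequences *)

Section Limits.
Context (R : realType).

(** Stated for an arbitrary proper filter because it serves both along [\oo] and along the
    ultrafilter that defines the eigenfunction. *)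
Lemma cvg_dist_le (T : Type) (F : set_system T) (FF : ProperFilter F) (u : T -> R) (v a b : R) :
  u t @[t --> F] --> v -> (\forall t \near F, `|u t - a| <= b) -> `|v - a| <= b.
Proof.
move=> uv ub; have uva : `|u t - a| @[t --> F] --> `|v - a|.
  by apply: cvg_norm; apply: cvgB => //; exact: cvg_cst.
exact: cvgr_to_le uva ub.
Qed.

Lemma cvg_sum_seq (T : Type) (F : set_system T) (FF : Filter F) (I : Type) (r : seq I)
    (f : I -> T -> R) (l : I -> R) : (forall i, f i t @[t --> F] --> l i) ->
  \sum_(i <- r) f i t @[t --> F] --> \sum_(i <- r) l i.
Proof.
move=> fl; elim: r => [|i r IH].
  by under eq_fun do rewrite big_nil; rewrite big_nil; exact: cvg_cst.
by under eq_fun do rewrite big_cons; rewrite big_cons; exact: cvgD.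
Qed.

Lemma geometric_cauchy_dist (u : nat -> R) (c k : R) : 0 <= k -> k < 1 ->
  (forall n, `|u n.+1 - u n| <= c * k ^+ n) ->
  forall n j, `|u (n + j)%N - u n| <= c * k ^+ n / (1 - k).
Proof.
move=> k0 k1 uc n j; have k1' : 0 < 1 - k by rewrite subr_gt0.
have c0 : 0 <= c by have := le_trans (normr_ge0 _) (uc 0%N); rewrite expr0 mulr1.
apply: (@le_trans _ _ (\sum_(i < j) c * k ^+ n * k ^+ i)).
  elim: j => [|j IH]; first by rewrite addn0 subrr normr0 big_ord0.
  rewrite big_ord_recr /= addnS.
  have -> : u (n + j).+1 - u n = (u (n + j)%N - u n) + (u (n + j).+1 - u (n + j)%N) by ring.
  apply: (le_trans (ler_normD _ _)); apply: lerD => //.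
  by rewrite -mulrA -exprD.
rewrite -mulr_sumr; apply: ler_wpM2l; first by rewrite mulr_ge0 ?exprn_ge0.
exact: geometric_partial_sum_le.
Qed.

Lemma geometric_cvg (u : nat -> R) (c k : R) : 0 <= k -> k < 1 ->
  (forall n, `|u n.+1 - u n| <= c * k ^+ n) -> cvgn u.
Proof.
move=> k0 k1 uc; have k1' : 0 < 1 - k by rewrite subr_gt0.
have c0 : 0 <= c by have := le_trans (normr_ge0 _) (uc 0%N); rewrite expr0 mulr1.
apply/cauchy_cvgP/cauchy_exP => e e0.
have [|N H] := @exprn_small R k (e / 2 * (1 - k) / (c + 1)) k0 k1.
  by rewrite !divr_gt0 ?mulr_gt0 ?divr_gt0 // ltr_wpDl.
exists (u N); exists N => //= n Nn; rewrite /ball /= -(subnKC Nn) distrC.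
apply: (le_lt_trans (geometric_cauchy_dist k0 k1 uc N (n - N))).
have := H N (leqnn N); rewrite ler_pdivlMr ?ltr_wpDl // => HN.
rewrite ltr_pdivrMr //; apply: (@le_lt_trans _ _ (k ^+ N * (c + 1))).
  by rewrite mulrC ler_wpM2l ?exprn_ge0 // lerDl.
by apply: (le_lt_trans HN); rewrite ltr_pM2r //; lra.
Qed.

(** Provides the sum of the Neumann series, applied to real and imaginary parts separately. *)
Lemma geometric_uniform_limit (d : nat) (K : set 'rV[R]_d) (u : nat -> 'rV[R]_d -> R) (c k : R) :
  compact K -> 0 <= k -> k < 1 -> (forall n, CK K (u n)) ->
  (forall n x, K x -> `|u n.+1 x - u n x| <= c * k ^+ n) ->
  exists2 v, CK K v & forall x, K x -> u n x @[n --> \oo] --> v x.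
Proof.
move=> cK k0 k1 cu uc; pose v x := limn (u ^~ x).
have uv x : K x -> u n x @[n --> \oo] --> v x.
  by move=> Kx; apply: (@geometric_cvg (u ^~ x) c k) => // n; exact: uc.
exists v => //; apply: ucont_CK => e e0.
have k1' : 0 < 1 - k by rewrite subr_gt0.
have [[x0 Kx0]|K0] := pselect (K !=set0); last first.
  by exists 1 => // x y Kx; exfalso; apply: K0; exists x.
have c0 : 0 <= c by have := le_trans (normr_ge0 _) (uc 0%N _ Kx0); rewrite expr0 mulr1.
have [|N H] := @exprn_small R k (e / 3 * (1 - k) / (c + 1)) k0 k1.
  by rewrite !divr_gt0 ?mulr_gt0 ?divr_gt0 // ltr_wpDl.
have vN x : K x -> `|v x - u N x| <= e / 3.
  move=> Kx; apply: cvg_dist_le (uv x Kx) _; exists N => //= n Nn.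
  rewrite -(subnKC Nn); apply: (le_trans (geometric_cauchy_dist k0 k1 (uc ^~ x ^~ Kx) N _)).
  have := H N (leqnn N); rewrite ler_pdivlMr ?ltr_wpDl // => HN.
  rewrite ler_pdivrMr //; apply: le_trans HN; rewrite mulrC.
  by rewrite ler_wpM2l ?exprn_ge0 // lerDl.
have e3 : 0 < e / 3 by rewrite divr_gt0.
have [r r0 ur] := CK_ucont cK (cu N) e3.
exists r => // x y Kx Ky xy; have := ur _ _ Kx Ky xy.
have := vN _ Kx; have := vN _ Ky; rewrite !ler_norml => /andP[? ?] /andP[? ?] /andP[? ?].
by apply/andP; split; lra.
Qed.

End Limits.

(** * The spectral radius *)

Section Resolvent.
Import ComplexField.Normc.
Context (R : realType) (d m : nat) (K : set 'rV[R]_d).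
Context (w : 'I_m -> 'rV[R]_d -> 'rV[R]_d) (p : 'I_m -> 'rV[R]_d -> R).
Hypotheses (K0 : K !=set0) (cK : compact K) (wK : forall j x, K x -> K (w j x)).
Hypotheses (nw : forall j, nonexpansive K (w j)) (cp : forall j, CK K (p j)).
Hypothesis p0 : forall j x, K x -> 0 < p j x.
Local Notation T := (ruelle w p).
Local Notation one := (fun _ : 'rV[R]_d => 1 : R).
Local Notation TC := (complexify T).

(** As T is positive, the norm of T^n is the supremum of T^n 1, so these are the exponential rates
    that dominate the powers of T. *)
Definition growth_bound (s : R) := 0 < s /\
  exists2 C : R, 0 < C & forall n x, K x -> iter n T one x <= C * s ^+ n.

(** Division with remainder: every block of length n contributes a factor [s ^+ n], and the finitely
    many remainders r < n are absorbed in the constant. *)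
Lemma growth_bound_of_power (s : R) n : 0 < s -> (0 < n)%N ->
  (forall x, K x -> iter n T one x <= s ^+ n) -> growth_bound s.
Proof.
move=> s0 n0 Tn; split => //.
have [C C0 HC] : exists2 C : R, 0 < C &
    forall r x, (r < n)%N -> K x -> iter r T one x <= C * s ^+ r.
  elim: (n) => [|k [C C0 IH]]; first by exists 1.
  have [M M0 HM] := CK_bounded cK (iter_ruelle_CK cK wK nw cp (n := k) (CK_cst (c := 1))).
  exists (C + M / s ^+ k) => [|r x]; first by rewrite addr_gt0 // divr_gt0 // exprn_gt0.
  rewrite ltnS leq_eqVlt => /orP[/eqP->|rk] Kx.
    rewrite mulrDl divfK ?gt_eqF ?exprn_gt0 // (le_trans (ler_norm _)) //.
    by rewrite (le_trans (HM _ Kx)) // lerDr mulr_ge0 ?ltW // exprn_gt0.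
  apply: (le_trans (IH _ _ rk Kx)); rewrite ler_wpM2r ?exprn_ge0 ?(ltW s0) //.
  by rewrite lerDl divr_ge0 ?ltW // exprn_gt0.
exists C => //; elim/ltn_ind => k IH x Kx.
have [kn|nk] := ltnP k n; first exact: HC.
rewrite -(subnKC nk) iterD.
apply: (le_trans (iter_ruelle_ub wK p0 n (c := C * s ^+ (k - n)) _ Kx)).
  by apply: IH; rewrite ltn_subrL n0 (leq_trans n0 nk).
rewrite exprD [s ^+ n * _]mulrC mulrA; apply: ler_wpM2l; last exact: Tn.
by rewrite mulr_ge0 ?exprn_ge0 // ltW.
Qed.

(* Iterating [u <= b/L + (T/L) u] leaves a geometric series plus a remainder
   that is at most half the maximum of [u]. *)
Lemma growth_bound_resolvent s (L : R) : growth_bound s -> s < L ->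
  exists2 M : R, 0 < M & forall u b, CK K u -> (forall x, K x -> 0 <= u x) -> 0 <= b ->
    (forall x, K x -> L * u x <= b + T u x) -> forall x, K x -> u x <= M * b.
Proof.
move=> [s0 [C C0 HC]] sL; have L0 : 0 < L by exact: lt_trans sL.
pose k := s / L; have k0 : 0 <= k by rewrite divr_ge0 ?ltW.
have k1 : k < 1 by rewrite ltr_pdivrMr // mul1r.
have k1' : 0 < 1 - k by rewrite subr_gt0.
have [|N HN] := @exprn_small R k (2^-1 / C) k0 k1; first by rewrite divr_gt0.
exists (2 * (C / L / (1 - k))) => [|u b cu u0 b0 uT x Kx].
  by rewrite mulr_gt0 // !divr_gt0.
have it n y : K y -> u y <= b / L * (\sum_(i < n) L ^- i * iter i T one y)
                            + L ^- n * iter n T u y.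
  move=> Ky; elim: n => [|n IH]; first by rewrite big_ord0 mulr0 add0r expr0 invr1 mul1r.
  apply: (le_trans IH); rewrite big_ord_recr /= mulrDr -addrA lerD2l.
  have : iter n T u y <= iter n T (fun z => b / L + L^-1 * T u z) y.
    apply: (iter_ruelle_le wK p0) => // z Kz.
    by rewrite mulrC -mulrDr -ler_pdivrMl ?invr_gt0 // invrK uT.
  rewrite iter_ruelle_affine -iterSr => H.
  apply: (le_trans (ler_wpM2l _ H)); first by rewrite invr_ge0 exprn_ge0 ?ltW.
  by rewrite exprS invfM /= le_eqVlt; apply/orP; left; apply/eqP; ring.
have [a Ka ua] := CK_max cK K0 cu.
have : u a <= b / L * (C / (1 - k)) + 2^-1 * u a.
  apply: (le_trans (it N a Ka)); apply: lerD.
    apply: ler_wpM2l; first by rewrite divr_ge0 // ltW.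
    apply: (@le_trans _ _ (\sum_(i < N) C * k ^+ i)).
      apply: ler_sum => i _; rewrite /k exprMn exprVn mulrA mulrC ler_wpM2r //.
        by rewrite invr_ge0 exprn_ge0 ?ltW.
      exact: HC.
    rewrite -mulr_sumr; apply: ler_wpM2l; first exact: ltW.
    exact: geometric_partial_sum_le.
  have := iter_ruelle_ub wK p0 N ua Ka.
  move=> /(ler_wpM2l (_ : 0 <= L ^- N)) H.
  apply: (le_trans (H _)); first by rewrite invr_ge0 exprn_ge0 ?ltW.
  rewrite mulrCA mulrC ler_wpM2r ?u0 //.
  have := HN N (leqnn N); rewrite ler_pdivlMr // => HN'.
  apply: le_trans HN'.
  have -> : k ^+ N * C = L ^- N * (C * s ^+ N) by rewrite /k exprMn exprVn; ring.
  by apply: ler_wpM2l; [rewrite invr_ge0 exprn_ge0 // ltW | exact: HC].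
have := ua _ Kx; move=> A B; apply: (le_trans A).
have -> : 2 * (C / L / (1 - k)) * b = 2 * (b / L * (C / (1 - k))) by ring.
lra.
Qed.

Lemma ReM (x y : R[i]) : complex.Re (x * y) =
  complex.Re x * complex.Re y - complex.Im x * complex.Im y.
Proof. by case: x => a b; case: y. Qed.

Lemma ImM (x y : R[i]) : complex.Im (x * y) =
  complex.Re x * complex.Im y + complex.Im x * complex.Re y.
Proof. by case: x => a b; case: y. Qed.

Lemma ReD (x y : R[i]) : complex.Re (x + y) = complex.Re x + complex.Re y.
Proof. by case: x => a b; case: y. Qed.

Lemma ImD (x y : R[i]) : complex.Im (x + y) = complex.Im x + complex.Im y.
Proof. by case: x => a b; case: y. Qed.

Lemma ReN (x : R[i]) : complex.Re (- x) = - complex.Re x.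
Proof. by case: x. Qed.

Lemma ImN (x : R[i]) : complex.Im (- x) = - complex.Im x.
Proof. by case: x. Qed.

Lemma normc_sub (x y : R[i]) : normc (x - y) = normc (y - x).
Proof. by rewrite -opprB; exact: normcN. Qed.

Lemma normc_triangle (x y : R[i]) : normc (x + y) <= normc x + normc y.
Proof. exact: le_normcD. Qed.

Lemma normc_ge0 (x : R[i]) : 0 <= normc x.
Proof. by case: x => a b; exact: sqrtr_ge0. Qed.

Lemma normr_Re_le (x : R[i]) : `|complex.Re x| <= normc x.
Proof. by case: x => a b /=; rewrite -sqrtr_sqr ler_wsqrtr // lerDl sqr_ge0. Qed.

Lemma normr_Im_le (x : R[i]) : `|complex.Im x| <= normc x.
Proof. by case: x => a b /=; rewrite -sqrtr_sqr ler_wsqrtr // lerDr sqr_ge0. Qed.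

Lemma normc_real (a : R) : normc (Complex a 0) = `|a|.
Proof. by rewrite /= expr0n /= addr0 sqrtr_sqr. Qed.

Lemma normc_sum (I : Type) (r : seq I) (F : I -> R[i]) :
  normc (\sum_(i <- r) F i) <= \sum_(i <- r) normc (F i).
Proof.
elim: r => [|i r IH]; first by rewrite !big_nil normc0.
by rewrite !big_cons (le_trans (normc_triangle _ _)) // lerD2l.
Qed.

Lemma complexifyE f x : TC f x = \sum_(j < m) Complex (p j x) 0 * f (w j x).
Proof.
apply/eqP; rewrite eq_complex; apply/andP; split; apply/eqP => /=.
  have -> : complex.Re (\sum_(j < m) Complex (p j x) 0 * f (w j x)) =
     \sum_(j < m) complex.Re (Complex (p j x) 0 * f (w j x)).
    by apply: (big_morph _ ReD).
  by apply: eq_bigr => j _; rewrite ReM /= mul0r subr0.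
have -> : complex.Im (\sum_(j < m) Complex (p j x) 0 * f (w j x)) =
   \sum_(j < m) complex.Im (Complex (p j x) 0 * f (w j x)).
  by apply: (big_morph _ ImD).
by apply: eq_bigr => j _; rewrite ImM /= mul0r addr0.
Qed.

(** The weights are positive reals, so complex resolvent estimates reduce to inequalities between T
    and the real function |f|. *)
Lemma normc_complexify f x : K x -> normc (TC f x) <= T (fun y => normc (f y)) x.
Proof.
move=> Kx; rewrite complexifyE; apply: (le_trans (normc_sum _ _)).
by apply: ler_sum => j _; rewrite normcM normc_real gtr0_norm ?p0.
Qed.

Lemma complexify_sub f g x : TC f x - TC g x = TC (fun y => f y - g y) x.
Proof.
rewrite !complexifyE -sumrB; apply: eq_bigr => j _; by rewrite mulrBr.
Qed.

Lemma CKC_normc f : CKC K f -> CK K (fun x => normc (f x)).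
Proof.
move=> [cr ci]; apply: ucont_CK => e e0; have e2 : 0 < e / 2 by rewrite divr_gt0.
have [r r0 fr] := CK_ucont cK cr e2; have [s s0 fs] := CK_ucont cK ci e2.
exists (Num.min r s) => [|x y Kx Ky]; first by rewrite lt_min r0.
rewrite le_min => /andP[xr xs]; have A := fr _ _ Kx Ky xr; have B := fs _ _ Kx Ky xs.
have H : normc (f x - f y) <= e.
  have -> : f x - f y = Complex (complex.Re (f x) - complex.Re (f y)) 0
      + 'i%C * Complex (complex.Im (f x) - complex.Im (f y)) 0.
    case: (f x) => a b; case: (f y) => a' b'; apply/eqP; rewrite eq_complex /=.
    by apply/andP; split; apply/eqP; ring.
  apply: (le_trans (normc_triangle _ _)); rewrite normcM !normc_real.
  have -> : normc 'i%C = 1 :> R by rewrite /= expr0n /= expr1n add0r sqrtr1.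
  by rewrite mul1r; lra.
have := normc_triangle (f x - f y) (f y); rewrite subrK.
have := normc_triangle (f y - f x) (f x); rewrite subrK normc_sub.
by move=> *; rewrite ler_norml; apply/andP; split; lra.
Qed.

Lemma CKC_complexify f : CKC K f -> CKC K (TC f).
Proof. by move=> [cr ci]; split; exact: (ruelle_CK cK wK nw cp). Qed.

Lemma CKC_sub f g : CKC K f -> CKC K g -> CKC K (fun x => f x - g x).
Proof.
move=> [a b] [a' b']; split.
  by apply: CK_eq (CK_sub cK a a') => // x _; rewrite ReD ReN.
by apply: CK_eq (CK_sub cK b b') => // x _; rewrite ImD ImN.
Qed.

Lemma CKC_add f g : CKC K f -> CKC K g -> CKC K (fun x => f x + g x).
Proof.
move=> [a b] [a' b']; split.
  by apply: CK_eq (CK_add cK a a') => // x _; rewrite ReD.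
by apply: CK_eq (CK_add cK b b') => // x _; rewrite ImD.
Qed.

Lemma CKC_scale (l : R[i]) f : CKC K f -> CKC K (fun x => l * f x).
Proof.
move=> [a b]; split.
  apply: CK_eq (CK_sub cK (CK_scale cK (c := complex.Re l) a) (CK_scale cK (c := complex.Im l) b)).
    exact: cK.
  by move=> x _; rewrite ReM.
apply: CK_eq (CK_add cK (CK_scale cK (c := complex.Re l) b) (CK_scale cK (c := complex.Im l) a)).
  exact: cK.
by move=> x _; rewrite ImM.
Qed.

Lemma supnormC_ge f x : CKC K f -> K x -> normc (f x) <= supnormC K f.
Proof.
move=> /CKC_normc/(CK_bounded cK)[M _ fM] Kx; apply: ub_le_sup; last by exists x.
by exists M => _ [y Ky <-]; rewrite (le_trans (ler_norm _)) // fM.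
Qed.

Lemma supnormC_le f (M : R) : (forall x, K x -> normc (f x) <= M) -> supnormC K f <= M.
Proof.
move=> fM; have [x Kx] := K0; apply: ge_sup; first by exists (normc (f x)); exists x.
by move=> _ [y Ky <-]; exact: fM.
Qed.

(** Injectivity and the bound on the inverse come from [growth_bound_resolvent] for u = |f|, since
    |l| |f| <= |g| + T |f| whenever l f - T f = g. Surjectivity comes from the Neumann series. *)
Lemma resolvent_of_growth_bound s (l : R[i]) :
  growth_bound s -> s < normc l -> resolvent_set K T l.
Proof.
move=> gs sl; have [M M0 HM] := growth_bound_resolvent gs sl.
have est f g b : CKC K f -> 0 <= b -> (forall x, K x -> l * f x - TC f x = g x) ->
    (forall x, K x -> normc (g x) <= b) -> forall x, K x -> normc (f x) <= M * b.
  move=> cf b0 fg gb; apply: HM => //; [exact: CKC_normc | by move=> x _; exact: normc_ge0 |].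
  move=> x Kx; rewrite -normcM -(subrK (TC f x) (l * f x)) fg //.
  apply: (le_trans (normc_triangle _ _)); apply: lerD; [exact: gb | exact: normc_complexify].
split.
- move=> f1 f2 cf1 cf2 E x; rewrite inE => Kx.
  have H := est (fun y => f1 y - f2 y) (fun=> 0) 0 (CKC_sub cf1 cf2) (lexx 0).
  have : normc (f1 x - f2 x) <= 0.
    rewrite -[leRHS](mulr0 M); apply: H => // y Ky; last by rewrite normc0.
    rewrite -complexify_sub mulrBr.
    have := E y; rewrite inE => /(_ Ky) E'.
    have -> : l * f1 y - l * f2 y - (TC f1 y - TC f2 y) =
      (l * f1 y - TC f1 y) - (l * f2 y - TC f2 y) by ring.
    by rewrite E' subrr.
  rewrite le_eqVlt ltNge normc_ge0 orbF => /eqP/eq0_normc/eqP.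
  by rewrite subr_eq0 => /eqP.
- move=> g cg; have [s0 [C C0 HC]] := gs.
  have L0 : 0 < normc l by exact: lt_trans sl.
  have l0 : l != 0 by apply/eqP => l0; move: L0; rewrite l0 normc0 ltxx.
  (* Iteration of f = (g + T f) / l from 0; the iterates are the partial sums of the Neumann series,
     and their increments are dominated by the iterates of T on a constant. *)
  pose F := fix F n := if n is n'.+1 then (fun x => l^-1 * (g x + TC (F n') x)) else (fun=> 0).
  have cF n : CKC K (F n).
    elim: n => [|n IH]; first by split; exact: CK_cst.
    by apply: CKC_scale; apply: CKC_add => //; exact: CKC_complexify.
  have [G G0 HG] := CK_bounded cK (CKC_normc cg).
  pose k := s / normc l; have k0 : 0 <= k by rewrite divr_ge0 ?ltW.
  have k1 : k < 1 by rewrite ltr_pdivrMr // mul1r.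
  have dF n x : K x -> normc (F n.+1 x - F n x) <=
      (normc l) ^- n * iter n T (fun=> G / normc l) x.
    elim: n x => [|n IH] x Kx.
      rewrite expr0 invr1 mul1r /= subr0 -/(F 0%N) normcM normcV mulrC.
      have -> : TC (fun=> 0) x = 0.
        by rewrite complexifyE big1 // => j _; rewrite mulr0.
      rewrite addr0 ler_wpM2r ?invr_ge0 ?normc_ge0 //.
      by rewrite (le_trans (ler_norm _)) // HG.
    have -> : F n.+2 x - F n.+1 x = l^-1 * TC (fun y => F n.+1 y - F n y) x.
      by rewrite -complexify_sub /=; ring.
    rewrite normcM normcV exprS invfM -mulrA ler_wpM2l ?invr_ge0 ?normc_ge0 //.
    apply: (le_trans (normc_complexify _ Kx)).
    rewrite iterS -[leRHS]/((fun y => normc l ^- n * T (iter n T (fun=> G / normc l)) y) x).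
    rewrite -ruelleZ; exact: (ruelle_le wK p0 IH).
  have dF' n x : K x -> normc (F n.+1 x - F n x) <= G / normc l * C * k ^+ n.
    move=> Kx; apply: (le_trans (dF _ _ Kx)); rewrite iter_ruelle_cst.
    rewrite /k exprMn exprVn mulrCA -!mulrA ler_wpM2l ?(ltW G0) //.
    rewrite ler_wpM2l ?invr_ge0 ?normc_ge0 // mulrC mulrA ler_wpM2r ?HC //.
    by rewrite invr_ge0 exprn_ge0 // normc_ge0.
  have [||u cu Hu] := @geometric_uniform_limit R d K
    (fun n x => complex.Re (F n x)) (G / normc l * C) k cK k0 k1.
    + by move=> n; case: (cF n).
    + move=> n x Kx; apply: le_trans (dF' n x Kx).
      by rewrite -ReN -ReD; exact: normr_Re_le.
  have [||v cv Hv] := @geometric_uniform_limit R d K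
    (fun n x => complex.Im (F n x)) (G / normc l * C) k cK k0 k1.
    + by move=> n; case: (cF n).
    + move=> n x Kx; apply: le_trans (dF' n x Kx).
      by rewrite -ImN -ImD; exact: normr_Im_le.
  exists (fun x => Complex (u x) (v x)); first by split.
  move=> x; rewrite inE => Kx /=.
  have FE n : l * F n.+1 x = g x + TC (F n) x by rewrite /= mulrA mulfV // mul1r.
  have TF (f : nat -> 'rV[R]_d -> R) (h : 'rV[R]_d -> R) :
      (forall y, K y -> f n y @[n --> \oo] --> h y) ->
      T (f n) x @[n --> \oo] --> T h x.
    move=> fh; rewrite /ruelle; apply: cvg_sum_seq => j; apply: cvgM; first exact: cvg_cst.
    by apply: fh; exact: wK.
  have shift (a : nat -> R) (b : R) : a n @[n --> \oo] --> b -> a n.+1 @[n --> \oo] --> b.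
    by move=> ab; rewrite (cvg_shiftS a).
  (* The recursion [FE] passes to the limit in real and imaginary parts; uniqueness of limits gives
     the equation. *)
  apply/eqP; rewrite eq_complex ReD ImD ReN ImN ReM ImM /=; apply/andP; split; apply/eqP.
    apply/eqP; rewrite subr_eq; apply/eqP.
    have E : (fun n => complex.Re l * complex.Re (F n.+1 x) -
        complex.Im l * complex.Im (F n.+1 x)) =
        (fun n => complex.Re (g x) + T (fun y => complex.Re (F n y)) x).
      by apply/funext => n; rewrite -ReM FE ReD.
    apply: (cvg_unique (@Rhausdorff R) (F := (fun n => complex.Re l * complex.Re (F n.+1 x) -
        complex.Im l * complex.Im (F n.+1 x)) @ \oo)).
      apply: cvgB; apply: cvgM; try exact: cvg_cst.
        by apply: (shift (fun n => complex.Re (F n x))); exact: Hu.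
      by apply: (shift (fun n => complex.Im (F n x))); exact: Hv.
    rewrite E; by apply: cvgD; [exact: cvg_cst | exact: TF].
  apply/eqP; rewrite subr_eq; apply/eqP.
  have E : (fun n => complex.Re l * complex.Im (F n.+1 x) +
      complex.Im l * complex.Re (F n.+1 x)) =
        (fun n => complex.Im (g x) + T (fun y => complex.Im (F n y)) x).
    by apply/funext => n; rewrite -ImM FE ImD.
  apply: (cvg_unique (@Rhausdorff R) (F := (fun n => complex.Re l * complex.Im (F n.+1 x) +
      complex.Im l * complex.Re (F n.+1 x)) @ \oo)).
    apply: cvgD; apply: cvgM; try exact: cvg_cst.
      by apply: (shift (fun n => complex.Im (F n x))); exact: Hv.
    by apply: (shift (fun n => complex.Re (F n x))); exact: Hu.
  rewrite E; by apply: cvgD; [exact: cvg_cst | exact: TF].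
- exists M => f cf; apply: supnormC_le => x Kx.
  have cS : CKC K (fun y => l * f y - TC f y).
    by apply: CKC_sub; [exact: CKC_scale | exact: CKC_complexify].
  apply: (est f (fun y => l * f y - TC f y)) => //; last by move=> y Ky; exact: (supnormC_ge cS Ky).
  by apply: le_trans (normc_ge0 _) (supnormC_ge cS Kx).
Qed.

Lemma spectral_radius_le s : growth_bound s -> spectral_radius K T <= s.
Proof.
move=> gs; rewrite /spectral_radius; set E := (X in sup X).
have ubE : ubound E s.
  move=> _ [l /= nl <-]; rewrite leNgt; apply/negP => sl; apply: nl.
  exact: resolvent_of_growth_bound gs sl.
have [E0|E0] := pselect (E !=set0); first exact: ge_sup.
(* An empty spectrum would have supremum 0, which is below [s]. *)
have -> : E = set0 by apply/seteqP; split => // z Ez; apply: E0; exists z.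
by rewrite sup0; case: gs => /ltW.
Qed.

Context (j0 : 'I_m).

Lemma growth_bound_exists : exists s, growth_bound s.
Proof.
have [M M0 HM] := CK_bounded cK (ruelle_CK cK wK nw cp (CK_cst (c := 1))).
exists M; apply: (growth_bound_of_power (n := 1%N)) => // x Kx.
by rewrite expr1 (le_trans (ler_norm _)) // HM.
Qed.

Lemma ruelle_one_lower : exists2 c : R, 0 < c & forall x, K x -> c <= T one x.
Proof.
have [a Ka pa] := CK_min cK K0 (@cp j0); exists (p j0 a) => [|x Kx]; first exact: p0.
rewrite /ruelle (bigD1 j0) //= mulr1 (le_trans (pa _ Kx)) // lerDl sumr_ge0 // => j _.
by rewrite mulr1 ltW ?p0.
Qed.

(** By submultiplicativity this is the limit of (sup T^n 1)^(1/n), the quantity in Gelfand's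
    formula. *)
Definition growth_rate : R := inf growth_bound.

Lemma growth_rate_lb : has_lbound growth_bound.
Proof. by exists 0 => s [/ltW]. Qed.

(** From T 1 >= c follows T^n 1 >= c^n, which excludes growth bounds below c. *)
Lemma growth_rate_gt0 : 0 < growth_rate.
Proof.
have [c c0 Hc] := ruelle_one_lower; apply: (lt_le_trans c0).
apply: lb_le_inf; first exact: growth_bound_exists.
move=> s [s0 [C C0 HC]]; rewrite leNgt; apply/negP => sc.
have [x Kx] := K0.
have low n y : K y -> c ^+ n <= iter n T one y.
  elim: n y => [|n IH] y Ky; first by rewrite expr0.
  rewrite exprSr mulrC; apply: (@le_trans _ _ (c ^+ n * T one y)).
    by rewrite mulrC ler_wpM2l ?exprn_ge0 ?Hc ?ltW.
  have := ruelleZ w p (c ^+ n) one; move=> /(congr1 (fun f => f y)) <-.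
  by apply: (ruelle_le wK p0) => // z Kz; rewrite mulr1; exact: IH.
have cs1 : 1 < c / s by rewrite ltr_pdivlMr // mul1r.
have [n] := exprn_large C cs1.
rewrite exprMn exprVn ltr_pdivlMr ?exprn_gt0 // => H.
by have := lt_le_trans H (low n _ Kx); rewrite ltNge HC.
Qed.

Lemma growth_bound_lt s : growth_rate < s -> exists2 s', growth_bound s' & s' < s.
Proof.
rewrite -subr_gt0 => ls.
have [s' gs' s's] := inf_adherent ls (conj growth_bound_exists growth_rate_lb).
by exists s' => //; move: s's; rewrite -/growth_rate addrC subrK.
Qed.

(** Only the bounded inverse is extracted from the resolvent condition, by regarding a real function
    as a complex one with imaginary part 0. *)
Lemma real_resolvent_bound (s : R) : resolvent_set K T (Complex s 0) ->
  exists2 M : R, 0 < M & forall f b, CK K f -> (forall x, K x -> `|s * f x - T f x| <= b) ->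
     forall x, K x -> `|f x| <= M * b.
Proof.
move=> [_ _ [M HM]]; exists (`|M| + 1) => [|f b cf fb x Kx]; first by rewrite ltr_wpDl.
have cfC : CKC K (fun x => Complex (f x) 0) by split => //=; exact: CK_cst.
have := HM _ cfC; set S := supnormC K _; set S' := supnormC K _.
have fS : `|f x| <= S by rewrite -normc_real; exact: (supnormC_ge cfC Kx).
have S'b : S' <= b.
  apply: supnormC_le => y Ky.
  have T0 : T (fun=> 0) y = 0 by rewrite /ruelle big1 // => j _; rewrite mulr0.
  have -> : Complex s 0 * Complex (f y) 0 - TC (fun x => Complex (f x) 0) y =
      Complex (s * f y - T f y) 0.
    apply/eqP; rewrite eq_complex /complexify /= T0.
    by apply/andP; split; apply/eqP; ring.
  by rewrite normc_real fb.
have b0 : 0 <= b by have := le_trans (normr_ge0 _) (fb _ Kx).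
move=> SM; apply: (le_trans fS); apply: (le_trans SM).
have S'0 : 0 <= S'.
  apply: le_trans (supnormC_ge (_ : CKC K _) Kx); first exact: normc_ge0.
  by apply: CKC_sub; [exact: CKC_scale | exact: CKC_complexify].
apply: (@le_trans _ _ (`|M| * S')); first by rewrite ler_wpM2r // ler_norm.
by apply: ler_pM => //; rewrite lerDl.
Qed.

(* For [s] slightly above the growth rate, [f], a partial sum of the Neumann
   series of [1/(s - T)] at [1], would satisfy [T f <= s' f] with [s'] below it. *)
Lemma growth_rate_spectrum : ~ resolvent_set K T (Complex growth_rate 0).
Proof.
move=> /real_resolvent_bound[M M0 HM]; set s0 := growth_rate in HM *.
have s00 : 0 < s0 := growth_rate_gt0.
(* The resolvent bound gives max f <= M (1 + dl max f) = M + (max f) / 8, hence max f <= 2 M. Then 2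
   dl f <= 1/2 <= s f - T f, that is T f <= (s - 2 dl) f, and s - 2 dl = s0 - dl is below the growth
   rate. *)
pose dl := (8 * M)^-1; have dl0 : 0 < dl by rewrite invr_gt0 mulr_gt0.
have Mdl : M * dl = 8^-1 by rewrite /dl; field; rewrite gt_eqF.
pose s := s0 + dl; have s0s : s0 < s by rewrite ltrDl.
have sp : 0 < s by exact: lt_trans s0s.
have [t [t0 [C C0 HC]] ts] := growth_bound_lt s0s.
have ts1 : t / s < 1 by rewrite ltr_pdivrMr // mul1r.
have ts0 : 0 <= t / s by rewrite divr_ge0 ?ltW.
have [|N HN] := @exprn_small R (t / s) (2^-1 / C) ts0 ts1; first by rewrite divr_gt0.
pose f x := \sum_(i < N.+1) s ^- i.+1 * iter i T one x.
have cf : CK K f.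
  apply: (CK_sum cK) => i; apply: (CK_scale cK).
  exact: (iter_ruelle_CK cK wK nw cp (n := i) (CK_cst (c := 1))).
have fT x : s * f x - T f x = 1 - s ^- N.+1 * iter N.+1 T one x.
  pose v i := s ^- i * iter i T one x.
  have tel : \sum_(i < N.+1) (v i - v i.+1) = v 0%N - v N.+1.
    rewrite -opprB -telescope_sumr // big_mkord -sumrN.
    by apply: eq_bigr => i _; rewrite opprB.
  have v0 : v 0%N = 1 by rewrite /v expr0 invr1 mulr1.
  rewrite -/(v N.+1) -v0 -tel /f (ruelle_sum w p) mulr_sumr -sumrB.
  apply: eq_bigr => i _; rewrite ruelleZ /v; congr (_ - _).
  by rewrite exprS invfM !mulrA mulfV ?mul1r // gt_eqF.
have rem x : K x -> 0 <= s ^- N.+1 * iter N.+1 T one x <= 2^-1.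
  move=> Kx; apply/andP; split.
    by apply: mulr_ge0; [rewrite invr_ge0 exprn_ge0 // ltW | exact: (iter_ruelle_one_ge0 wK p0)].
  have := HN N.+1 (leqnSn N); rewrite ler_pdivlMr // exprMn exprVn => H.
  apply: le_trans H.
  have -> : t ^+ N.+1 / s ^+ N.+1 * C = s ^- N.+1 * (C * t ^+ N.+1) by ring.
  by apply: ler_wpM2l; [rewrite invr_ge0 exprn_ge0 // ltW | exact: HC].
have f1 x : K x -> s^-1 <= f x.
  move=> Kx; rewrite /f big_ord_recl; apply: ler_wpDr; last by rewrite /= expr1 mulr1.
  apply: sumr_ge0 => i _; apply: mulr_ge0; first by rewrite invr_ge0 exprn_ge0 // ltW.
  exact: (iter_ruelle_one_ge0 wK p0 (lift ord0 i) Kx).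
have f0 x : K x -> 0 < f x by move=> /f1; apply: lt_le_trans; rewrite invr_gt0.
have [a Ka fa] := CK_max cK K0 cf.
have fM : f a <= 2 * M.
  have : `|f a| <= M * (1 + dl * f a).
    apply: HM => // x Kx.
    have -> : s0 * f x - T f x = (s * f x - T f x) - dl * f x by rewrite /s; ring.
    rewrite fT; have /andP[? ?] := rem _ Kx; have ? := f0 _ Kx.
    have : dl * f x <= dl * f a by rewrite ler_wpM2l ?(ltW dl0) ?fa.
    have : 0 <= dl * f x by rewrite mulr_ge0 ?ltW.
    by move=> *; rewrite ler_norml; apply/andP; split; lra.
  rewrite gtr0_norm ?f0 // mulrDr mulrA Mdl mulr1; have := f0 _ Ka; lra.
pose q := s0 - dl.
have Tq x : K x -> T f x <= q * f x.
  move=> Kx; have := fT x; have /andP[? ?] := rem _ Kx.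
  have : 2 * dl * f x <= 2^-1.
    apply: (@le_trans _ _ (2 * dl * (2 * M))).
      by rewrite ler_wpM2l ?mulr_ge0 ?(ltW dl0) // (le_trans (fa _ Kx)).
    have -> : 2 * dl * (2 * M) = 4 * (M * dl) by ring.
    by rewrite Mdl; lra.
  have -> : q * f x = s * f x - 2 * dl * f x by rewrite /q /s; ring.
  lra.
have q0 : 0 < q.
  have [x Kx] := K0; have : 0 < T f x.
    have [c c0 Hc] := ruelle_one_lower; have := iter_ruelle_lb wK p0 1 f1 Kx.
    by apply: lt_le_trans; rewrite mulr_gt0 ?invr_gt0 // (lt_le_trans c0) ?Hc.
  by move=> Tx; have := lt_le_trans Tx (Tq _ Kx); rewrite pmulr_lgt0 // f0.
suff gq : growth_bound q.
  have := ge_inf growth_rate_lb gq; rewrite -/growth_rate -/s0 /q; lra.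
split => //; exists (s * (2 * M)) => [|n x Kx]; first by rewrite !mulr_gt0.
have Tn y : K y -> iter n T f y <= q ^+ n * f y.
  elim: n y => [|n IH] y Ky; first by rewrite expr0 mul1r.
  apply: (le_trans (ruelle_le wK p0 IH Ky)); rewrite ruelleZ exprSr -mulrA.
  by apply: ler_wpM2l; [rewrite exprn_ge0 // ltW | exact: Tq].
have H := iter_ruelle_lb wK p0 n f1 Kx.
rewrite -mulrA -ler_pdivrMl //; apply: (le_trans H); apply: (le_trans (Tn _ Kx)).
rewrite mulrC; apply: ler_wpM2r; first by rewrite exprn_ge0 // ltW.
exact: le_trans (fa _ Kx) fM.
Qed.

(** Gelfand's formula for a positive operator. The disc outside a growth bound consists of resolvent
    points, and positivity puts the growth rate itself in the spectrum, so no complex analysis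
    enters. *)
Lemma spectral_radiusE : spectral_radius K T = growth_rate.
Proof.
apply/eqP; rewrite eq_le; apply/andP; split.
  apply: lb_le_inf; first exact: growth_bound_exists.
  by move=> s; exact: spectral_radius_le.
have [s gs] := growth_bound_exists.
apply: ub_le_sup; last first.
  exists (Complex growth_rate 0); first exact: growth_rate_spectrum.
  by rewrite normc_real gtr0_norm // growth_rate_gt0.
exists s => _ [l /= nl <-]; rewrite leNgt; apply/negP => sl; apply: nl.
exact: resolvent_of_growth_bound gs sl.
Qed.

Lemma spectral_radius_gt0 : 0 < spectral_radius K T.
Proof. by rewrite spectral_radiusE growth_rate_gt0. Qed.

(** Otherwise some s below the growth rate would still satisfy T^n 1 <= s^n, hence be a growth bound
    below the infimum of all growth bounds. *)
Lemma spectral_radius_expr_le n (C : R) :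
  (forall x, K x -> iter n T one x <= C) -> spectral_radius K T ^+ n <= C.
Proof.
move=> TC'; rewrite spectral_radiusE leNgt; apply/negP => Cr.
have [x Kx] := K0.
case: n TC' Cr => [|n] TC' Cr; first by have := TC' _ Kx; rewrite /= leNgt Cr.
have [s [s0 sr Cs]] := exprn_between growth_rate_gt0 Cr.
have gs : growth_bound s.
  by apply: (growth_bound_of_power (n := n.+1)) => // y Ky; exact: le_trans (TC' _ Ky) Cs.
by have := ge_inf growth_rate_lb gs; rewrite leNgt sr.
Qed.

(** If b > 1, iterating the lower bound k times gives T^(kn) 1 >= (b rho^n)^k, which outgrows C
    t^(kn) for a growth bound t close enough to rho. *)
Lemma spectral_radius_expr_ge n (b : R) : (0 < n)%N ->
  (forall x, K x -> b * spectral_radius K T ^+ n <= iter n T one x) -> b <= 1.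
Proof.
rewrite spectral_radiusE => n0 Tb; rewrite leNgt; apply/negP => b1.
set r := growth_rate in Tb; have r0 : 0 < r := growth_rate_gt0.
have b0 : 0 < b by exact: lt_trans b1.
have rb : r ^+ n < b * r ^+ n by rewrite ltr_pMl // exprn_gt0.
have [s [rs sb]] := exprn_between_gt r0 rb.
have [t [t0 [C C0 HC]] ts] := growth_bound_lt rs.
have s0 : 0 < s by exact: lt_trans rs.
have low k x : K x -> (b * r ^+ n) ^+ k <= iter (k * n) T one x.
  elim: k x => [|k IH] x Kx; first by rewrite expr0 mul0n.
  rewrite mulSn iterD exprSr.
  apply: le_trans (iter_ruelle_lb wK p0 n IH Kx).
  by rewrite ler_wpM2l ?exprn_ge0 ?mulr_ge0 ?exprn_ge0 ?Tb ?ltW.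
have st1 : 1 < (s / t) ^+ n.
  by rewrite exprn_egt1 -?lt0n // ltr_pdivlMr // mul1r.
have [k] := exprn_large C st1; rewrite -exprM exprMn exprVn ltr_pdivlMr ?exprn_gt0 // => H.
have [x Kx] := K0.
have := le_trans (low k _ Kx) (HC (k * n)%N _ Kx); rewrite leNgt mulnC => /negP; apply.
apply: (lt_le_trans H); rewrite exprM; apply: lerXn2r => //.
- by rewrite nnegrE exprn_ge0 // ltW.
- by rewrite nnegrE mulr_ge0 ?exprn_ge0 ?ltW.
Qed.

End Resolvent.

(** * Bounded distortion *)

Section NormalizedOperator.
Context (R : realType) (d m : nat) (K : set 'rV[R]_d).
Context (w : 'I_m -> 'rV[R]_d -> 'rV[R]_d) (q : 'I_m -> 'rV[R]_d -> R).
Hypotheses (K0 : K !=set0) (cK : compact K) (wK : forall j x, K x -> K (w j x)).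
Hypotheses (nw : forall j, nonexpansive K (w j)) (cq : forall j, CK K (q j)).
Hypothesis q0 : forall j x, K x -> 0 < q j x.
Context (c0 B0 lam th S : R) (b : nat -> R).
Hypotheses (c0_gt0 : 0 < c0) (c0_le : forall j x, K x -> c0 <= q j x).
Hypothesis B0_ge : forall j x y, K x -> K y -> `|q j x - q j y| <= B0.
Hypotheses (lam0 : 0 <= lam) (lam_th : lam < th) (th1 : th < 1).
Hypothesis mean_contraction : forall x y, K x -> K y ->
  \sum_(j < m) q j x * enorm (w j x - w j y) <= lam * enorm (x - y).
Hypotheses (b0 : forall k, 0 <= b k) (bS : forall n, \sum_(k < n) b k <= S).
Hypothesis q_mod : forall j k x y, K x -> K y -> enorm (x - y) <= th ^+ k.+1 ->
  `|q j x - q j y| <= b k.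
Local Notation T := (ruelle w q).
Local Notation one := (fun _ : 'rV[R]_d => 1 : R).
(** This and [min_le1] are all that is retained of the spectral radius being 1. *)
Hypothesis norm_ge1 : forall n (C : R), (forall x, K x -> iter n T one x <= C) -> 1 <= C.
Hypothesis min_le1 : forall n (a : R), (0 < n)%N ->
  (forall x, K x -> a <= iter n T one x) -> a <= 1.

Let th0 : 0 < th. Proof. exact: le_lt_trans lam_th. Qed.
Let thX n : 0 < th ^+ n. Proof. exact: exprn_gt0. Qed.
Let kap := lam / th.
Let kap0 : 0 <= kap. Proof. by rewrite divr_ge0 // ltW. Qed.
Let kap1 : kap < 1. Proof. by rewrite ltr_pdivrMr // mul1r. Qed.
Let kap1' : 0 < 1 - kap. Proof. by rewrite subr_gt0. Qed.

Section Distortion.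
(** [M] is any majorant of the iterates: the sup norms in the proof of the upper bound, then the
    constant found there in the proof of the lower bound. *)
Context (l : nat) (M : nat -> R).
Hypothesis M_ge : forall n x, K x -> iter n T one x <= M n.

(** The thresholds th^(k+1-l). Raising them by th^-l makes the error proportional to th^l; the price
    is paid in [e k], where for k < l the weights are compared only through [B0]. *)
Let s k := th ^+ k.+1 / th ^+ l.
Let e k := 1 + (if (k < l)%N then `|B0| else b (k - l)) / c0.

Let e1 k : 1 <= e k.
Proof. by rewrite lerDl divr_ge0 ?(ltW c0_gt0) //; case: ifP. Qed.

Let M0 n : 0 <= M n.
Proof.
have [x Kx] := K0; apply: le_trans (M_ge n Kx).
exact: (iter_ruelle_one_ge0 wK q0).
Qed.

Let s0 k : 0 < s k. Proof. by rewrite divr_gt0. Qed.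

Let ratio j k x y : K x -> K y -> enorm (x - y) <= s k -> q j x <= e k * q j y.
Proof.
move=> Kx Ky xy; have qy := q0 j Ky; have c0y := c0_le j Ky.
have H : q j x - q j y <= if (k < l)%N then `|B0| else b (k - l).
  apply: (le_trans (ler_norm _)); case: ltnP => kl.
    by apply: (le_trans (B0_ge j Kx Ky)); exact: ler_norm.
  apply: q_mod => //; apply: (le_trans xy).
  by rewrite /s -(subnK kl) addnK -addSn exprD mulfK // gt_eqF.
rewrite /e mulrDl mul1r addrC -lerBlDr; apply: (le_trans H).
set a := (X in X <= _); have a0 : 0 <= a by rewrite /a; case: ifP.
rewrite -[leLHS](mulfVK (lt0r_neq0 c0_gt0)) mulrAC -mulrA -mulrA.
by rewrite ler_wpM2l // mulrC ler_wpM2l // invr_ge0 ltW.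
Qed.

(* A pair whose distance exceeds the threshold [s k] is absorbed by the first
   term of the error sum; otherwise the weights at x and y are comparable. *)
Lemma distortion n k x y : K x -> K y ->
  iter n T one x <= (\prod_(i < n) e (k + i)) * iter n T one y +
    \sum_(i < n) lam ^+ i * enorm (x - y) / s (k + i) * M (n - i).
Proof.
elim: n k x y => [|n IH] k x y Kx Ky.
  by rewrite !big_ord0 mul1r addr0.
have E0 k' n' : 0 <= \prod_(i < n') e (k' + i).
  by apply: prodr_ge0 => i _; exact: le_trans (e1 _).
have R0 k' n' z z' : 0 <= \sum_(i < n') lam ^+ i * enorm (z - z') / s (k' + i) * M (n' - i).
  apply: sumr_ge0 => i _; rewrite !mulr_ge0 ?exprn_ge0 ?enorm_ge0 ?M0 // invr_ge0 ltW //.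
have [xy|xy] := lerP (enorm (x - y)) (s k); last first.
  apply: ler_wpDl.
    by rewrite mulr_ge0 // ?E0 //; exact: (iter_ruelle_one_ge0 wK q0).
  rewrite big_ord_recl /= expr0 mul1r subn0 addn0; apply: ler_wpDr.
    apply: sumr_ge0 => i _; rewrite !mulr_ge0 ?exprn_ge0 ?enorm_ge0 ?M0 // invr_ge0 ltW //.
  apply: (le_trans (M_ge n.+1 Kx)); rewrite ler_peMl //.
  by rewrite ler_pdivlMr // mul1r ltW.
have Eq : \prod_(i < n.+1) e (k + i) = e k * \prod_(i < n) e (k.+1 + i).
  rewrite big_ord_recl /= addn0; congr (_ * _).
  by apply: eq_bigr => i _; rewrite /= /bump /= add1n addnS.
have Es : \sum_(i < n.+1) lam ^+ i * enorm (x - y) / s (k + i) * M (n.+1 - i) =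
    enorm (x - y) / s k * M n.+1 +
    \sum_(i < n) lam ^+ i * (lam * enorm (x - y)) / s (k.+1 + i) * M (n - i).
  rewrite big_ord_recl /= expr0 mul1r addn0 subn0; congr (_ + _).
  by apply: eq_bigr => i _; rewrite /= /bump /= add1n addnS subSS exprSr !mulrA.
rewrite Eq Es; set E := \prod_(i < n) e (k.+1 + i).
have step : iter n.+1 T one x <= \sum_(j < m) q j x *
   (E * iter n T one (w j y) +
     \sum_(i < n) lam ^+ i * enorm (w j x - w j y) / s (k.+1 + i) * M (n - i)).
  by apply: ler_sum => j _; apply: ler_wpM2l; [rewrite ltW ?q0 | apply: IH; exact: wK].
apply: (le_trans step).
under eq_bigr do rewrite mulrDr.
rewrite big_split /=; apply: lerD.
  rewrite /ruelle mulr_sumr; apply: ler_sum => j _.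
  rewrite mulrCA [e k * E]mulrC -!mulrA ler_wpM2l ?E0 // mulrA ler_wpM2r ?ratio //.
  by apply: (iter_ruelle_one_ge0 wK q0); exact: wK.
apply: ler_wpDl; first by rewrite !mulr_ge0 ?enorm_ge0 ?invr_ge0 ?(ltW (s0 _)).
under eq_bigr do rewrite mulr_sumr.
(* After the exchange of sums the mean contraction yields one factor [lam] per step, against one
   factor [th] lost in the threshold. *)
rewrite exchange_big; apply: ler_sum => i _ /=.
have -> : \sum_(j < m) q j x * (lam ^+ i * enorm (w j x - w j y) / s (k.+1 + i) * M (n - i)) =
   lam ^+ i / s (k.+1 + i) * M (n - i) * \sum_(j < m) q j x * enorm (w j x - w j y).
  by rewrite mulr_sumr; apply: eq_bigr => j _; ring.
have -> : lam ^+ i * (lam * enorm (x - y)) / s (k.+1 + i) * M (n - i) =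
   lam ^+ i / s (k.+1 + i) * M (n - i) * (lam * enorm (x - y)) by ring.
by apply: ler_wpM2l; [rewrite !mulr_ge0 ?exprn_ge0 ?invr_ge0 ?(ltW (s0 _)) | exact: mean_contraction].
Qed.

(** From 1 + a <= exp a: the excesses over 1 add up to at most l crude terms and one partial sum of
    [b], all divided by [c0]. *)
Let prod_e n : \prod_(i < n) e i <= expR ((l%:R * `|B0| + S) / c0).
Proof.
apply: (@le_trans _ _ (expR (\sum_(i < n) (e i - 1)))).
  rewrite expR_sum; apply: ler_prod => i _; rewrite (le_trans _ (e1 i)) //=.
  by apply: le_trans (expR_ge1Dx _); rewrite addrC subrK.
rewrite ler_expR /e; under eq_bigr do rewrite addrAC subrr add0r.
rewrite -mulr_suml ler_wpM2r ?invr_ge0 ?(ltW c0_gt0) //.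
elim: n => [|n IH].
  by rewrite big_ord0 addr_ge0 ?mulr_ge0 //; have := bS 0; rewrite big_ord0.
(* For k < l the truncated subtraction makes the second sum empty. *)
have aux k : \sum_(i < k) (if (i < l)%N then `|B0| else b (i - l)) <=
   (minn k l)%:R * `|B0| + \sum_(i < k - l) b i.
  elim: k => [|k IHk]; first by rewrite big_ord0 min0n sub0n big_ord0 mul0r addr0.
  rewrite big_ord_recr /=; apply: (le_trans (lerD IHk (lexx _))); case: ltnP => kl.
    have -> : (k.+1 - l = 0)%N by apply/eqP; rewrite subn_eq0.
    have -> : (k - l = 0)%N by apply/eqP; rewrite subn_eq0 ltnW.
    rewrite !big_ord0 !addr0 (minn_idPl kl).
    by rewrite -natr1 mulrDl mul1r.
  by rewrite subSn // big_ord_recr /= addrA (minn_idPr (leqW kl)).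
apply: (le_trans (aux _)); apply: lerD; last exact: bS.
by rewrite ler_wpM2r // ler_nat geq_minr.
Qed.

(** With all distances at most [D] the error is a geometric series of ratio lam / th. Its factor
    [th ^+ l] is made small by the choice of [l]. *)
Lemma distortion_bound (D C : R) n x y : K x -> K y -> enorm (x - y) <= D -> 0 <= C ->
  (forall i, (i <= n)%N -> M i <= C) ->
  iter n T one x <= expR ((l%:R * `|B0| + S) / c0) * iter n T one y +
    D * th ^+ l / th / (1 - kap) * C.
Proof.
move=> Kx Ky xy C0 MC; have D0 : 0 <= D by apply: le_trans xy; exact: enorm_ge0.
apply: (le_trans (distortion n 0 Kx Ky)); apply: lerD.
  by apply: ler_wpM2r; [exact: (iter_ruelle_one_ge0 wK q0) | exact: prod_e].
apply: (@le_trans _ _ (\sum_(i < n) (D * th ^+ l / th * C) * kap ^+ i)).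
  apply: ler_sum => i _; rewrite add0n /s /kap.
  have -> : lam ^+ i * enorm (x - y) / (th ^+ i.+1 / th ^+ l) * M (n - i) =
     (enorm (x - y) * M (n - i)) * (lam ^+ i * th ^+ l / th ^+ i.+1).
    by field; rewrite !gt_eqF.
  have -> : D * th ^+ l / th * C * (lam / th) ^+ i = (D * C) * (lam ^+ i * th ^+ l / th ^+ i.+1).
    rewrite exprMn exprVn exprS; field; by rewrite !gt_eqF.
  apply: ler_wpM2r; first by rewrite !mulr_ge0 ?exprn_ge0 ?invr_ge0 ?exprn_ge0 ?(ltW th0).
  by apply: ler_pM => //; [exact: enorm_ge0 | apply: MC; exact: leq_subr].
rewrite -mulr_sumr.
have -> : D * th ^+ l / th / (1 - kap) * C = D * th ^+ l / th * C * (1 - kap)^-1 by ring.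
apply: ler_wpM2l; first by rewrite !mulr_ge0 ?exprn_ge0 ?invr_ge0 ?(ltW th0).
exact: geometric_partial_sum_le.
Qed.

End Distortion.

Let M n : R := supnorm K (iter n T one).

Let M_ge n x : K x -> iter n T one x <= M n.
Proof.
move=> Kx; apply: (le_trans (ler_norm _)); apply: supnorm_ge => //.
exact: (iter_ruelle_CK cK wK nw cq (n := n) (CK_cst (c := 1))).
Qed.

Let M_attained n : exists2 x, K x & M n = iter n T one x.
Proof.
have [a Ka fa] := CK_max cK K0 (iter_ruelle_CK cK wK nw cq (n := n) (CK_cst (c := 1))).
exists a => //; apply/eqP; rewrite eq_le M_ge // andbT; apply: supnorm_le => // x Kx.
by rewrite ger0_norm ?fa //; exact: (iter_ruelle_one_ge0 wK q0).
Qed.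

Let small_scale (D C : R) : 0 <= D -> 0 <= C ->
  exists l, D * th ^+ l / th / (1 - kap) * C <= 2^-1.
Proof.
move=> D0 C0; have [|N HN] := @exprn_small R th (2^-1 / (D / th / (1 - kap) * C + 1)) (ltW th0) th1.
  by rewrite divr_gt0 // ltr_wpDl // !mulr_ge0 ?invr_ge0 ?(ltW th0) ?(ltW kap1').
exists N; have := HN N (leqnn N).
rewrite ler_pdivlMr; last first.
  by rewrite ltr_wpDl // !mulr_ge0 ?invr_ge0 ?(ltW th0) ?(ltW kap1').
move=> H; apply: le_trans H.
have -> : D * th ^+ N / th / (1 - kap) * C = th ^+ N * (D / th / (1 - kap) * C) by ring.
by apply: ler_wpM2l; [exact: ltW | rewrite lerDl].
Qed.

(* If n is the first time [M n] exceeds the bound then [M i <= M n] for i <= n,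
   so [T^n 1] would exceed 1 everywhere by bounded distortion. *)
Lemma iter_one_upper : exists2 B : R, 1 <= B & forall n x, K x -> iter n T one x <= B.
Proof.
have [D D0 HD] := enorm_bounded cK.
have [l Hl] := small_scale (ltW D0) (ler01 : 0 <= 1 :> R).
set E := expR ((l%:R * `|B0| + S) / c0).
have E0 : 0 < E by exact: expR_gt0.
(* At a record time the error is at most M n / 2, so T^n 1 >= M n / (2 E) everywhere and [min_le1]
   forces M n <= 2 E. The summand 1 covers n = 0, where M 0 = 1. *)
suff H n : M n <= 1 + 2 * E.
  exists (1 + 2 * E) => [|n x Kx]; first by rewrite lerDl mulr_ge0 // ltW.
  exact: le_trans (M_ge n Kx) (H n).
elim/ltn_ind: n => n IH; rewrite leNgt; apply/negP => Mn.
have M0 : 0 <= M n by apply: ltW; apply: le_lt_trans Mn; rewrite addr_ge0 // mulr_ge0 // ltW.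
have n0 : (0 < n)%N.
  case: (n) Mn => // M01; have [x Kx Mx] := M_attained 0.
  by move: M01; rewrite Mx /= ltNge lerDl mulr_ge0 // ltW.
have [x Kx Mx] := M_attained n.
have low y : K y -> M n / (2 * E) <= iter n T one y.
  move=> Ky; have := @distortion_bound l M M_ge D (M n) n x y Kx Ky (HD _ _ Kx Ky) M0.
  have Mi i : (i <= n)%N -> M i <= M n.
    rewrite leq_eqVlt => /orP[/eqP->//|/IH Mi]; exact: le_trans Mi (ltW Mn).
  move=> /(_ Mi); rewrite -Mx -/E => H.
  have H2 : D * th ^+ l / th / (1 - kap) * M n <= 2^-1 * M n.
    by apply: ler_wpM2r => //; move: Hl; rewrite mulr1.
  rewrite ler_pdivrMr ?mulr_gt0 //; lra.
have := min_le1 n0 low; rewrite ler_pdivrMr ?mulr_gt0 // mul1r => H.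
by move: Mn; rewrite ltNge (le_trans H) // lerDr.
Qed.

(** With the constant majorant [B] no record time is required. As the maximum of T^n 1 is at least 1
    and the error at most 1/2, every value of T^n 1 is at least 1 / (2 E). *)
Lemma iter_one_lower : exists2 A : R, 0 < A & forall n x, K x -> A <= iter n T one x.
Proof.
have [D D0 HD] := enorm_bounded cK.
have [B B1 HB] := iter_one_upper.
have B0' : 0 <= B by exact: le_trans B1.
have [l Hl] := small_scale (ltW D0) B0'.
set E := expR ((l%:R * `|B0| + S) / c0).
have E0 : 0 < E by exact: expR_gt0.
exists ((2 * E)^-1) => [|n y Ky]; first by rewrite invr_gt0 mulr_gt0.
have [x Kx Mx] := M_attained n.
have M1 : 1 <= M n by apply: (norm_ge1 (n := n)) => z; exact: M_ge.
have := @distortion_bound l (fun=> B) HB D B n x y Kx Ky (HD _ _ Kx Ky) B0' (fun _ _ => lexx B).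
rewrite -Mx -/E => H; rewrite -[leLHS]mul1r ler_pdivrMr ?mulr_gt0 //; lra.
Qed.

(** * Equicontinuity of the iterates *)

Lemma summable_tail (e : R) : 0 < e -> exists l, forall n, \sum_(i < n) b (l + i) <= e.
Proof.
move=> e0; pose E := [set \sum_(k < n) b k | n in setT].
have hE : has_sup E by split; [exists (\sum_(k < 0) b k); exists 0%N | exists S => _ [n _ <-]; exact: bS].
have [_ [l _ <-] Hl] := sup_adherent e0 hE; exists l => n.
have : \sum_(k < l + n) b k <= sup E by apply: sup_upper_bound => //; exists (l + n)%N.
rewrite big_split_ord /=; lra.
Qed.

Section Equicontinuity.
Context (f : 'rV[R]_d -> R) (om G : R) (l : nat).
Hypothesis f_mod : forall x y, K x -> K y -> enorm (x - y) <= th ^+ l.+1 -> `|f x - f y| <= om.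
Hypothesis G_ge : forall n x, K x -> `|iter n T f x| <= G.

(** Each step splits into a difference of iterates, handled by induction, and a difference of
    weights. The index [k] is the time at which the threshold [th ^+ k.+1] applies. Nonexpansiveness
    keeps the pair within [th ^+ l.+1], so a pair above its threshold still costs at most [b l]. *)
Lemma iter_modulus n k x y : K x -> K y -> enorm (x - y) <= th ^+ l.+1 ->
  `|iter n T f x - iter n T f y| <= om * iter n T one x +
     \sum_(i < n) (iter i T one x * b (k + i) + lam ^+ i * enorm (x - y) / th ^+ (k + i).+1 * b l) *
       (m%:R * G).
Proof.
elim: n k x y => [|n IH] k x y Kx Ky xy.
  by rewrite big_ord0 addr0 mulr1; exact: f_mod.
have G0 : 0 <= G by exact: le_trans (normr_ge0 _) (G_ge 0 Kx).
have step : iter n.+1 T f x - iter n.+1 T f y =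
    \sum_(j < m) q j x * (iter n T f (w j x) - iter n T f (w j y)) +
    \sum_(j < m) (q j x - q j y) * iter n T f (w j y).
  by rewrite /= /ruelle -sumrB -big_split /=; apply: eq_bigr => j _; ring.
rewrite step; apply: (le_trans (ler_normD _ _)).
(* Below the threshold the first summand suffices; above it the quotient exceeds 1, so the second
   summand is at least [b l]. *)
have qd j : `|q j x - q j y| <= b k + enorm (x - y) / th ^+ k.+1 * b l.
  have [xyk|xyk] := lerP (enorm (x - y)) (th ^+ k.+1).
    by apply: ler_wpDr; [rewrite !mulr_ge0 ?enorm_ge0 ?invr_ge0 ?(ltW (thX _)) | exact: q_mod].
  apply: ler_wpDl => //; apply: (le_trans (q_mod j Kx Ky xy)).
  by rewrite ler_peMl // ler_pdivlMr // mul1r ltW.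
have second : `|\sum_(j < m) (q j x - q j y) * iter n T f (w j y)| <=
    (b k + enorm (x - y) / th ^+ k.+1 * b l) * (m%:R * G).
  apply: (le_trans (ler_norm_sum _ _ _)).
  apply: (@le_trans _ _ (\sum_(j < m) (b k + enorm (x - y) / th ^+ k.+1 * b l) * G)).
    apply: ler_sum => j _; rewrite normrM; apply: ler_pM => //; apply: G_ge; exact: wK.
  by rewrite sumr_const card_ord -[_ *+ m]mulr_natl mulrCA.
have first : `|\sum_(j < m) q j x * (iter n T f (w j x) - iter n T f (w j y))| <=
   om * iter n.+1 T one x + \sum_(i < n) (iter i.+1 T one x * b (k.+1 + i) +
     lam ^+ i.+1 * enorm (x - y) / th ^+ (k.+1 + i).+1 * b l) * (m%:R * G).
  apply: (le_trans (ler_norm_sum _ _ _)).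
  apply: (@le_trans _ _ (\sum_(j < m) q j x * (om * iter n T one (w j x) +
     \sum_(i < n) (iter i T one (w j x) * b (k.+1 + i) +
        lam ^+ i * enorm (w j x - w j y) / th ^+ (k.+1 + i).+1 * b l) * (m%:R * G)))).
    apply: ler_sum => j _; rewrite normrM gtr0_norm ?q0 //; apply: ler_wpM2l; first by rewrite ltW ?q0.
    by apply: IH; [exact: wK | exact: wK | apply: le_trans xy; exact: nw].
  under eq_bigr do rewrite mulrDr.
  rewrite big_split /=; apply: lerD.
    rewrite le_eqVlt; apply/orP; left; apply/eqP; rewrite /ruelle mulr_sumr.
    by apply: eq_bigr => j _; ring.
  under eq_bigr do rewrite mulr_sumr.
  rewrite exchange_big; apply: ler_sum => i _ /=.
  have -> : \sum_(j < m) q j x * ((iter i T one (w j x) * b (k.+1 + i) +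
        lam ^+ i * enorm (w j x - w j y) / th ^+ (k.+1 + i).+1 * b l) * (m%:R * G)) =
     (iter i.+1 T one x * b (k.+1 + i) + lam ^+ i / th ^+ (k.+1 + i).+1 * b l *
       (\sum_(j < m) q j x * enorm (w j x - w j y))) * (m%:R * G).
    rewrite /= {2}/ruelle mulr_suml mulr_sumr -big_split mulr_suml /=.
    by apply: eq_bigr => j _; ring.
  apply: ler_wpM2r; first by rewrite mulr_ge0.
  apply: lerD => //.
  have -> : lam ^+ i.+1 * enorm (x - y) / th ^+ (k.+1 + i).+1 * b l =
    lam ^+ i / th ^+ (k.+1 + i).+1 * b l * (lam * enorm (x - y)) by rewrite exprSr; ring.
  apply: ler_wpM2l; last exact: mean_contraction.
  by rewrite !mulr_ge0 ?exprn_ge0 ?invr_ge0 ?(ltW (thX _)).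
have -> : \sum_(i < n.+1) (iter i T one x * b (k + i) +
      lam ^+ i * enorm (x - y) / th ^+ (k + i).+1 * b l) * (m%:R * G) =
    (b k + enorm (x - y) / th ^+ k.+1 * b l) * (m%:R * G) +
    \sum_(i < n) (iter i.+1 T one x * b (k.+1 + i) +
     lam ^+ i.+1 * enorm (x - y) / th ^+ (k.+1 + i).+1 * b l) * (m%:R * G).
  rewrite big_ord_recl /= expr0 !mul1r addn0; congr (_ + _).
  by apply: eq_bigr => i _; rewrite /= /bump /= add1n addnS.
by rewrite addrCA addrC; apply: lerD.
Qed.

End Equicontinuity.

(** [iter_modulus] with k = l: uniform continuity of f accounts for e / 2, and the sum is at most
    [W] times a tail of the series of [b]. *)
Lemma iter_equicontinuous f (e : R) : CK K f -> 0 < e -> exists2 r : R, 0 < r &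
  forall n x y, K x -> K y -> enorm (x - y) <= r -> `|iter n T f x - iter n T f y| <= e.
Proof.
move=> cf e0; have [B B1 HB] := iter_one_upper; have [F F0 HF] := CK_bounded cK cf.
have Bp : 0 < B by exact: lt_le_trans B1.
pose G := F * B; have G0 : 0 < G by rewrite mulr_gt0.
have HG n x : K x -> `|iter n T f x| <= G.
  move=> Kx; apply: (le_trans (iter_ruelle_abs wK q0 n HF Kx)).
  by apply: ler_wpM2l; [exact: ltW | exact: HB].
pose om := e / 2 / B; have om0 : 0 < om by rewrite !divr_gt0.
have [r r0 fr] := CK_ucont cK cf om0.
pose W := m%:R * G * (B + (1 - kap)^-1).
have W0 : 0 <= W.
  rewrite /W; apply: mulr_ge0; first by rewrite mulr_ge0 // ltW.
  by rewrite addr_ge0 ?invr_ge0 // ltW.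
have [|l0 Hl0] := @summable_tail (e / 2 / (W + 1)).
  by rewrite !divr_gt0 // ltr_wpDl.
have [N HN] := exprn_small (ltW th0) th1 r0.
(* Large enough both for the tail of [b] and for [th ^+ l.+1 <= r]. *)
pose l := (l0 + N)%N.
have Hl n : \sum_(i < n) b (l + i) <= e / 2 / (W + 1).
  apply: le_trans (Hl0 (N + n)%N); rewrite big_split_ord /=; apply: ler_wpDl; first exact: sumr_ge0.
  by apply: ler_sum => i _; rewrite addnA.
exists (th ^+ l.+1) => // n x y Kx Ky xy.
have f_mod u v : K u -> K v -> enorm (u - v) <= th ^+ l.+1 -> `|f u - f v| <= om.
  move=> Ku Kv uv; apply: fr => //; apply: (le_trans uv); apply: HN.
  by rewrite /l leqW // leq_addl.
apply: (le_trans (iter_modulus f_mod HG n l Kx Ky xy)).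
have -> : e = e / 2 + e / 2 by lra.
apply: lerD.
  rewrite -[leRHS](divfK (lt0r_neq0 Bp)) -/om.
  by apply: ler_wpM2l; [exact: ltW | exact: HB].
rewrite -mulr_suml big_split /=.
have t1 : \sum_(i < n) iter i T one x * b (l + i) <= B * (e / 2 / (W + 1)).
  apply: (@le_trans _ _ (B * \sum_(i < n) b (l + i))); last by rewrite ler_wpM2l ?(ltW Bp).
  by rewrite mulr_sumr; apply: ler_sum => i _; apply: ler_wpM2r => //; exact: HB.
have bl : b l <= e / 2 / (W + 1).
  by have := Hl 1%N; rewrite big_ord_recl big_ord0 addr0 addn0.
have t2 : \sum_(i < n) lam ^+ i * enorm (x - y) / th ^+ (l + i).+1 * b l <=
    (1 - kap)^-1 * (e / 2 / (W + 1)).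
  (* The distance bound [th ^+ l.+1] cancels all of the denominator but [th ^+ i], and lam^i / th^i
     is [kap ^+ i]. *)
  apply: (@le_trans _ _ ((\sum_(i < n) kap ^+ i) * b l)).
    rewrite mulr_suml; apply: ler_sum => i _; apply: ler_wpM2r => //.
    rewrite /kap exprMn exprVn -addSn exprD invfM -!mulrA ler_wpM2l ?exprn_ge0 //.
    rewrite mulrA ler_piMl ?invr_ge0 ?(ltW (thX _)) //.
    by rewrite ler_pdivrMr // mul1r.
  by apply: ler_pM => //; [apply: sumr_ge0 => i _; rewrite exprn_ge0 | exact: geometric_partial_sum_le].
apply: (@le_trans _ _ ((B * (e / 2 / (W + 1)) + (1 - kap)^-1 * (e / 2 / (W + 1))) * (m%:R * G))).
  by apply: ler_wpM2r; [rewrite mulr_ge0 // ltW | exact: lerD].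
have -> : (B * (e / 2 / (W + 1)) + (1 - kap)^-1 * (e / 2 / (W + 1))) * (m%:R * G) =
   W * (e / 2 / (W + 1)) by rewrite /W; ring.
rewrite mulrCA ler_piMr ?divr_ge0 ?(ltW e0) //.
by rewrite ler_pdivrMr ?mul1r ?lerDl // ltr_wpDl.
Qed.

End NormalizedOperator.

(** * The eigenfunction *)

Section Eigenfunction.
Context (R : realType) (d m : nat) (K : set 'rV[R]_d).
Context (w : 'I_m -> 'rV[R]_d -> 'rV[R]_d) (q : 'I_m -> 'rV[R]_d -> R).
Hypotheses (cK : compact K) (wK : forall j x, K x -> K (w j x)).
Local Notation T := (ruelle w q).
Local Notation one := (fun _ : 'rV[R]_d => 1 : R).
Context (A B : R).
Hypotheses (A_le : forall n x, K x -> A <= iter n T one x)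
           (B_ge : forall n x, K x -> iter n T one x <= B).
Hypothesis equi : forall e : R, 0 < e -> exists2 r : R, 0 < r &
  forall n x y, K x -> K y -> enorm (x - y) <= r ->
    `|iter n T one x - iter n T one y| <= e.

Let v n x : R := n.+1%:R^-1 * \sum_(i < n.+1) iter i T one x.

Let v_mean n (a : R) : (\sum_(i < n.+1) a) / n.+1%:R = a.
Proof. by rewrite sumr_const card_ord -[a *+ n.+1]mulr_natr mulfK // pnatr_eq0. Qed.

Let v_le n x : K x -> v n x <= B.
Proof.
move=> Kx; rewrite /v mulrC -(v_mean n B) ler_wpM2r ?invr_ge0 //.
by apply: ler_sum => i _; exact: B_ge.
Qed.

Let v_ge n x : K x -> A <= v n x.
Proof.
move=> Kx; rewrite /v mulrC -(v_mean n A) ler_wpM2r ?invr_ge0 //.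
by apply: ler_sum => i _; exact: A_le.
Qed.

Let v_equi (e : R) : 0 < e -> exists2 r : R, 0 < r &
  forall n x y, K x -> K y -> enorm (x - y) <= r -> `|v n x - v n y| <= e.
Proof.
move=> /equi[r r0 Hr]; exists r => // n x y Kx Ky xy.
rewrite /v -mulrBr -sumrB normrM ger0_norm ?invr_ge0 // mulrC.
rewrite -[leRHS](v_mean n e) ler_wpM2r ?invr_ge0 //.
by apply: (le_trans (ler_norm_sum _ _ _)); apply: ler_sum => i _; exact: Hr.
Qed.

(** Telescoping; the iterates being bounded, the defect of invariance is of order 1 / n. *)
Let v_shift n x : T (v n) x = v n x + n.+1%:R^-1 * (iter n.+1 T one x - 1).
Proof.
rewrite /v ruelleZ ruelle_sum -mulrDr; congr (_ * _).
rewrite [in RHS]big_ord_recl [in LHS]big_ord_recr /=; ring.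
Qed.

(* The Cesaro means of [T^n 1] converge along an ultrafilter, and their limit is invariant. *)
Lemma eigenfunction_exists : exists h : 'rV[R]_d -> R,
  [/\ CK K h, forall x, K x -> A <= h x & forall x, K x -> T h x = h x].
Proof.
have [U [UU sub]] := ultraFilterLemma (@eventually_filter).
have PU : ProperFilter U := @ultra_proper _ _ UU.
have cv x : K x -> exists l : R, v n x @[n --> U] --> l.
  move=> Kx; have : compact `[A, B] by exact: segment_compact.
  (* The image of an ultrafilter under a map is an ultrafilter. *)
  have UF : UltraFilter (v n x @[n --> U]).
    have PF : ProperFilter (v n x @[n --> U]) by exact: fmap_proper_filter.
    split=> // G PG sG; apply/seteqP; split => // Y GY.
    have [//|nUY] := in_ultra_setVsetC ((v ^~ x) @^-1` Y) UU.
    have /sG GnY : (v n x @[n --> U]) (~` Y) by [].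
    have G0 : G set0 by rewrite -(setICr Y); exact: filterI.
    by case: (@filter_not_empty _ G PG G0).
  rewrite compact_ultra => /(_ (v n x @[n --> U]) UF) /=.
  case=> [|l [_ Hl]]; last by exists l.
  by apply: filterS (filterT) => n _ /=; rewrite in_itv /= v_ge // v_le.
pose h x := lim (v n x @[n --> U]).
have hv x : K x -> v n x @[n --> U] --> h x.
  by move=> /cv[l vl]; apply/cvg_ex; exists l.
exists h; split.
- apply: ucont_CK => e e0; have [r r0 Hr] := v_equi e0.
  exists r => // x y Kx Ky xy; rewrite -[X in `|X|]subr0.
  apply: (@cvg_dist_le R nat U PU (fun n => v n x - v n y)).
    by apply: cvgB; exact: hv.
  by apply: filterS (filterT) => n _; rewrite subr0; exact: Hr.
- move=> x Kx; apply: (cvgr_to_ge (hv x Kx)).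
  by apply: filterS (filterT) => n _; exact: v_ge.
- move=> x Kx; apply: (cvg_unique (@Rhausdorff R) (F := T (v n) x @[n --> U])).
    rewrite /ruelle; apply: cvg_sum_seq => j; apply: cvgM; first exact: cvg_cst.
    by apply: hv; exact: wK.
  have E : (fun n => T (v n) x) = (fun n => v n x + n.+1%:R^-1 * (iter n.+1 T one x - 1)).
    by apply/funext => n; exact: v_shift.
  rewrite /= E.
  rewrite -[X in _ --> X]addr0; apply: cvgD; first exact: hv.
  (* [U] refines [\oo], so a limit along [\oo] is a limit along [U]. *)
  apply: (@cvg_trans _ (n.+1%:R^-1 * (iter n.+1 T one x - 1) @[n --> \oo])).
    by move=> Y; exact: sub.
  have -> : 0 = 0 * (`|A| + `|B| + 1) :> R by rewrite mul0r.
  apply/cvgrPdist_le => e e0.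
  near=> n; rewrite mul0r sub0r normrN normrM.
  have H : `|iter n.+1 T one x - 1| <= `|A| + `|B| + 1.
    have := A_le n.+1 Kx; have := B_ge n.+1 Kx.
    have := ler_norm B; have := ler_norm (- A); rewrite normrN.
    have := normr_ge0 A; have := normr_ge0 B.
    by move=> *; rewrite ler_norml; apply/andP; split; lra.
  apply: (le_trans (ler_wpM2l (normr_ge0 _) H)).
  rewrite ger0_norm ?invr_ge0 // mulrC ler_pdivrMr // mulrC -ler_pdivrMr //.
  near: n; exists (Num.truncn ((`|A| + `|B| + 1) / e)).+1 => //= n Nn.
  apply: ltW; apply: (lt_le_trans (truncnS_gt _)); rewrite ler_nat.
  exact: leqW.
Unshelve. all: by end_near. Qed.

End Eigenfunction.

(** * Convergence to equilibrium *)

(** The first letter acts first: the n-th iterate of the operator at x is a weighted sum of the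
    values of f at [word_map w J x] over the words J of length n. *)
Definition word_map (R : realType) (d m : nat) (w : 'I_m -> 'rV[R]_d -> 'rV[R]_d)
  (J : seq 'I_m) (x : 'rV[R]_d) := foldl (fun y j => w j y) x J.

Section WordMaps.
Context (R : realType) (d m : nat) (w : 'I_m -> 'rV[R]_d -> 'rV[R]_d).

Lemma word_map_cat J1 J2 x : word_map w (J1 ++ J2) x = word_map w J2 (word_map w J1 x).
Proof. by rewrite /word_map foldl_cat. Qed.

Lemma word_map_rcons J j x : word_map w (rcons J j) x = w j (word_map w J x).
Proof. by rewrite -cats1 word_map_cat. Qed.

Lemma word_map_nseq n j x : word_map w (nseq n j) x = iter n (w j) x.
Proof. by elim: n x => //= n IH x; rewrite /word_map /= -/(word_map w _ _) IH -iterSr. Qed.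

Lemma word_map_in (X : set 'rV[R]_d) J x :
  (forall j x, X x -> X (w j x)) -> X x -> X (word_map w J x).
Proof. by move=> wX; elim: J x => //= j J IH x Xx; apply: IH; exact: wX. Qed.

Lemma word_map_nonexpansive (X : set 'rV[R]_d) J x y :
  (forall j x, X x -> X (w j x)) -> (forall j, nonexpansive X (w j)) ->
  X x -> X y -> enorm (word_map w J x - word_map w J y) <= enorm (x - y).
Proof.
move=> wX nw; elim: J x y => //= j J IH x y Xx Xy.
apply: (le_trans (IH _ _ (wX _ _ Xx) (wX _ _ Xy))); exact: nw.
Qed.

End WordMaps.

Lemma closureP_enorm (R : realType) (d : nat) (A : set 'rV[R]_d) (z : 'rV[R]_d) :
  closure A z <-> forall e : R, 0 < e -> exists2 u, A u & enorm (z - u) <= e.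
Proof.
split=> [cz e e0|H B Bz].
  have [r r0 Hr] := enorm_small d e0.
  have [u [Au zu]] := cz _ (nbhs_dist_lt z r0); exists u => //.
  by apply: Hr; exact: ltW.
move: Bz => /nbhs_ballP[e /= e0 He].
have [|u Au zu] := H (e / 2); first by rewrite divr_gt0.
exists u; split => //; apply: He; rewrite mx_norm_ball /ball_ /=.
apply: le_lt_trans (norm_le_enorm _) _; apply: (le_lt_trans zu); lra.
Qed.

Lemma nonexpansive_continuous (R : realType) (d : nat) (A : set 'rV[R]_d)
  (f : 'rV[R]_d -> 'rV[R]_d) : nonexpansive A f -> {within A, continuous f}.
Proof.
move=> nf; apply/subspace_continuousP => x Ax B /nbhs_ballP[e /= e0 He].
have e2 : 0 < e / 2 by rewrite divr_gt0.
have [s s0 sr] := enorm_small d e2.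
apply: filterS (nbhs_dist_lt x s0) => y xy Ay; apply: He; rewrite mx_norm_ball /ball_ /=.
apply: (le_lt_trans (norm_le_enorm _)); apply: (le_lt_trans (nf _ _ Ax Ay)).
by apply: (le_lt_trans (sr _ (ltW xy))); lra.
Qed.

(** * Fixed point and uniform attraction for a weak contraction *)

Section WeakContraction.
Context (R : realType) (d : nat) (X : set 'rV[R]_d) (f : 'rV[R]_d -> 'rV[R]_d).
Hypotheses (X0 : X !=set0) (cX : compact X) (fX : forall x, X x -> X (f x)).
Hypothesis wc : weakly_contractive X f.

Lemma enorm_sqr (x : 'rV[R]_d) : enorm x ^+ 2 = \sum_(i < d) x ord0 i ^+ 2.
Proof. by rewrite sqr_sqrtr // sumr_ge0 // => i _; exact: sqr_ge0. Qed.

Lemma weakly_contractive_lt x y : X x -> X y -> x != y -> enorm (f x - f y) < enorm (x - y).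
Proof.
move=> Xx Xy xy; have e0 : 0 < enorm (x - y).
  by rewrite lt_def enorm_eq0 subr_eq0 xy enorm_ge0.
rewrite -lte_fin; apply: le_lt_trans (wc e0).
by apply: ereal_sup_ubound; exists x, y.
Qed.

Let nf : nonexpansive X f.
Proof.
move=> x y Xx Xy; have [->|xy] := eqVneq x y; last exact: ltW (weakly_contractive_lt Xx Xy xy).
by rewrite !subrr lexx.
Qed.

Let CK_coord i : CK X (fun x => x ord0 i).
Proof.
apply: ucont_CK => e e0; exists e => // x y _ _; apply: le_trans.
apply: le_trans (norm_le_enorm _); rewrite [leRHS]mx_normrE.
have -> : x ord0 i - y ord0 i = (x - y) ord0 i by rewrite !mxE.
exact: (le_bigmax _ (fun ij : 'I_1 * 'I_d => `|(x - y) ij.1 ij.2|) (ord0, i)).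
Qed.

(** Squared distances are polynomials in the coordinates, so their continuity needs no square
    root. *)
Let CK_dist_sqr (a b : 'rV[R]_d -> 'rV[R]_d) :
  (forall i, CK X (fun x => a x ord0 i)) -> (forall i, CK X (fun x => b x ord0 i)) ->
  CK X (fun x => enorm (a x - b x) ^+ 2).
Proof.
move=> ca cb; have H : CK X (fun x => \sum_(i < d) (a x ord0 i - b x ord0 i) ^+ 2).
  by apply: (CK_sum cX) => i; apply: (CK_exp cX); apply: (CK_sub cX).
apply: CK_eq H => // x _; rewrite enorm_sqr.
by apply: eq_bigr => i _; rewrite !mxE.
Qed.

Let CK_f i : CK X (fun x => f x ord0 i).
Proof. exact: (CK_comp cX fX (@nf) (@CK_coord i)). Qed.

(** The displacement |x - f x| attains its minimum; if that were positive, f x would have a smaller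
    displacement. *)
Lemma weakly_contractive_fixpoint : exists2 x0, X x0 & f x0 = x0.
Proof.
have cQ : CK X (fun x => enorm (x - f x) ^+ 2)
  by apply: (CK_dist_sqr (a := id)); [exact: CK_coord | exact: CK_f].
have [x0 Xx0 H] := CK_min cX X0 cQ; exists x0 => //; apply/eqP/negPn/negP => fx.
have := H _ (fX Xx0); rewrite leNgt => /negP; apply.
rewrite ltrXn2r ?enorm_ge0 //.
by apply: weakly_contractive_lt => //; [exact: fX | rewrite eq_sym].
Qed.

(** Outside the ball of radius [e] about the fixed point, one step lowers the squared distance by a
    fixed positive amount, and the ball is never left. *)
Lemma weakly_contractive_iter x0 (e : R) : X x0 -> f x0 = x0 -> 0 < e ->
  exists k0, forall k x, (k0 <= k)%N -> X x -> enorm (iter k f x - x0) <= e.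
Proof.
move=> Xx0 fx0 e0; have e20 : 0 < e ^+ 2 by exact: exprn_gt0.
pose Q x := enorm (x - x0) ^+ 2.
have cQ : CK X Q by apply: (CK_dist_sqr (a := id) (b := fun=> x0)) => // i; exact: CK_cst.
have cQf : CK X (fun x => Q (f x)).
  by apply: (CK_dist_sqr (a := f) (b := fun=> x0)) => i; [exact: CK_f | exact: CK_cst].
have Qf x : X x -> Q (f x) <= Q x.
  by move=> Xx; rewrite lerXn2r ?nnegrE ?enorm_ge0 // -[X in _ - X]fx0; exact: nf.
have Qlt x : X x -> x != x0 -> Q (f x) < Q x.
  move=> Xx xx0; rewrite ltrXn2r ?enorm_ge0 // -[X in _ - X]fx0.
  exact: weakly_contractive_lt.
(* The decrease of Q plus twice the positive part of e^2 - Q. It is continuous and positive on all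
   of [X], also at the fixed point, so its minimum is positive; where e^2 <= Q it is the decrease
   alone. *)
pose G x := (Q x - Q (f x)) + (`|e ^+ 2 - Q x| + (e ^+ 2 - Q x)).
have cG : CK X G.
  have cE : CK X (fun x => e ^+ 2 - Q x) by apply: (CK_sub cX) => //; exact: CK_cst.
  apply: (CK_add cX); first exact: (CK_sub cX).
  by apply: (CK_add cX) => //; exact: (CK_abs cX).
have [a Xa Ga] := CK_min cX X0 cG.
have c0 : 0 < G a.
  have := normr_ge0 (e ^+ 2 - Q a); have := ler_norm (- (e ^+ 2 - Q a)); rewrite normrN => A B.
  have [ax0|ax0] := eqVneq a x0; last by have := Qlt _ Xa ax0; rewrite /G; lra.
  have Qx0 : Q x0 = 0 by apply/eqP; rewrite /Q expf_eq0 /= enorm_eq0 subrr.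
  by rewrite /G ax0 fx0 Qx0 !subr0 add0r ger0_norm ?(ltW e20) //; lra.
have dec x : X x -> e ^+ 2 <= Q x -> Q (f x) <= Q x - G a.
  move=> Xx ex; have := Ga _ Xx; rewrite {2}/G ler0_norm; last by rewrite subr_le0.
  lra.
have [D D0 HD] := enorm_bounded cX.
have it k x : X x -> X (iter k f x) by move=> Xx; elim: k => //= k; exact: fX.
have H k x : X x -> Q (iter k f x) <= e ^+ 2 \/ Q (iter k f x) <= D ^+ 2 - k%:R * G a.
  move=> Xx; elim: k => [|k [IH|IH]].
  - by right; rewrite mul0r subr0 lerXn2r ?nnegrE ?enorm_ge0 ?(ltW D0) //; exact: HD.
  - by left; apply: le_trans IH; exact: (Qf _ (it k _ Xx)).
  - have [le|lt] := lerP (e ^+ 2) (Q (iter k f x)).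
      right; apply: (le_trans (dec _ (it k _ Xx) le)).
      by rewrite -natr1 mulrDl mul1r; lra.
    by left; apply: (le_trans (Qf _ (it k _ Xx))); exact: ltW.
exists (Num.truncn (D ^+ 2 / G a)).+1 => k x kk Xx.
rewrite -(@ler_pXn2r R 2) ?nnegrE ?enorm_ge0 ?(ltW e0) //.
have [//|Hk] := H k x Xx; apply: (le_trans Hk).
have : D ^+ 2 / G a < k%:R.
  by apply: (lt_le_trans (truncnS_gt _)); rewrite ler_nat.
by rewrite ltr_pdivrMr //; lra.
Qed.

End WeakContraction.

(** * Words of a fixed length reach every part of the invariant set *)

Section Primitivity.
Context (R : realType) (d m : nat) (X K : set 'rV[R]_d).
Context (w : 'I_m -> 'rV[R]_d -> 'rV[R]_d) (j1 : 'I_m).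
Hypotheses (X0 : X !=set0) (cX : compact X) (wX : forall j x, X x -> X (w j x)).
Hypotheses (nw : forall j, nonexpansive X (w j)) (wc : weakly_contractive X (w j1)).
Hypothesis hK : invariant_set X w K.

(** The closure of the orbit is itself self-similar, so the minimality of [K] applies. *)
Lemma invariant_set_orbit x0 : X x0 -> w j1 x0 = x0 ->
  K `<=` closure [set word_map w J x0 | J in setT].
Proof.
move=> Xx0 fx0; have [_ min] := hK; apply: min; set O := [set _ | _ in _].
have OX : O `<=` X by move=> _ [J _ <-]; exact: word_map_in.
have clX : closed X by apply: compact_closed => //; exact: norm_hausdorff.
have cOX : closure O `<=` X by rewrite (closure_id X).1 //; exact: closure_subset.
have cO : compact (closure O) by apply: (subclosed_compact _ cX cOX); exact: closed_closure.
split => //.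
- by exists x0; apply: subset_closure; exists [::].
- have nwO j : nonexpansive (closure O) (w j).
    by move=> x y /cOX Xx /cOX Xy; exact: nw.
  apply/seteqP; split; last first.
    move=> _ [j _ [z cz <-]]; apply/closureP_enorm => e e0.
    have [u [J _ uJ] zu] := (closureP_enorm O z).1 cz e e0.
    exists (w j u); first by exists (rcons J j) => //; rewrite word_map_rcons uJ.
    apply: le_trans zu; apply: nw; first exact: cOX.
    by apply: OX; exists J.
  have clU : closed (\bigcup_j (w j @` closure O)).
    apply: closed_bigcup => [|j _]; first exact: finite_finset.
    apply: compact_closed; first exact: norm_hausdorff.
    by apply: continuous_compact => //; exact: nonexpansive_continuous.
  rewrite (closure_id (\bigcup_j _)).1 //; apply: closure_subset.
  move=> _ [J _ <-]; case/lastP: J => [|J j].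
    (* The empty word: [x0] is an image of an orbit point because it is fixed by [w j1]. *)
    by exists j1 => //; exists x0 => //; apply: subset_closure; exists [::].
  exists j => //; exists (word_map w J x0); last by rewrite word_map_rcons.
  by apply: subset_closure; exists J.
Qed.

(** A long power of [w j1] brings every x near [x0], and a further word J brings [x0] near z. The
    length of that power is free, so all words can have the same length; compactness makes it
    uniform in z. *)
Lemma words_dense (e : R) : 0 < e ->
  exists N, forall x z, K x -> K z -> exists2 J, size J = N & enorm (word_map w J x - z) <= e.
Proof.
move=> e0; have [[K0 cK KX _] _] := hK.
have [s s0 Hs] := enorm_small d e0.
have s3 : 0 < s / 3 by rewrite divr_gt0.
have [x0 Xx0 fx0] := weakly_contractive_fixpoint X0 cX (@wX j1) wc.
have [k0 Hk0] := weakly_contractive_iter X0 cX (@wX j1) wc Xx0 fx0 s3.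
pose P N z := forall x, K x -> exists2 J, size J = N & enorm (word_map w J x - z) <= e.
have cov := (compact_near_coveringP K).1 cK nat \oo P _.
have : \forall N \near \oo, K `<=` P N.
  apply: cov => z Kz.
  have cz : closure [set word_map w J x0 | J in setT] z by exact: invariant_set_orbit.
  have [_ [J _ <-] zJ] := (closureP_enorm _ _).1 cz _ s3.
  exists ([set z' | `|z - z'| < s / 3], [set N | (size J + k0 <= N)%N]) => /=.
    by split; [exact: nbhs_dist_lt | exists (size J + k0)%N].
  move=> [z' N] /= [zz' JN] x Kx.
  have JN' : (size J <= N)%N by apply: leq_trans JN; exact: leq_addr.
  (* The padding is applied first; being nonexpansive, J does not enlarge the remaining distance to
     [x0]. *)
  exists (nseq (N - size J) j1 ++ J); first by rewrite size_cat size_nseq subnK.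
  apply: Hs; rewrite word_map_cat word_map_nseq.
  set y := iter _ _ _.
  have Xy : X y by rewrite /y; elim: (N - size J)%N => [|n IH] /=; [exact: KX | exact: wX].
  have yx0 : enorm (y - x0) <= s / 3.
    by apply: Hk0; [rewrite leq_subRL // | exact: KX].
  have A : `|word_map w J y - word_map w J x0| <= s / 3.
    apply: (le_trans (norm_le_enorm _)); apply: le_trans yx0.
    exact: (word_map_nonexpansive J wX nw).
  have B : `|z - word_map w J x0| <= s / 3 by apply: le_trans zJ; exact: norm_le_enorm.
  have -> : word_map w J y - z' = (word_map w J y - word_map w J x0) -
      (z - word_map w J x0) + (z - z') by rewrite opprB !subrKA.
  apply: (le_trans (ler_normD _ _));
  have := ler_normB (word_map w J y - word_map w J x0) (z - word_map w J x0).
  by move: zz' => /ltW; lra.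
by move=> /filter_ex[N HN]; exists N => x z Kx Kz; exact: HN.
Qed.

End Primitivity.

(** * Decay of oscillation for Markov operators *)

Section MarkovConvergence.
Context (R : realType) (d m : nat) (K : set 'rV[R]_d).
Context (w : 'I_m -> 'rV[R]_d -> 'rV[R]_d) (pr : 'I_m -> 'rV[R]_d -> R) (c : R).
Hypotheses (K0 : K !=set0) (cK : compact K) (wK : forall j x, K x -> K (w j x)).
Hypotheses (c0 : 0 < c) (pr_ge : forall j x, K x -> c <= pr j x).
Hypothesis pr1 : forall x, K x -> \sum_(j < m) pr j x = 1.
Hypothesis dense : forall e : R, 0 < e ->
  exists N, forall x z, K x -> K z -> exists2 J, size J = N & enorm (word_map w J x - z) <= e.
Local Notation P := (ruelle w pr).

Let pr0 j x : K x -> 0 < pr j x. Proof. by move=> Kx; apply: lt_le_trans (pr_ge j Kx). Qed.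

Let P_cst n (a : R) x : K x -> iter n P (fun=> a) x = a.
Proof.
elim: n x => // n IH x Kx.
change (\sum_(j < m) pr j x * iter n P (fun=> a) (w j x) = a).
transitivity (\sum_(j < m) pr j x * a); last by rewrite -mulr_suml pr1 // mul1r.
by apply: eq_bigr => j _; rewrite IH //; exact: wK.
Qed.

Let P_ub n v (a : R) x : (forall y, K y -> v y <= a) -> K x -> iter n P v x <= a.
Proof. by move=> va Kx; rewrite -(P_cst n a Kx); exact: (iter_ruelle_le wK pr0). Qed.

Let P_lb n v (a : R) x : (forall y, K y -> a <= v y) -> K x -> a <= iter n P v x.
Proof. by move=> va Kx; rewrite -(P_cst n a Kx); exact: (iter_ruelle_le wK pr0). Qed.

(** The path J has probability at least [c ^+ size J] and ends with the deficit s - v; all other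
    paths contribute at most s. *)
Lemma markov_word_bound J v (s : R) x : (forall y, K y -> v y <= s) -> K x ->
  iter (size J) P v x <= s - c ^+ size J * (s - v (word_map w J x)).
Proof.
move=> vs; elim: J x => [|j J IH] x Kx /=; first by rewrite expr0 mul1r; lra.
have Kj := wK j Kx; have := IH _ Kj; rewrite /word_map /= -/(word_map w J _).
set z := word_map w J (w j x); set n := size J => H.
have sv : 0 <= s - v z by rewrite subr_ge0 vs //; exact: word_map_in.
have : P (iter n P v) x <= \sum_(i < m) pr i x * s - pr j x * (c ^+ n * (s - v z)).
  rewrite /ruelle (bigD1 j) //= [X in _ <= X - _](bigD1 j) //= addrAC -mulrBr.
  apply: lerD; first by rewrite ler_wpM2l // ltW ?pr0.
  apply: ler_sum => i _; rewrite ler_wpM2l //; first by rewrite ltW ?pr0.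
  by apply: P_ub => //; exact: wK.
rewrite -mulr_suml pr1 // mul1r => H'; apply: (le_trans H').
rewrite lerD2l lerN2 exprS -mulrA ler_wpM2r ?pr_ge //.
by rewrite mulr_ge0 // exprn_ge0 // ltW.
Qed.

(** A Doeblin contraction: from every x some word of length [N] ends near the minimizer of v, which
    lowers the upper bound by almost [c ^+ N] times the oscillation, while averaging never lowers
    the minimum. *)
Lemma markov_oscillation v (D e r : R) N : CK K v ->
  (forall x y, K x -> K y -> enorm (x - y) <= r -> `|v x - v y| <= e) ->
  (forall x z, K x -> K z -> exists2 J, size J = N & enorm (word_map w J x - z) <= r) ->
  c ^+ N <= 1 ->
  (forall x y, K x -> K y -> v x - v y <= D) ->
  forall x y, K x -> K y -> iter N P v x - iter N P v y <= (1 - c ^+ N) * D + c ^+ N * e.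
Proof.
move=> cv ve dn cN1 vD x y Kx Ky.
have [a Ka va] := CK_max cK K0 cv; have [z Kz vz] := CK_min cK K0 cv.
have [J JN Jz] := dn x z Kx Kz.
have KJ : K (word_map w J x) by exact: word_map_in.
have := ve _ _ KJ Kz Jz; rewrite ler_norml => /andP[_ Je].
have := markov_word_bound J va Kx; rewrite JN => H.
have L := P_lb N vz Ky.
have aD := vD _ _ Ka Kz.
have cN0 : 0 <= c ^+ N by rewrite exprn_ge0 // ltW.
have H1 : c ^+ N * (v a - v z - e) <= c ^+ N * (v a - v (word_map w J x)).
  by apply: ler_wpM2l => //; lra.
have H2 : (1 - c ^+ N) * (v a - v z) <= (1 - c ^+ N) * D.
  by apply: ler_wpM2l => //; rewrite subr_ge0.
have : (1 - c ^+ N) * (v a - v z) + c ^+ N * e = v a - c ^+ N * (v a - v z - e) - v z by ring.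
lra.
Qed.

Lemma markov_converges u : (forall n, CK K (iter n P u)) ->
  (forall e : R, 0 < e -> exists2 r : R, 0 < r & forall n x y, K x -> K y ->
     enorm (x - y) <= r -> `|iter n P u x - iter n P u y| <= e) ->
  exists l : R, forall e : R, 0 < e -> exists N, forall n x, (N <= n)%N -> K x ->
    `|iter n P u x - l| <= e.
Proof.
move=> cu equi.
have small e : 0 < e -> exists n, forall x y, K x -> K y -> iter n P u x - iter n P u y <= e.
  move=> e0; have e2 : 0 < e / 2 by rewrite divr_gt0.
  have [r r0 Hr] := equi _ e2; have [N HN] := dense r0.
  have [x1 Kx1] := K0.
  (* [c <= 1] needs a letter to exist, which a word of positive length provides. *)
  have c1 : c ^+ N <= 1.
    have [J JN _] := HN _ _ Kx1 Kx1; case: N JN {HN} => [|N] JN; first by rewrite expr0.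
    apply: exprn_ile1; first exact: ltW.
    case: J JN => // j J _; rewrite -(pr1 Kx1) (bigD1 j) //=.
    apply: (le_trans (pr_ge j Kx1)); rewrite lerDl sumr_ge0 // => i _.
    by rewrite ltW ?pr0.
  have cN0 : 0 < c ^+ N by rewrite exprn_gt0.
  have [D D0 HD] := CK_bounded cK (cu 0%N).
  (* [e / 2] is the fixed point of the recursion in [markov_oscillation]; the excess over it decays
     geometrically from at most [2 * D]. *)
  have it k x y : K x -> K y -> iter (k * N) P u x - iter (k * N) P u y <=
      (1 - c ^+ N) ^+ k * (2 * D) + e / 2.
    elim: k x y => [|k IH] x y Kx Ky.
      rewrite expr0 mul1r mul0n; have := HD _ Kx; have := HD _ Ky; rewrite !ler_norml /=.
      by move=> /andP[? ?] /andP[? ?]; lra.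
    rewrite mulSn iterD.
    apply: (le_trans (markov_oscillation (cu (k * N)%N) (Hr (k * N)%N) HN c1 IH Kx Ky)).
    by rewrite exprS le_eqVlt; apply/orP; left; apply/eqP; ring.
  have k0 : 0 <= 1 - c ^+ N by rewrite subr_ge0.
  have k1 : 1 - c ^+ N < 1 by rewrite ltrBlDr ltrDl.
  have [|k Hk] := @exprn_small R _ (e / 2 / (2 * D)) k0 k1; first by rewrite !divr_gt0 // mulr_gt0.
  exists (k * N)%N => x y Kx Ky; apply: (le_trans (it k x y Kx Ky)).
  have := Hk k (leqnn k); rewrite ler_pdivlMr ?mulr_gt0 //; lra.
(* Averaging keeps all later values within the range attained at time [n0]. *)
have stay e n0 : (forall x y, K x -> K y -> iter n0 P u x - iter n0 P u y <= e) ->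
    forall n x y, (n0 <= n)%N -> K x -> K y -> `|iter n P u x - iter n0 P u y| <= e.
  move=> H n x y n0n Kx Ky; rewrite -(subnK n0n) iterD.
  rewrite ler_norml lerBrDr lerBlDr; apply/andP; split.
    by apply: P_lb => // z Kz; have := H _ _ Ky Kz; lra.
  by apply: P_ub => // z Kz; have := H _ _ Kz Ky; lra.
have [x1 Kx1] := K0.
have cv : cvgn (fun n => iter n P u x1).
  apply/cauchy_cvgP/cauchy_exP => e e0.
  have [|n0 Hn0] := small (e / 2); first by rewrite divr_gt0.
  exists (iter n0 P u x1); exists n0 => //= n n0n; rewrite /ball /= distrC.
  by apply: (le_lt_trans (stay _ _ Hn0 n x1 x1 n0n Kx1 Kx1)); lra.
exists (limn (fun n => iter n P u x1)) => e e0.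
have e2 : 0 < e / 2 by rewrite divr_gt0.
have [n0 Hn0] := small _ e2; exists n0 => n x n0n Kx.
have A := stay _ _ Hn0 n x x1 n0n Kx Kx1.
have B : `|limn (fun n => iter n P u x1) - iter n0 P u x1| <= e / 2.
  by apply: (@cvg_dist_le R nat \oo _ (fun n => iter n P u x1) _ _ _ cv); exists n0 => //= k n0k; exact: stay.
move: A B; rewrite !ler_norml => /andP[? ?] /andP[? ?].
by apply/andP; split; lra.
Qed.

End MarkovConvergence.

(** * Transfer of the convergence to the Ruelle operator *)

Section RuelleConvergence.
Context (R : realType) (d m : nat) (K : set 'rV[R]_d).
Context (w : 'I_m -> 'rV[R]_d -> 'rV[R]_d) (q : 'I_m -> 'rV[R]_d -> R).
Hypotheses (K0 : K !=set0) (cK : compact K) (wK : forall j x, K x -> K (w j x)).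
Hypotheses (nw : forall j, nonexpansive K (w j)) (cq : forall j, CK K (q j)).
Context (c0 : R) (h : 'rV[R]_d -> R).
Hypotheses (c0_gt0 : 0 < c0) (c0_le : forall j x, K x -> c0 <= q j x).
Local Notation T := (ruelle w q).
Hypotheses (ch : CK K h) (h0 : forall x, K x -> 0 < h x) (Th : forall x, K x -> T h x = h x).
Hypothesis dense : forall e : R, 0 < e ->
  exists N, forall x z, K x -> K z -> exists2 J, size J = N & enorm (word_map w J x - z) <= e.
Hypothesis equi : forall f (e : R), CK K f -> 0 < e -> exists2 r : R, 0 < r &
  forall n x y, K x -> K y -> enorm (x - y) <= r -> `|iter n T f x - iter n T f y| <= e.
Hypothesis bdd : exists B : R, forall n x, K x -> iter n T (fun=> 1) x <= B.

(** The Doob transform by h: the weights sum to 1 because T h = h. *)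
Let pr j x := q j x * h (w j x) / h x.
Let P := ruelle w pr.

Let q0 j x : K x -> 0 < q j x. Proof. by move=> Kx; apply: lt_le_trans (c0_le j Kx). Qed.

Let P_T f n x : K x -> iter n P (fun y => f y / h y) x = iter n T f x / h x.
Proof.
elim: n x => // n IH x Kx.
change (\sum_(j < m) pr j x * iter n P (fun y => f y / h y) (w j x) =
  (\sum_(j < m) q j x * iter n T f (w j x)) / h x).
rewrite mulr_suml; apply: eq_bigr => j _; have Kj := wK j Kx.
by rewrite IH // /pr; field; rewrite !gt_eqF ?h0.
Qed.

Lemma ruelle_converges f : CK K f -> exists l : R, forall e : R, 0 < e ->
  exists N, forall n x, (N <= n)%N -> K x -> `|iter n T f x - l * h x| <= e.
Proof.
move=> cf.
have [a Ka ha] := CK_min cK K0 ch; have [b Kb hb] := CK_max cK K0 ch.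
have a0 := h0 Ka; have b0 := h0 Kb.
have ci : CK K (fun x => (h x)^-1) by exact: (CK_inv cK).
have cPn n : CK K (iter n P (fun y => f y / h y)).
  have cT := iter_ruelle_CK cK wK nw cq (n := n) cf.
  by apply: CK_eq (CK_mul cK cT ci) => // x Kx; rewrite P_T.
have [F F0 HF] := CK_bounded cK cf; have [B HB] := bdd.
have equiP (e : R) : 0 < e -> exists2 r : R, 0 < r & forall n x y, K x -> K y ->
    enorm (x - y) <= r -> `|iter n P (fun y => f y / h y) x - iter n P (fun y => f y / h y) y| <= e.
  move=> e0.
  have B0 : 0 <= B by have := le_trans ler01 (HB 0%N _ Ka).
  have I0 : 0 < (h a)^-1 by rewrite invr_gt0.
  have e1 : 0 < e / 2 / (h a)^-1 by rewrite !divr_gt0.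
  have FB : 0 < F * B + 1 by rewrite ltr_wpDl // mulr_ge0 // ltW.
  have e2 : 0 < e / 2 / (F * B + 1) by rewrite !divr_gt0.
  have [r r0 Hr] := equi cf e1; have [s s0 Hs] := CK_ucont cK ci e2.
  exists (Num.min r s) => [|n x y Kx Ky]; first by rewrite lt_min r0.
  rewrite le_min => /andP[xr xs]; rewrite !P_T //.
  have -> : iter n T f x / h x - iter n T f y / h y =
     (iter n T f x - iter n T f y) / h x + iter n T f y * ((h x)^-1 - (h y)^-1) by ring.
  apply: (le_trans (ler_normD _ _)); rewrite !normrM.
  have -> : e = e / 2 / (h a)^-1 * (h a)^-1 + (F * B + 1) * (e / 2 / (F * B + 1)).
    by field; rewrite !gt_eqF.
  apply: lerD; apply: ler_pM => //; [exact: Hr | | | exact: Hs].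
    rewrite ger0_norm; last by rewrite invr_ge0 ltW // h0.
    by rewrite lef_pV2 ?posrE ?h0 ?ha.
  apply: (le_trans (iter_ruelle_abs wK q0 n HF Ky)).
  apply: (@le_trans _ _ (F * B)); last by rewrite lerDl.
  by apply: ler_wpM2l; [exact: ltW | exact: HB].
have pr_ge j x : K x -> c0 * h a / h b <= pr j x.
  move=> Kx; apply: ler_pM.
  - by rewrite mulr_ge0 // ltW.
  - by rewrite invr_ge0 ltW.
  - by apply: ler_pM => //; [exact: ltW | exact: ltW | exact: c0_le | apply: ha; exact: wK].
  - by rewrite lef_pV2 ?posrE ?h0 ?hb.
have pr1 x : K x -> \sum_(j < m) pr j x = 1.
  by move=> Kx; rewrite /pr -mulr_suml -/(ruelle w q h x) Th // mulfV // gt_eqF // h0.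
have cc : 0 < c0 * h a / h b by rewrite divr_gt0 // mulr_gt0.
have [l Hl] := markov_converges K0 cK wK cc pr_ge pr1 dense cPn equiP.
exists l => e e0; have e1 : 0 < e / h b by rewrite divr_gt0.
have [N HN] := Hl _ e1; exists N => n x Nn Kx.
have := HN n x Nn Kx; rewrite P_T // => H.
have hx := h0 Kx.
have -> : iter n T f x - l * h x = (iter n T f x / h x - l) * h x by field; rewrite gt_eqF.
rewrite normrM (gtr0_norm hx) -[leRHS](divfK (lt0r_neq0 b0)).
by apply: ler_pM => //; [exact: ltW | exact: hb].
Qed.

End RuelleConvergence.

(** One enumeration serves all double series at once: merging covers uses it for the covering
    functions at every point and for the values of the functional. *)
Lemma nneseries_pairs (R : realType) : exists e : nat -> nat * nat,
  forall a : nat -> nat -> \bar R, (forall n k, 0 <= a n k)%E ->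
    (\sum_(i <oo) a (e i).1 (e i).2 = \sum_(n <oo) \sum_(k <oo) a n k)%E.
Proof.
have /card_set_bijP[e be] := card_esym card_nat2.
exists e => a a0.
rewrite nneseries_esumT; last by move=> i; exact: a0.
have -> : (\sum_(n <oo) \sum_(k <oo) a n k =
    \esum_(n in [set: nat]) \esum_(k in [set: nat]) a n k)%E.
  rewrite nneseries_esumT; last by move=> n; exact: nneseries_ge0.
  by apply: eq_esum => n _; rewrite nneseries_esumT.
rewrite esum_esum //.
rewrite (_ : [set: nat] `*`` (fun=> [set: nat]) = [set: nat * nat]); last first.
  by apply/seteqP; split.
by rewrite (reindex_esum [set: nat] _ e).
Qed.

(** * The representing measure *)

Section Riesz.
Context (R : realType) (d : nat) (K : set 'rV[R]_d) (nu : ('rV[R]_d -> R) -> R).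
Hypothesis cK : compact K.
Hypothesis nuD : forall f g, CK K f -> CK K g -> nu (fun x => f x + g x) = nu f + nu g.
Hypothesis nuZ : forall (c : R) f, CK K f -> nu (fun x => c * f x) = c * nu f.
Hypothesis nu_ge0 : forall f, CK K f -> (forall x, K x -> 0 <= f x) -> 0 <= nu f.
Hypothesis nu1 : nu (fun=> 1) = 1.
Local Notation V := 'rV[R]_d.
Implicit Types (f : V -> R) (g : V -> \bar R) (x y : V).

Lemma functional_le f f' : CK K f -> CK K f' -> (forall x, K x -> f x <= f' x) -> nu f <= nu f'.
Proof.
move=> cf cf' ff'.
have E : nu (fun x => f' x + (-1) * f x) = nu f' + (-1) * nu f.
  by rewrite nuD ?nuZ //; exact: (CK_scale cK).
have : 0 <= nu (fun x => f' x + (-1) * f x).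
  apply: nu_ge0 => [|x Kx]; first by apply: (CK_add cK) => //; exact: (CK_scale cK).
  by have := ff' _ Kx; lra.
by rewrite E; lra.
Qed.

Lemma functional_eq f f' : CK K f -> CK K f' -> (forall x, K x -> f x = f' x) -> nu f = nu f'.
Proof.
move=> cf cf' E; apply/eqP; rewrite eq_le.
by apply/andP; split; apply: functional_le => // x Kx; rewrite E.
Qed.

Lemma functional_cst (c : R) : nu (fun=> c) = c.
Proof.
rewrite -[RHS]mulr1 -nu1 -nuZ; last exact: CK_cst.
by apply: functional_eq; [exact: CK_cst | exact: (CK_scale cK (CK_cst (c := 1))) | move=> x _; rewrite mulr1].
Qed.

Lemma functional_sum (F : nat -> V -> R) n : (forall k, CK K (F k)) ->
  nu (fun x => \sum_(k < n) F k x) = \sum_(k < n) nu (F k).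
Proof.
move=> cF; have cS k : CK K (fun x => \sum_(i < k) F i x) by apply: (CK_sum cK) => i; exact: cF.
elim: n => [|n IH].
  rewrite big_ord0 -[RHS]functional_cst; apply: functional_eq => //; first exact: CK_cst.
  by move=> x _; rewrite big_ord0.
rewrite big_ord_recr /= -IH -nuD //; apply: functional_eq.
- exact: (@cS n.+1).
- by apply: (CK_add cK); [exact: (@cS n) | exact: cF].
- by move=> x _; rewrite big_ord_recr.
Qed.

(** The sums defining Daniell's upper integral. Countable covers build in countable subadditivity,
    and since they are tested on [K] only, the complement of [K] is invisible. *)
Definition cover_sums g : set (\bar R) := [set s | exists F : nat -> V -> R,
  [/\ forall k, CK K (F k), forall k x, K x -> 0 <= F k x,
      forall x, K x -> (g x <= \sum_(k <oo) (F k x)%:E)%E &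
      s = (\sum_(k <oo) (nu (F k))%:E)%E]].

Definition outer_integral g : \bar R := ereal_inf (cover_sums g).

Lemma outer_integral_ge0 g : (0 <= outer_integral g)%E.
Proof.
apply: le_ereal_inf_tmp => _ [F [cF F0 _ ->]].
by apply: nneseries_ge0 => k _ _; rewrite lee_fin nu_ge0 // => x; exact: F0.
Qed.

Lemma outer_integral_le g g' : (forall x, K x -> (g x <= g' x)%E) ->
  (outer_integral g <= outer_integral g')%E.
Proof.
move=> gg'; apply: le_ereal_inf_tmp => _ [F [cF F0 Fg ->]].
apply: ereal_inf_lbound; exists F; split => // x Kx.
by apply: le_trans (Fg _ Kx); exact: gg'.
Qed.

Lemma nneseries_first (a : \bar R) : (0 <= a)%E ->
  (\sum_(k <oo) (if k == 0%N then a else 0) = a)%E.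
Proof.
move=> a0; rewrite nneseries_recl //; last by move=> k _; case: ifP.
by rewrite eseries0 ?adde0 // => -[].
Qed.

Lemma outer_integral_le_functional f g : CK K f -> (forall x, K x -> 0 <= f x) ->
  (forall x, K x -> (g x <= (f x)%:E)%E) -> (outer_integral g <= (nu f)%:E)%E.
Proof.
move=> cf f0 gf; apply: ereal_inf_lbound.
exists (fun k => if k == 0%N then f else fun=> 0); split.
- by case=> [|k] //=; exact: CK_cst.
- by case=> [|k] x Kx //=; exact: f0.
- move=> x Kx; apply: (le_trans (gf _ Kx)).
  rewrite (eq_eseriesr (g := fun k => if k == 0%N then (f x)%:E else 0%E)); last by case.
  by rewrite nneseries_first // lee_fin f0.
- rewrite (eq_eseriesr (g := fun k => if k == 0%N then (nu f)%:E else 0%E)).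
    by rewrite nneseries_first // lee_fin nu_ge0.
  by case=> [|k] _ //=; rewrite functional_cst.
Qed.

(** Covers of the [G n] that are optimal up to [e / (2 ^ n.+1)%:R] are merged into one; infinite
    terms are set aside first, as near-optimal covers require finite values. *)
Lemma outer_integral_subadditive g (G : nat -> V -> \bar R) :
  (forall n x, K x -> 0 <= G n x)%E ->
  (forall x, K x -> g x <= \sum_(n <oo) G n x)%E ->
  (outer_integral g <= \sum_(n <oo) outer_integral (G n))%E.
Proof.
move=> G0 gG.
have [[n Gn]|fin] := pselect (exists n, outer_integral (G n) = +oo%E).
  by rewrite (nneseries_pinfty (k := n)) ?leey // => k _; exact: outer_integral_ge0.
apply/lee_addgt0Pr => e e0.
have ex n : exists F : nat -> V -> R, [/\ forall k, CK K (F k), forall k x, K x -> 0 <= F k x,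
      forall x, K x -> (G n x <= \sum_(k <oo) (F k x)%:E)%E &
      (\sum_(k <oo) (nu (F k))%:E <= outer_integral (G n) + (e / (2 ^ n.+1)%:R)%:E)%E].
  have en : 0 < e / (2 ^ n.+1)%:R by rewrite divr_gt0 // ltr0n expn_gt0.
  have Gfin : outer_integral (G n) \is a fin_num.
    rewrite ge0_fin_numE ?outer_integral_ge0 // ltey; apply/eqP => Gn.
    by apply: fin; exists n.
  have [_ [F [cF F0 FG ->]] lt] := lb_ereal_inf_adherent en Gfin.
  by exists F; split => //; exact: ltW.
have {ex} [F HF] := choice ex.
have [p Hp] := nneseries_pairs R.
apply: (@le_trans _ _ (\sum_(n <oo) \sum_(k <oo) (nu (F n k))%:E)%E).
  apply: ereal_inf_lbound; exists (fun i => F (p i).1 (p i).2); split.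
  - by move=> k; case: (HF (p k).1).
  - by move=> k x Kx; case: (HF (p k).1) => _ H _ _; exact: H.
  - move=> x Kx; apply: (le_trans (gG _ Kx)).
    rewrite (Hp (fun n k => (F n k x)%:E)); last first.
      by move=> n k; rewrite lee_fin; case: (HF n) => _ H _ _; exact: H.
    apply: lee_nneseries => n _; first by move=> _; exact: G0.
    by case: (HF n) => _ _ H _; exact: H.
  - rewrite (Hp (fun n k => (nu (F n k))%:E)) // => n k.
    by rewrite lee_fin; case: (HF n) => H H' _ _; apply: nu_ge0 => // x; exact: H'.
apply: le_trans (epsilon_trick xpredT _ (ltW e0)); last by move=> n; exact: outer_integral_ge0.
apply: lee_nneseries => n _; last by case: (HF n).
move=> _; apply: nneseries_ge0 => k _ _.
by rewrite lee_fin; case: (HF n) => H H' _ _; apply: nu_ge0 => // x; exact: H'.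
Qed.

Lemma outer_integral0 : outer_integral (fun=> 0%E) = 0%E.
Proof.
apply/eqP; rewrite eq_le outer_integral_ge0 andbT -[leRHS](_ : (nu (fun=> 0))%:E = _).
  by apply: outer_integral_le_functional => //; exact: CK_cst.
by rewrite functional_cst.
Qed.

Lemma nneseries_fin n (a : nat -> \bar R) : (forall k, 0 <= a k)%E ->
  (\sum_(k <oo) (if (k < n)%N then a k else 0) = \sum_(k < n) a k)%E.
Proof.
move=> a0; rewrite (nneseries_split _ n) ?add0n //; last by move=> k _; case: ifP.
rewrite eseries0 ?adde0; last by move=> k nk _; rewrite ltnNge nk.
by rewrite big_mkord; apply: eq_bigr => i _; rewrite ltn_ord.
Qed.

Lemma outer_integral_sum g n (G : nat -> V -> \bar R) :
  (forall k x, K x -> 0 <= G k x)%E ->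
  (forall x, K x -> g x <= \sum_(k < n) G k x)%E ->
  (outer_integral g <= \sum_(k < n) outer_integral (G k))%E.
Proof.
move=> G0 gG.
have := @outer_integral_subadditive g (fun k => if (k < n)%N then G k else fun=> 0%E).
have -> : (\sum_(k <oo) outer_integral (if (k < n)%N then G k else fun=> 0%E) =
   \sum_(k < n) outer_integral (G k))%E.
  rewrite -(nneseries_fin n (a := fun k => outer_integral (G k))); last first.
    by move=> k; exact: outer_integral_ge0.
  by apply: eq_eseriesr => k _; case: ifP => // _; rewrite outer_integral0.
apply; first by move=> k x Kx; case: ifP => // _; exact: G0.
move=> x Kx; apply: (le_trans (gG _ Kx)).
rewrite (eq_eseriesr (g := fun k => if (k < n)%N then (if (k < n)%N then G k x else 0) else 0)%E); last first.
  by move=> k _; case: ifP.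
rewrite (nneseries_fin n (a := fun k => if (k < n)%N then G k x else 0%E)); last first.
  by move=> k; case: ifP => // _; exact: G0.
by apply: lee_sum => i _; rewrite ltn_ord.
Qed.

(* Dini: by compactness finitely many terms of the cover already exceed f - e. *)
Lemma functional_le_cover f (F : nat -> V -> R) : CK K f -> (forall k, CK K (F k)) ->
  (forall k x, K x -> 0 <= F k x) -> (forall x, K x -> ((f x)%:E <= \sum_(k <oo) (F k x)%:E)%E) ->
  ((nu f)%:E <= \sum_(k <oo) (nu (F k))%:E)%E.
Proof.
move=> cf cF F0 fF; apply/lee_addgt0Pr => e e0; have e2 : 0 < e / 2 by rewrite divr_gt0.
have cS n : CK K (fun x => \sum_(k < n) F k x) by apply: (CK_sum cK) => k; exact: cF.
have /near_covering_withinP cov := (compact_near_coveringP K).1 cK.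
have : \forall n \near \oo, K `<=` (fun x => f x <= e + \sum_(k < n) F k x).
  apply: (cov nat \oo (fun n x => f x <= e + \sum_(k < n) F k x)) => x Kx.
  have [n Hn] : exists n, f x - e / 2 <= \sum_(k < n) F k x.
    apply: contrapT => nex.
    have : (\sum_(k <oo) (F k x)%:E <= (f x - e / 2)%:E)%E.
      apply: lime_le; first by apply: is_cvg_nneseries => k _ _; rewrite lee_fin F0.
      apply: nearW => n; rewrite big_mkord sumEFin lee_fin leNgt; apply/negP => lt.
      by apply: nex; exists n; exact: ltW.
    move/(le_trans (fF _ Kx)); rewrite lee_fin; lra.
  have cfS : CK K (fun y => f y - \sum_(k < n) F k y) by exact: (CK_sub cK).
  have [r r0 Hr] := CK_ucont cK cfS e2.
  have [s s0 Hs] := enorm_small d r0.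
  exists ([set y | `|x - y| < s], [set n' | (n <= n')%N]) => /=.
    by split; [exact: nbhs_dist_lt | exists n].
  move=> [y n'] /= [xy nn'] Ky.
  have := Hr x y Kx Ky (Hs _ (ltW xy)); rewrite ler_norml => /andP[A _].
  have : \sum_(k < n) F k y <= \sum_(k < n') F k y.
    by rewrite -(subnKC nn') big_split_ord /= lerDl sumr_ge0 // => i _; exact: F0.
  by move: A Hn; lra.
move=> /filter_ex[n Hn].
have : nu f <= e + \sum_(k < n) nu (F k).
  rewrite -functional_sum // -[X in X + _]functional_cst -nuD //; last exact: CK_cst.
  by apply: functional_le => //; apply: (CK_add cK) => //; exact: CK_cst.
rewrite -lee_fin => /le_trans; apply; rewrite addrC EFinD leeD2r // -sumEFin.
apply: le_trans (nneseries_lim_ge n _); first by rewrite big_mkord.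
by move=> k _ _; rewrite lee_fin nu_ge0 // => x; exact: F0.
Qed.

Lemma functional_le_outer f : CK K f -> ((nu f)%:E <= outer_integral (EFin \o f))%E.
Proof.
move=> cf; apply: le_ereal_inf_tmp => _ [F [cF F0 fF ->]].
exact: functional_le_cover.
Qed.

Section OpenSets.
Context (U : set V) (oU : open U).

(* The distance to the complement of U, truncated at 1. *)
Let radii x : set R := [set r | 0 <= r <= 1 /\ forall y, `|x - y| < r -> U y].
Let psi x : R := sup (radii x).

Let radii_sup x : has_sup (radii x).
Proof.
split; last by exists 1 => r [/andP[]].
by exists 0; split; [rewrite lexx ler01 | move=> y; rewrite normr_lt0].
Qed.

Let psi_ge x r : radii x r -> r <= psi x. Proof. exact: (sup_upper_bound (radii_sup x)). Qed.

Let psi_ge0 x : 0 <= psi x.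
Proof. by apply: psi_ge; split; [rewrite lexx ler01 | move=> y; rewrite normr_lt0]. Qed.

Let psi_le1 x : psi x <= 1.
Proof. by apply: ge_sup; [case: (radii_sup x) | move=> r [/andP[]]]. Qed.

Let psi_gt0 x : U x -> 0 < psi x.
Proof.
move=> Ux; have /nbhs_ballP[e /= e0 He] : nbhs x U by exact: open_nbhs_nbhs.
apply: (@lt_le_trans _ _ (Num.min e 1)); first by rewrite lt_min e0 ltr01.
apply: psi_ge; split; first by rewrite le_min (ltW e0) ler01 ge_min lexx orbT.
by move=> y; rewrite lt_min => /andP[xy _]; apply: He; rewrite mx_norm_ball.
Qed.

Let psi_eq0 x : ~ U x -> psi x = 0.
Proof.
move=> nU; apply/eqP; rewrite eq_le psi_ge0 andbT; apply: ge_sup; first by case: (radii_sup x).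
move=> r [_ Hr]; rewrite leNgt; apply/negP => r0; apply: nU; apply: Hr.
by rewrite subrr normr0.
Qed.

Let psi_lip x y : psi x <= psi y + `|x - y|.
Proof.
apply: ge_sup; first by case: (radii_sup x).
move=> r [/andP[r0 r1] Hr]; have [le|lt] := lerP r `|x - y|.
  by apply: (le_trans le); rewrite lerDr psi_ge0.
rewrite -lerBlDr; apply: psi_ge; split.
  by rewrite subr_ge0 (ltW lt) /= (le_trans _ r1) // lerBlDr lerDl.
move=> z yz; apply: Hr.
have -> : x - z = (x - y) + (y - z) by rewrite subrKA.
by apply: (le_lt_trans (ler_normD _ _)); lra.
Qed.

Let psi_CK : CK K psi.
Proof.
apply: ucont_CK => e e0; exists e => // x y _ _ xy.
have A := le_trans (norm_le_enorm _) xy.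
have := psi_lip x y; have := psi_lip y x; rewrite distrC.
by rewrite ler_norml => *; apply/andP; split; lra.
Qed.

(** The functions f (1 - psi)^n majorize f outside [U], and their decrements [F k] add up to f on
    [U]. The first n decrements cost exactly nu f - nu (phi n), and nu (phi n) is at least the outer
    integral of f outside [U]. *)
Lemma outer_integral_split f : CK K f -> (forall x, K x -> 0 <= f x) ->
  (outer_integral (fun x => (f x * \1_U x)%:E) +
   outer_integral (fun x => (f x * \1_(~` U) x)%:E) <= (nu f)%:E)%E.
Proof.
move=> cf f0.
have c1 : CK K (fun x => 1 - psi x) by apply: (CK_sub cK) => //; exact: CK_cst.
pose phi n x := f x * (1 - psi x) ^+ n.
have cphi n : CK K (phi n) by apply: (CK_mul cK) => //; exact: (CK_exp cK).
have p1 x : 0 <= 1 - psi x by rewrite subr_ge0.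
have phi0 n x : K x -> 0 <= phi n x by move=> Kx; rewrite mulr_ge0 ?f0 ?exprn_ge0.
pose F k x := phi k x * psi x.
have cF k : CK K (F k) by exact: (CK_mul cK).
have F0 k x : K x -> 0 <= F k x by move=> Kx; rewrite mulr_ge0 ?phi0.
have tel n x : \sum_(k < n) F k x = f x - phi n x.
  elim: n => [|n IH]; first by rewrite big_ord0 /phi expr0 mulr1 subrr.
  by rewrite big_ord_recr /= IH /F /phi exprS; ring.
have nuF n : \sum_(k < n) nu (F k) = nu f - nu (phi n).
  rewrite -functional_sum //.
  have E : nu (fun x => f x + (-1) * phi n x) = nu f + (-1) * nu (phi n).
    by rewrite nuD ?nuZ //; exact: (CK_scale cK).
  rewrite -[RHS]/(nu f + - nu (phi n)) -mulN1r -E; apply: functional_eq.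
  - by apply: (CK_sum cK) => k.
  - by apply: (CK_add cK) => //; exact: (CK_scale cK).
  - by move=> x _; rewrite tel mulN1r.
have out n : (outer_integral (fun x => (f x * \1_(~` U) x)%:E) <= (nu (phi n))%:E)%E.
  apply: outer_integral_le_functional => // [x Kx|x Kx]; first exact: phi0.
  rewrite lee_fin indicE; have [Ux|nUx] := pselect (U x).
    by rewrite memNset ?mulr0 ?phi0 //; apply.
  by rewrite mem_set // mulr1 /phi psi_eq0 // subr0 expr1n mulr1.
have fin : outer_integral (fun x => (f x * \1_(~` U) x)%:E) \is a fin_num.
  by rewrite ge0_fin_numE ?outer_integral_ge0 // (le_lt_trans (out 0%N)) // ltry.
rewrite -leeBrDr //.
apply: (@le_trans _ _ (\sum_(k <oo) (nu (F k))%:E)%E).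
  apply: ereal_inf_lbound; exists F; split => // x Kx.
  rewrite indicE; have [Ux|nUx] := pselect (U x); last first.
    by rewrite memNset // mulr0; apply: nneseries_ge0 => k _ _; rewrite lee_fin F0.
  rewrite mem_set // mulr1; apply/lee_addgt0Pr => e e0.
  have q1 : 1 - psi x < 1 by rewrite ltrBlDr ltrDl psi_gt0.
  have [|N HN] := @exprn_small R _ (e / (f x + 1)) (p1 x) q1.
    by rewrite divr_gt0 // ltr_wpDl // f0.
  apply: (@le_trans _ _ ((\sum_(k < N) F k x)%:E + e%:E)%E).
    rewrite -EFinD lee_fin tel; have := HN N (leqnn N).
    rewrite ler_pdivlMr ?ltr_wpDl ?f0 // => H.
    have : phi N x <= e.
      apply: le_trans H; rewrite /phi mulrC; apply: ler_wpM2l; first exact: exprn_ge0.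
      by rewrite lerDl.
    lra.
  rewrite leeD2r // -sumEFin.
  apply: le_trans (nneseries_lim_ge N _); first by rewrite big_mkord.
  by move=> k _ _; rewrite lee_fin F0.
apply: lime_le.
  by apply: is_cvg_nneseries => k _ _; rewrite lee_fin nu_ge0 // => x; exact: F0.
apply: nearW => n; rewrite big_mkord sumEFin nuF leeBrDr //.
apply: (le_trans (leeD2l _ (out n))); rewrite -EFinD lee_fin; lra.
Qed.

End OpenSets.

(** * The measure and its Borel sets *)

Definition daniell_measure (A : set V) : \bar R := outer_integral (fun x => (\1_A x)%:E).

Lemma daniell_measure0 : daniell_measure set0 = 0%E.
Proof.
rewrite -[RHS]outer_integral0; congr outer_integral.
by apply/funext => x; rewrite indic0.
Qed.

Lemma daniell_measure_ge0 A : (0 <= daniell_measure A)%E.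
Proof. exact: outer_integral_ge0. Qed.

Lemma daniell_measure_le : {homo daniell_measure : A B / A `<=` B >-> (A <= B)%E}.
Proof.
move=> A B AB; apply: outer_integral_le => x Kx; rewrite lee_fin !indicE ler_nat.
by case: (boolP (x \in A)) => //; rewrite inE => /AB/mem_set ->.
Qed.

Lemma daniell_measure_subadditive : sigma_subadditive daniell_measure.
Proof.
move=> F; apply: outer_integral_subadditive => [n x _|x _]; first by rewrite lee_fin.
have F0 n : (0 <= (\1_(F n) x)%:E :> \bar R)%E by rewrite lee_fin.
rewrite indicE; have [[n _ Fnx]|nF] := pselect ((\bigcup_n F n) x); last first.
  by rewrite memNset //; exact: nneseries_ge0.
rewrite mem_set; last by exists n.
rewrite (nneseriesD1 (n := n)) // indicE mem_set // leeDl //.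
exact: nneseries_ge0.
Qed.

Definition daniell_outer : {outer_measure set V -> \bar R} :=
  HB.pack daniell_measure (isOuterMeasure.Build R V daniell_measure
    daniell_measure0 daniell_measure_ge0 daniell_measure_le daniell_measure_subadditive).

(** Every function in a cover of the indicator of X splits along [U] by [outer_integral_split];
    summing the pieces covers both parts of X at no extra cost. *)
Lemma open_caratheodory U : open U -> daniell_outer.-caratheodory U.
Proof.
move=> oU; apply: le_caratheodory_measurable => X.
rewrite /daniell_outer /= /daniell_measure.
apply: le_ereal_inf_tmp => _ [F [cF F0 FX ->]].
have inD (B : set V) : (outer_integral (fun x => (\1_(X `&` B) x)%:E) <=
    \sum_(k <oo) outer_integral (fun x => (F k x * \1_B x)%:E))%E.
  apply: outer_integral_subadditive => [n x Kx|x Kx].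
    by rewrite lee_fin mulr_ge0 ?F0.
  rewrite indicI /=; have [Bx|nBx] := pselect (B x).
    rewrite [\1_B x]indicE mem_set // mulr1; apply: (le_trans (FX _ Kx)).
    by apply: lee_nneseries => k _; [rewrite lee_fin F0 | rewrite mulr1].
  rewrite [\1_B x]indicE memNset // mulr0; apply: nneseries_ge0 => k _ _.
  by rewrite mulr0.
apply: (le_trans (leeD (inD U) (inD (~` U)))).
rewrite -nneseriesD; try by move=> *; exact: outer_integral_ge0.
apply: lee_nneseries => k _.
  by move=> _; apply: adde_ge0; exact: outer_integral_ge0.
by apply: outer_integral_split => // x; exact: F0.
Qed.

Lemma borel_caratheodory (A : set (borel R d)) : measurable A -> daniell_outer.-caratheodory A.
Proof.
(* Borel measurability means membership in every sigma-algebra that contains the open sets. *)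
move=> mA; apply: (mA (daniell_outer.-caratheodory)); split; last exact: open_caratheodory.
split.
- exact: caratheodory_measurable_set0.
- by move=> B mB; apply: caratheodory_measurable_setD => //; rewrite -setC0;
    apply: caratheodory_measurable_setC; exact: caratheodory_measurable_set0.
- by move=> F mF; exact: caratheodory_measurable_bigcup.
Qed.

Lemma daniell_sigma_additive : semi_sigma_additive (daniell_measure : set (borel R d) -> \bar R).
Proof.
move=> F mF tF mU; apply: (@caratheodory_measure_sigma_additive R V daniell_outer) => //.
- by move=> n; exact: borel_caratheodory.
- exact: borel_caratheodory.
Qed.

(** Covers see only [K], so [K] and the whole space both have mass nu 1 = 1. *)
Lemma daniell_setK (A : set V) : K `<=` A -> daniell_measure A = 1%E.
Proof.
move=> KA; apply/eqP; rewrite eq_le; apply/andP; split.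
  rewrite -[leRHS](_ : (nu (fun=> 1))%:E = _); last by rewrite nu1.
  apply: outer_integral_le_functional => //; first exact: CK_cst.
  by move=> x Kx; rewrite indicE mem_set //; exact: KA.
rewrite -[leLHS](_ : (nu (fun=> 1))%:E = _); last by rewrite nu1.
apply: (le_trans (functional_le_outer (CK_cst (c := 1)))); apply: outer_integral_le => x Kx /=.
by rewrite indicE mem_set //; exact: KA.
Qed.

(** [daniell_measure] retyped on [borel R d], to carry the measure and probability structures. *)
Definition daniell_borel (A : set (borel R d)) : \bar R := daniell_measure A.

HB.instance Definition _ := isMeasure.Build _ (borel R d) R daniell_borel
  daniell_measure0 daniell_measure_ge0 daniell_sigma_additive.

Lemma daniell_setT : daniell_borel setT = 1%E.
Proof. exact: daniell_setK. Qed.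

HB.instance Definition _ := Measure_isProbability.Build _ (borel R d) R daniell_borel daniell_setT.

Definition daniell_probability : probability (borel R d) R := daniell_borel.

(** * Integrals against the measure and its uniqueness *)

Lemma compact_borel : measurable (K : set (borel R d)).
Proof.
have clK : closed K by apply: compact_closed => //; exact: norm_hausdorff.
rewrite -(setCK K); apply: measurableC; apply: sub_sigma_algebra; exact: closed_openC.
Qed.

Lemma CK_measurable f : CK K f -> measurable_fun (K : set (borel R d)) (f : borel R d -> R).
Proof.
move=> cf; apply: (measurability _ (RGenOInfty.measurableE R)) => _ [_ [a ->] <-].
move: cf => /continuousP /(_ _ (rray_open a)) /open_subspaceP [Q oQ QK].
rewrite setIC -QK; apply: measurableI; last exact: compact_borel.
exact: sub_sigma_algebra.
Qed.

Lemma CK_integrable (mu : probability (borel R d) R) f : CK K f ->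
  mu.-integrable K (EFin \o f).
Proof.
move=> cf; apply: measurable_bounded_integrable.
- exact: compact_borel.
- by rewrite (le_lt_trans (probability_le1 _ compact_borel)) // ltry.
- exact: CK_measurable.
- have [M M0 HM] := CK_bounded cK cf; exists M; split; first exact: num_real.
  by move=> y My x Kx; apply: le_trans (ltW My); exact: HM.
Qed.

(** The sum is the integer part of t; it discretizes a function into indicators of its level
    sets. *)
Lemma count_levels (t : R) N : 0 <= t -> t <= N%:R ->
  t - 1 <= \sum_(i < N) ((i.+1%:R <= t)%R : nat)%:R :> R /\ \sum_(i < N) ((i.+1%:R <= t)%R : nat)%:R <= t :> R.
Proof.
move=> t0; elim: N => [|N IH] tN; first by rewrite big_ord0; split; lra.
have all1 : N%:R <= t -> \sum_(i < N) ((i.+1%:R <= t)%R : nat)%:R = N%:R :> R.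
  move=> Nt; rewrite (eq_bigr (fun=> 1)) ?sumr_const ?card_ord // => i _.
  by rewrite (le_trans _ Nt) // ler_nat.
rewrite big_ord_recr /=; move: tN; rewrite -natr1 => tN.
have [le|lt] := lerP (N%:R + 1) t.
  have t1 : true%:R = 1 :> R by [].
  by rewrite t1 all1; [split; lra | lra].
rewrite addr0; have [le'|lt'] := lerP t N%:R; first exact: IH.
by rewrite all1; [split; lra | exact: ltW].
Qed.

(** Layer cake at mesh 1 / n: with A_i = {f >= (i + 1) / n}, the sum of the indicators lies between
    n f - 1 and n f. The lower bound and subadditivity give n nu f <= 1 + sum of the masses of the
    A_i, the upper bound compares these masses with n times the integral, and the error 1 / n is
    below [e]. *)
Lemma functional_le_pairing f : CK K f -> (forall x, K x -> 0 <= f x) ->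
  nu f <= pairing K daniell_probability f.
Proof.
move=> cf f0; have intf := CK_integrable daniell_probability cf.
have [M M0 HM] := CK_bounded cK cf.
apply/ler_addgt0Pr => e e0.
pose n := (Num.truncn e^-1).+1; have n0 : 0 < n%:R :> R by rewrite ltr0n.
have ne : n%:R^-1 <= e.
  by rewrite -[leRHS]invrK lef_pV2 ?posrE ?invr_gt0 // ltW // truncnS_gt.
pose N := (Num.truncn (n%:R * M)).+1.
have fN x : K x -> n%:R * f x <= N%:R.
  move=> Kx; apply: le_trans (ltW (truncnS_gt _)); rewrite ler_wpM2l ?(ltW n0) //.
  by rewrite (le_trans (ler_norm _)) // HM.
have nf0 x : K x -> 0 <= n%:R * f x by move=> Kx; rewrite mulr_ge0 ?f0.
pose A (i : nat) : set (borel R d) := K `&` f @^-1` `[i.+1%:R / n%:R, +oo[.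
have mA i : measurable (A i).
  exact: (CK_measurable cf compact_borel (measurable_itv _)).
have AE i x : K x -> \1_(A i) x = ((i.+1%:R <= n%:R * f x)%R : nat)%:R :> R.
  move=> Kx; rewrite indicE /A; congr (nat_of_bool _)%:R.
  apply/idP/idP; rewrite inE /= in_itv /= andbT ler_pdivrMr // mulrC.
    by case.
  by [].
have cnf : CK K (fun x => n%:R * f x) by exact: (CK_scale cK).
have H1 : ((n%:R * nu f)%:E <= 1 + \sum_(i < N) daniell_measure (A i))%E.
  rewrite -nuZ //; apply: (le_trans (functional_le_outer cnf)).
  pose G (k : nat) : V -> \bar R :=
    if k is k'.+1 then (fun x => (\1_(A k') x)%:E) else (fun=> 1%E).
  have := @outer_integral_sum (EFin \o (fun x => n%:R * f x)) N.+1 G.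
  have G0 k x : K x -> (0 <= G k x)%E by case: k => [|k] _ //=; rewrite lee_fin.
  have GS x : K x -> ((n%:R * f x)%R%:E <= \sum_(k < N.+1) G k x)%E.
    move=> Kx; rewrite big_ord_recl /= sumEFin -EFinD lee_fin.
    have [H _] := count_levels (nf0 _ Kx) (fN _ Kx).
    by under eq_bigr do rewrite AE //; lra.
  move=> /(_ G0 GS) H; apply: (le_trans H); rewrite big_ord_recl /=.
  apply: leeD => //; rewrite -[leRHS](_ : (nu (fun=> 1))%:E = _); last by rewrite nu1.
  by apply: outer_integral_le_functional => //; exact: CK_cst.
have H2 : (\sum_(i < N) daniell_measure (A i) <=
    (n%:R * pairing K daniell_probability f)%:E)%E.
  have intnf := CK_integrable daniell_probability cnf.
  rewrite /pairing -RintegralZl //; last exact: compact_borel.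
  rewrite /Rintegral fineK; last first.
    by apply: (integrable_fin_num compact_borel); exact: intnf.
  have -> : (\sum_(i < N) daniell_measure (A i) =
      \int[daniell_probability]_(x in K) (\sum_(i < N) (\1_(A i) x)%:E))%E.
    rewrite ge0_integral_sum //; last 2 first.
    - exact: compact_borel.
    - move=> i; apply/measurable_EFinP; exact: measurable_indic.
    apply: eq_bigr => i _; rewrite integral_indic //; last exact: compact_borel.
    by rewrite setIidl // => x [].
  apply: le_integral_measurable_free => x Kx.
    by apply: sume_ge0 => i _; rewrite lee_fin.
  rewrite sumEFin lee_fin; have [_ H] := count_levels (nf0 _ Kx) (fN _ Kx).
  by under eq_bigr do rewrite AE //.
have := le_trans H1 (leeD2l 1 H2); rewrite -EFinD lee_fin => H.
have : nu f <= n%:R^-1 + pairing K daniell_probability f.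
  by rewrite -(ler_pM2l n0) mulrDr mulfV ?gt_eqF.
lra.
Qed.

Lemma pairing_add_cst (mu : probability (borel R d) R) (c : R) f : mu K = 1%E -> CK K f ->
  pairing K mu (fun x => f x + c) = pairing K mu f + c.
Proof.
move=> mK cf; rewrite /pairing RintegralD; last 3 first.
- exact: compact_borel.
- exact: CK_integrable.
- exact: (CK_integrable mu (CK_cst (c := c))).
rewrite Rintegral_cst; last exact: compact_borel.
by move: mK => /= ->; rewrite mulr1.
Qed.

(** The one-sided inequality extends to all f, since adding a constant changes both sides equally;
    applied to -f it becomes an equality. *)
Lemma daniell_pairing f : CK K f -> pairing K daniell_probability f = nu f.
Proof.
have mK : daniell_probability K = 1%E by exact: daniell_setK.
have le f' : CK K f' -> nu f' <= pairing K daniell_probability f'.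
  move=> cf; have [M M0 HM] := CK_bounded cK cf.
  have cfM : CK K (fun x => f' x + M) by apply: (CK_add cK) => //; exact: CK_cst.
  have := functional_le_pairing cfM; rewrite pairing_add_cst // nuD //; last exact: CK_cst.
  rewrite functional_cst lerD2r; apply=> x Kx.
  by have := HM _ Kx; rewrite ler_norml => /andP[]; lra.
move=> cf; apply/eqP; rewrite eq_le le // andbT.
have := le _ (CK_scale cK (c := -1) cf); rewrite nuZ //.
rewrite /pairing RintegralZl; last 2 first.
- exact: compact_borel.
- exact: CK_integrable.
by rewrite !mulN1r lerN2.
Qed.

(** A continuous cover of the indicator of A has the same cost under nu as its integral under mu,
    which is at least mu A; so mu A is below every cover sum. *)
Lemma pairing_measure_le (mu : probability (borel R d) R) (A : set (borel R d)) :
  mu K = 1%E -> (forall f, CK K f -> pairing K mu f = nu f) -> measurable A ->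
  (mu A <= daniell_probability A)%E.
Proof.
move=> mK pE mA; apply: le_ereal_inf_tmp => _ [F [cF F0 FA ->]].
have mK' := compact_borel.
have muKC : mu (~` (K : set (borel R d))) = 0%E.
  by have := probability_setC mu mK'; move: mK => /= ->; rewrite subee.
have -> : mu A = mu (A `&` (K : set (borel R d))).
  rewrite (measureDI mu mA mK') [X in (X + _)%E](_ : _ = 0%E) ?add0e //.
  apply/eqP; rewrite eq_le measure_ge0 andbT -[leRHS]muKC; apply: le_measure.
  - by rewrite inE; exact: measurableD.
  - by rewrite inE; exact: measurableC.
  - by move=> x [].
rewrite -integral_indic //.
apply: (@le_trans _ _ (\int[mu]_(x in (K : set (borel R d))) (\sum_(k <oo) (F k x)%:E)))%E.
  by apply: le_integral_measurable_free.
rewrite integral_nneseries //; last first.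
  by move=> k; apply/measurable_EFinP; exact: CK_measurable.
apply: lee_nneseries => k _.
  by move=> _; apply: integral_ge0 => x Kx; rewrite lee_fin F0.
rewrite -pE // /pairing /Rintegral fineK //.
by apply: (integrable_fin_num compact_borel); exact: (CK_integrable mu (cF k)).
Qed.

Lemma riesz_representation : exists mu : probability (borel R d) R,
  [/\ mu K = 1%E, forall f, CK K f -> pairing K mu f = nu f &
    forall mu' : probability (borel R d) R, mu' K = 1%E ->
      (forall f, CK K f -> pairing K mu' f = nu f) ->
      forall A, measurable A -> mu' A = mu A].
Proof.
exists daniell_probability; split; [exact: daniell_setK | exact: daniell_pairing |].
move=> mu' mK pE A mA; apply/eqP; rewrite eq_le pairing_measure_le //=.
(* Both measures have mass 1, so the inequality for the complement is the reverse inequality for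
   A. *)
have := pairing_measure_le mK pE (measurableC mA).
rewrite !probability_setC // leeBlDr ?fin_num_measure // addeC addeA.
by rewrite leeBrDr ?fin_num_measure // addeC leeD2lE.
Qed.

End Riesz.

(** * The Ruelle operator theorem *)

Section RuelleTheorem.
Context (R : realType) (d m : nat) (K : set 'rV[R]_d).
Context (w : 'I_m -> 'rV[R]_d -> 'rV[R]_d) (p : 'I_m -> 'rV[R]_d -> R) (rho : R).
Hypotheses (K0 : K !=set0) (cK : compact K) (wK : forall j x, K x -> K (w j x)).
Hypotheses (nw : forall j, nonexpansive K (w j)) (cp : forall j, CK K (p j)).
Hypotheses (p0 : forall j x, K x -> 0 < p j x) (rho0 : 0 < rho).
Local Notation T := (ruelle w p).
Implicit Types (f g h : 'rV[R]_d -> R) (mu : probability (borel R d) R).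

Let rhoX n : 0 < rho ^- n. Proof. by rewrite invr_gt0 exprn_gt0. Qed.

Lemma ruelle_data_cvg h mu f x : ruelle_data K T rho h mu -> CK K f -> K x ->
  (fun n => rho ^- n * iter n T f x) @ \oo --> pairing K mu f * h x.
Proof.
move=> [[ch _] _ _ _ [_ cv]] cf Kx.
apply/cvgrPdist_le => e e0; move/cvgrPdist_le: (cv _ cf) => /(_ _ e0).
apply: filterS => n; rewrite sub0r normrN => ne; rewrite distrC.
apply: le_trans ne; apply: le_trans (ler_norm _).
apply: (supnorm_ge cK (f := fun x => rho ^- n * iter n T f x - pairing K mu f * h x)) => //.
apply: (CK_sub cK (CK_scale cK (c := _) _) (CK_scale cK (c := _) ch)).
exact: (iter_ruelle_CK cK wK nw cp (n := n) cf).
Qed.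

Lemma pairing_one mu : mu K = 1%E -> pairing K mu (fun=> 1) = 1.
Proof.
move=> muK; rewrite /pairing Rintegral_cst ?mul1r; last exact: compact_borel.
by rewrite [X in fine X]muK.
Qed.

(** The limit of the normalized iterates of f is the pairing times h. Taking f = 1 identifies h, and
    cancelling the positive h then identifies the pairing. *)
Lemma ruelle_data_unique h mu h' mu' :
  ruelle_data K T rho h mu -> ruelle_data K T rho h' mu' ->
  {in K, h' =1 h} /\ (forall f, CK K f -> pairing K mu' f = pairing K mu f).
Proof.
move=> D D'.
have cv f x : CK K f -> K x -> pairing K mu' f * h' x = pairing K mu f * h x.
  move=> cf Kx; rewrite -(cvg_lim _ (ruelle_data_cvg D cf Kx)) //.
  by rewrite (cvg_lim _ (ruelle_data_cvg D' cf Kx)).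
have hh x : K x -> h' x = h x.
  move=> Kx; have [_ muK _ _ _] := D; have [_ muK' _ _ _] := D'.
  have := cv _ x (CK_cst (K := K) (c := 1)) Kx.
  by rewrite !pairing_one // !mul1r.
split=> [x|f cf]; first by rewrite inE; exact: hh.
have [x Kx] := K0; have [[_ h0] _ _ _ _] := D.
have := cv f x cf Kx; rewrite hh // => /mulIf; apply.
by rewrite gt_eqF ?h0.
Qed.

Section Normalization.
Context (h : 'rV[R]_d -> R).
Hypotheses (ch : CK K h) (h0 : forall x, K x -> 0 < h x).
Hypothesis Th : forall x, K x -> T h x = rho * h x.

Let conv f (l : R) := forall e : R, 0 < e -> exists N, forall n x, (N <= n)%N -> K x ->
  `|rho ^- n * iter n T f x - l * h x| <= e.

Hypothesis converges : forall f, CK K f -> exists l, conv f l.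

Let conv_cvg f l x : K x -> conv f l -> (fun n => rho ^- n * iter n T f x) @ \oo --> l * h x.
Proof.
move=> Kx cv; apply/cvgrPdist_le => e /cv[N Ne].
by exists N => // n /= Nn; rewrite distrC; exact: Ne.
Qed.

Let conv_unique f l l' : conv f l -> conv f l' -> l = l'.
Proof.
move=> c c'; have [x Kx] := K0.
have : l * h x = l' * h x.
  by rewrite -(cvg_lim _ (conv_cvg Kx c)) // -(cvg_lim _ (conv_cvg Kx c')).
by move/mulIf; apply; rewrite gt_eqF ?h0.
Qed.

Let convD f g l l' : conv f l -> conv g l' -> conv (fun x => f x + g x) (l + l').
Proof.
move=> c c' e e0; have e2 : 0 < e / 2 by rewrite divr_gt0.
have [N cN] := c _ e2; have [N' cN'] := c' _ e2.
exists (maxn N N') => n x; rewrite geq_max => /andP[nN nN'] Kx.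
rewrite iter_ruelleD mulrDr mulrDl opprD addrACA (splitr e).
by apply: le_trans (ler_normD _ _) _; apply: lerD; [exact: cN|exact: cN'].
Qed.

Let convZ (c : R) f l : conv f l -> conv (fun x => c * f x) (c * l).
Proof.
move=> cv e e0; have c1 : 0 < `|c| + 1 by rewrite ltr_wpDl.
have [|N cN] := cv (e / (`|c| + 1)); first by rewrite divr_gt0.
exists N => n x nN Kx; rewrite iter_ruelleZ mulrCA -mulrA -mulrBr normrM.
apply: (@le_trans _ _ (`|c| * (e / (`|c| + 1)))).
  by apply: ler_wpM2l; [exact: normr_ge0|exact: cN].
rewrite mulrCA -[leRHS]mulr1; apply: ler_wpM2l; first exact: ltW.
by rewrite ler_pdivrMr // mul1r lerDl.
Qed.

Let conv_ge0 f l : (forall x, K x -> 0 <= f x) -> conv f l -> 0 <= l.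
Proof.
move=> f0 /conv_cvg cv; have [x Kx] := K0.
rewrite -(pmulr_lge0 _ (h0 Kx)) -(cvg_lim _ (cv _ Kx)) //.
apply: limr_ge; first by apply/cvg_ex; exists (l * h x); exact: cv.
by near=> n; rewrite mulr_ge0 ?(ltW (rhoX n)) // (iter_ruelle_ge0 wK p0).
Unshelve. all: by end_near. Qed.

Let conv_h : conv h 1.
Proof.
have Tn n x : K x -> iter n T h x = rho ^+ n * h x.
  elim: n x => [|n IH] x Kx; first by rewrite expr0 mul1r.
  rewrite iterS (@ruelle_eq _ _ _ _ _ p wK _ (fun x => rho ^+ n * h x)) //.
  by rewrite ruelleZ Th // exprSr mulrA.
move=> e e0; exists 0%N => n x _ Kx.
by rewrite Tn // mulKf ?expf_neq0 ?gt_eqF // mul1r subrr normr0 ltW.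
Qed.

Let conv_ruelle f l : conv f l -> conv (T f) (rho * l).
Proof.
move=> cv e e0; have [|N cN] := cv (rho^-1 * e); first by rewrite mulr_gt0 ?invr_gt0.
exists N => n x nN Kx; rewrite -iterSr.
have -> : rho ^- n * iter n.+1 T f x - rho * l * h x =
    rho * (rho ^- n.+1 * iter n.+1 T f x - l * h x).
  by rewrite mulrBr !mulrA exprS invfM mulrA divff ?gt_eqF // mul1r.
rewrite normrM gtr0_norm // -ler_pdivlMl //.
by apply: cN => //; exact: leq_trans nN (leqnSn n).
Qed.

Lemma ruelle_theorem_of_convergence : ruelle_operator_theorem K T rho.
Proof.
have [t ct] := converges (CK_cst (K := K) (c := 1)).
(* As 1 - h / M >= 0 has limit coefficient t - 1 / M, t is at least 1 / M. *)
have t0 : 0 < t.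
  have [M M0 hM] := CK_bounded cK ch.
  apply: (@lt_le_trans _ _ M^-1); first by rewrite invr_gt0.
  have := convD ct (convZ (- M^-1) conv_h); rewrite mulr1 => /conv_ge0.
  rewrite subr_ge0; apply => x Kx; rewrite mulNr subr_ge0 mulrC ler_pdivrMr // mul1r.
  exact: le_trans (ler_norm _) (hM _ Kx).
(* The default 0 is taken only where no limit coefficient exists. Dividing by [t] makes the
   functional of total mass 1 and turns the eigenfunction into t h. *)
pose nu0 f := xget 0 [set l | conv f l].
have nu0P f : CK K f -> conv f (nu0 f).
  by case/converges => l cl; exact: (@xgetI _ 0 [set l | conv f l] l cl).
pose nu f := t^-1 * nu0 f.
have nuD f g : CK K f -> CK K g -> nu (fun x => f x + g x) = nu f + nu g.
  move=> cf cg; rewrite /nu -mulrDr; congr (_ * _).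
  exact: conv_unique (nu0P _ (CK_add cK cf cg)) (convD (nu0P _ cf) (nu0P _ cg)).
have nuZ (c : R) f : CK K f -> nu (fun x => c * f x) = c * nu f.
  move=> cf; rewrite /nu mulrCA; congr (_ * _).
  exact: conv_unique (nu0P _ (CK_scale cK (c := c) cf)) (convZ c (nu0P _ cf)).
have nu_ge0 f : CK K f -> (forall x, K x -> 0 <= f x) -> 0 <= nu f.
  move=> cf f0; apply: mulr_ge0; first by rewrite invr_ge0 ltW.
  exact: conv_ge0 f0 (nu0P _ cf).
have nu1 : nu (fun=> 1) = 1.
  by rewrite /nu (conv_unique (nu0P _ (CK_cst (K := K) (c := 1))) ct) mulVf ?gt_eqF.
have [mu [muK mu_nu mu_unique]] := riesz_representation cK nuD nuZ nu_ge0 nu1.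
have cTf f : CK K f -> CK K (T f) by exact: ruelle_CK.
exists (fun x => t * h x), mu.
have D : ruelle_data K T rho (fun x => t * h x) mu.
  split=> //.
  - split; first exact: (CK_scale cK (c := t) ch).
    by move=> x Kx; rewrite mulr_gt0 ?h0.
  - by move=> x; rewrite inE => Kx; rewrite ruelleZ Th // mulrCA.
  - move=> f cf; rewrite !mu_nu //; last exact: cTf.
    rewrite /nu mulrCA; congr (_ * _).
    exact: conv_unique (nu0P _ (cTf _ cf)) (conv_ruelle (nu0P _ cf)).
  split.
    rewrite mu_nu; last exact: (CK_scale cK (c := t) ch).
    by rewrite nuZ // /nu (conv_unique (nu0P _ ch) conv_h) mulr1 divff ?gt_eqF.
  move=> f cf; rewrite mu_nu //; apply/cvgrPdist_le => e /(nu0P _ cf)[N Ne].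
  exists N => // n /= Nn; rewrite sub0r normrN ger0_norm; last first.
    have [x Kx] := K0; apply: le_trans (normr_ge0 _) (supnorm_ge cK _ Kx).
    apply: (CK_sub cK (CK_scale cK (c := _) _) (CK_scale cK (c := _) (CK_scale cK (c := t) ch))).
    exact: (iter_ruelle_CK cK wK nw cp (n := n) cf).
  apply: (supnorm_le K0) => x Kx; rewrite /nu mulrACA mulVf ?gt_eqF // mul1r.
  exact: Ne.
split=> // h' mu' D'; have [hh mm] := ruelle_data_unique D D'.
split=> // A mA; apply: mu_unique => //; first by have [] := D'.
by move=> f cf; rewrite mm // mu_nu.
Qed.

End Normalization.
End RuelleTheorem.

(** * Continuity, contraction and positivity constants from the hypotheses *)

Lemma dini_modulus_CK (R : realType) (d : nat) (K : set 'rV[R]_d) (p : 'rV[R]_d -> R)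
    (th S : R) (b : nat -> R) : compact K -> 0 < th -> (forall n, \sum_(k < n) b k <= S) ->
  (forall k x y, K x -> K y -> enorm (x - y) <= th ^+ k.+1 -> `|p x - p y| <= b k) ->
  CK K p.
Proof.
move=> cK th0 bS pb; apply: ucont_CK => // e e0.
have [l bl] := summable_tail bS e0; exists (th ^+ l.+1); first exact: exprn_gt0.
move=> x y Kx Ky xy; apply: le_trans (pb _ _ _ Kx Ky xy) _.
by have := bl 1%N; rewrite big_ord1 addn0.
Qed.

Section AverageLipschitz.
Context (R : realType) (d m : nat) (K : set 'rV[R]_d).
Context (w : 'I_m -> 'rV[R]_d -> 'rV[R]_d) (p : 'I_m -> 'rV[R]_d -> R).
Hypotheses (K0 : K !=set0) (cK : compact K).
Hypotheses (nw : forall j, nonexpansive K (w j)) (cp : forall j, CK K (p j)).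
Hypothesis p0 : forall j x, K x -> 0 < p j x.

Let ratio j x := [set enorm (w j x - w j y) / enorm (x - y) | y in K `\ x].

Let ratio_le1 j x : K x -> ubound (ratio j x) 1.
Proof.
move=> Kx _ [y [Ky yx] <-]; rewrite ler_pdivrMr ?mul1r; first exact: nw.
rewrite lt_neqAle enorm_ge0 andbT eq_sym enorm_eq0 subr_eq0.
by apply/eqP => xy; apply: yx.
Qed.

Let ratio_ub j x : K x -> has_ubound (ratio j x).
Proof. by move=> Kx; exists 1; exact: ratio_le1. Qed.

Let lipschitz_at_ge0 j x : K x -> 0 <= lipschitz_at K (w j) x.
Proof.
move=> Kx; rewrite /lipschitz_at -/(ratio j x).
have [->|/set0P[z rz]] := eqVneq (ratio j x) set0; first by rewrite sup0.
apply: le_trans (ub_le_sup (ratio_ub j Kx) rz).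
by have [y _ <-] := rz; rewrite divr_ge0 ?enorm_ge0.
Qed.

Let lipschitz_at_le1 j x : K x -> lipschitz_at K (w j) x <= 1.
Proof.
move=> Kx; rewrite /lipschitz_at -/(ratio j x).
have [->|/set0P ne] := eqVneq (ratio j x) set0; first by rewrite sup0.
by apply: ge_sup => //; exact: ratio_le1.
Qed.

Let le_average x : K x ->
  \sum_(j < m) p j x * lipschitz_at K (w j) x <= average_lipschitz K w p.
Proof.
move=> Kx; apply: ub_le_sup; last by exists x.
have /choice[M MP] : forall j, exists M, forall x, K x -> p j x <= M.
  move=> j; have [M _ pM] := CK_bounded cK (@cp j); exists M => y Ky.
  exact: le_trans (ler_norm _) (pM _ Ky).
exists (\sum_(j < m) M j) => _ [y Ky <-]; apply: ler_sum => j _.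
rewrite -[leRHS]mulr1; apply: ler_pM; rewrite ?(ltW (p0 _ Ky)) ?lipschitz_at_ge0 ?lipschitz_at_le1 //.
exact: MP.
Qed.

Lemma average_lipschitz_ge0 : 0 <= average_lipschitz K w p.
Proof.
have [x Kx] := K0; apply: le_trans (le_average Kx).
by apply: sumr_ge0 => j _; rewrite mulr_ge0 ?lipschitz_at_ge0 ?(ltW (p0 _ Kx)).
Qed.

(** Nonexpansiveness bounds the difference quotients by 1 and compactness bounds the weights, so
    both real suprema are genuine upper bounds. *)
Lemma average_lipschitz_contraction x y : K x -> K y ->
  \sum_(j < m) p j x * enorm (w j x - w j y) <= average_lipschitz K w p * enorm (x - y).
Proof.
move=> Kx Ky; apply: le_trans (ler_wpM2r (enorm_ge0 _) (le_average Kx)).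
rewrite mulr_suml; apply: ler_sum => j _; rewrite -mulrA.
apply: ler_wpM2l; first by rewrite ltW ?p0.
have [xy|xy] := eqVneq (enorm (x - y)) 0.
  by rewrite xy mulr0 -xy; exact: nw.
rewrite -ler_pdivrMr ?lt_neqAle ?enorm_ge0 ?andbT 1?eq_sym //.
apply: ub_le_sup; first exact: ratio_ub.
exists y => //; split=> // yx; move/eqP: xy; apply.
by rewrite yx subrr; apply/eqP; rewrite enorm_eq0.
Qed.

End AverageLipschitz.

Lemma CK_pos_lower (R : realType) (d m : nat) (K : set 'rV[R]_d) (p : 'I_m -> 'rV[R]_d -> R) :
  compact K -> K !=set0 -> (forall j, CK K (p j)) -> (forall j x, K x -> 0 < p j x) ->
  exists2 c : R, 0 < c & forall j x, K x -> c <= p j x.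
Proof.
move=> cK K0 cp p0.
have /choice[a aP] : forall j, exists a, 0 < a /\ forall x, K x -> a <= p j x.
  move=> j; have [x Kx xm] := CK_min cK K0 (@cp j); exists (p j x).
  by split=> //; exact: p0.
have s0 : 0 <= \sum_(j < m) (a j)^-1.
  by apply: sumr_ge0 => j _; rewrite invr_ge0 ltW // (aP j).1.
(* Its inverse exceeds every 1 / a_j, so it lies below all the a_j; it is positive even for m =
   0. *)
exists (1 + \sum_(j < m) (a j)^-1)^-1; first by rewrite invr_gt0 ltr_wpDr.
move=> j x Kx; apply: le_trans ((aP j).2 _ Kx).
have aj := (aP j).1.
rewrite -[leRHS]invrK lef_pV2 ?posrE ?invr_gt0 ?ltr_wpDr //.
rewrite (bigD1 j) //= addrCA lerDl addr_ge0 //.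
by apply: sumr_ge0 => i _; rewrite invr_ge0 ltW // (aP i).1.
Qed.

Theorem theorem1p2 (R : realType) (d m : nat) (X : set 'rV[R]_d)
    (w : 'I_m -> 'rV[R]_d -> 'rV[R]_d) (p : 'I_m -> 'rV[R]_d -> R)
    (K : set 'rV[R]_d)
    (hsys : nonexpansive_system X w p)
    (hwc : exists j, weakly_contractive X (w j))
    (hK : invariant_set X w K)
    (hrho : average_lipschitz K w p < spectral_radius K (ruelle w p)) :
  ruelle_operator_theorem K (ruelle w p) (spectral_radius K (ruelle w p)).
Proof.
have [X0 cX wX nwX pX0 diniX] := hsys; have [j1 wc] := hwc.
have [[K0 cK KX KE] _] := hK.
have wK j x : K x -> K (w j x) by move=> Kx; rewrite KE; exists j => //; exists x.
have nw j : nonexpansive K (w j) by move=> x y Kx Ky; apply: nwX; exact: KX.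
have p0 j x : K x -> 0 < p j x by move=> Kx; apply: pX0; exact: KX.
have half_lt1 : 2^-1 < 1 :> R by lra.
have half_gt0 : 0 < 2^-1 :> R by lra.
(* Continuity must precede the choice of [th], which depends on rho > 0 and hence on this
   continuity; so the Dini sums are first taken at ratio 1/2. *)
have cp j : CK K (p j).
  have [b [_ [S bS] pb]] := dini_summable half_gt0 half_lt1 (diniX j) X0.
  apply: (dini_modulus_CK cK half_gt0 bS) => k x y Kx Ky.
  by apply: pb; exact: KX.
set T := ruelle w p in hrho *; set rho := spectral_radius K T in hrho *.
have rho0 : 0 < rho := spectral_radius_gt0 K0 cK wK nw cp p0 j1.
set eta := average_lipschitz K w p in hrho.
have eta0 : 0 <= eta := average_lipschitz_ge0 K0 cK nw cp p0.
(* [th] is the midpoint of [lam] and 1. *)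
pose lam := rho^-1 * eta; pose th := (lam + 1) / 2.
have lam0 : 0 <= lam by rewrite mulr_ge0 ?invr_ge0 // ltW.
have lam1 : lam < 1 by rewrite /lam mulrC ltr_pdivrMr // mul1r.
have lam_th : lam < th by rewrite /th; lra.
have th1 : th < 1 by rewrite /th; lra.
have th0 : 0 < th by rewrite /th; lra.
have ri0 : 0 < rho^-1 by rewrite invr_gt0.
pose q j x := rho^-1 * p j x.
have q0 j x : K x -> 0 < q j x by move=> Kx; rewrite mulr_gt0 ?p0.
have cq j : CK K (q j) by exact: (CK_scale cK (c := rho^-1) (@cp j)).
have qE n f : iter n (ruelle w q) f = fun x => rho ^- n * iter n T f x.
  by rewrite /q ruelle_scale_weights exprVn.
have [c0 c0_gt0 c0_le] := CK_pos_lower cK K0 cq q0.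
have /choice[bj bjP] := fun j => dini_summable th0 th1 (diniX j) X0.
have /choice[Sj SjP] : forall j, exists S, forall n, \sum_(k < n) bj j k <= S.
  by move=> j; have [] := bjP j.
(* Summing over j gives one summable sequence that bounds the oscillation of all the weights. *)
pose b k := rho^-1 * \sum_(j < m) bj j k.
have bj0 j k : 0 <= bj j k by have [] := bjP j.
have b0 k : 0 <= b k by rewrite mulr_ge0 ?(ltW ri0) ?sumr_ge0.
have bS n : \sum_(k < n) b k <= rho^-1 * \sum_(j < m) Sj j.
  rewrite -mulr_sumr; apply: ler_wpM2l; first exact: ltW.
  by rewrite exchange_big /=; apply: ler_sum => j _; exact: SjP.
have q_mod j k x y : K x -> K y -> enorm (x - y) <= th ^+ k.+1 -> `|q j x - q j y| <= b k.
  move=> Kx Ky xy; rewrite /q -mulrBr normrM gtr0_norm //.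
  apply: ler_wpM2l; first exact: ltW.
  rewrite (bigD1 j) //=; apply: ler_wpDr; first by rewrite sumr_ge0.
  by have [_ _ pb] := bjP j; apply: pb => //; exact: KX.
have [B0 B0_ge] : exists B0, forall j x y, K x -> K y -> `|q j x - q j y| <= B0.
  have /choice[M MP] : forall j, exists M, 0 < M /\ forall x, K x -> `|q j x| <= M.
    by move=> j; have [M M0 qM] := CK_bounded cK (@cq j); exists M.
  exists (\sum_(j < m) (M j + M j)) => j x y Kx Ky.
  apply: le_trans (ler_normB _ _) _; rewrite (bigD1 j) //=; apply: ler_wpDr.
    by apply: sumr_ge0 => i _; rewrite addr_ge0 ?(ltW (MP i).1).
  by apply: lerD; apply: (MP j).2.
have mean_contraction x y : K x -> K y ->
    \sum_(j < m) q j x * enorm (w j x - w j y) <= lam * enorm (x - y).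
  move=> Kx Ky; rewrite /lam -mulrA.
  have -> : \sum_(j < m) q j x * enorm (w j x - w j y) =
      rho^-1 * \sum_(j < m) p j x * enorm (w j x - w j y).
    by rewrite mulr_sumr; apply: eq_bigr => j _; rewrite mulrA.
  apply: ler_wpM2l; first exact: ltW.
  exact: average_lipschitz_contraction.
have norm_ge1 n (C : R) : (forall x, K x -> iter n (ruelle w q) (fun=> 1) x <= C) -> 1 <= C.
  move=> H; have rX : 0 < rho ^+ n by rewrite exprn_gt0.
  have : rho ^+ n <= C * rho ^+ n.
    apply: (spectral_radius_expr_le K0 cK wK nw cp p0 j1) => x Kx.
    by rewrite -ler_pdivrMr // mulrC; have := H x Kx; rewrite qE.
  by rewrite -ler_pdivrMr // divff ?gt_eqF.
have min_le1 n (a : R) : (0 < n)%N ->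
    (forall x, K x -> a <= iter n (ruelle w q) (fun=> 1) x) -> a <= 1.
  move=> n0 H; have rX : 0 < rho ^+ n by rewrite exprn_gt0.
  apply: (spectral_radius_expr_ge K0 cK wK nw cp p0 j1 n0) => x Kx.
  by rewrite -ler_pdivlMr // mulrC; have := H x Kx; rewrite qE.
have [B _ B_ge] := iter_one_upper K0 cK wK nw cq q0 c0_gt0 c0_le B0_ge lam0 lam_th th1
  mean_contraction b0 bS q_mod min_le1.
have [A A0 A_le] := iter_one_lower K0 cK wK nw cq q0 c0_gt0 c0_le B0_ge lam0 lam_th th1
  mean_contraction b0 bS q_mod norm_ge1 min_le1.
have equi f e := @iter_equicontinuous _ _ _ _ _ _ K0 cK wK nw cq q0 _ _ _ _ _ _ c0_gt0 c0_le B0_ge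
  lam0 lam_th th1 mean_contraction b0 bS q_mod min_le1 f e.
have [h [ch hA Lh]] := eigenfunction_exists wK A_le B_ge
  (fun e => @equi _ e (CK_cst (K := K) (c := 1))).
have h0 x : K x -> 0 < h x by move=> Kx; apply: lt_le_trans (hA _ Kx).
have Th x : K x -> T h x = rho * h x.
  move=> Kx; rewrite -(Lh x Kx); have := qE 1%N h; rewrite /= => ->.
  by rewrite expr1 mulVKf ?gt_eqF.
apply: (ruelle_theorem_of_convergence K0 cK wK nw cp p0 rho0 ch h0 Th) => f cf.
have [l lP] := ruelle_converges K0 cK wK nw cq c0_gt0 c0_le ch h0 Lh
  (words_dense X0 cX wX nwX wc hK) equi (ex_intro _ B B_ge) cf.
exists l => e /lP[N Ne]; exists N => n x nN Kx.
by have := Ne n x nN Kx; rewrite qE.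
Qed.
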